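(* Let $n>0$ and let $T_{2,n}$ denote the annular $(2,n)$ torus link, i.e. the annular closure of the braid $\sigma^{-n}$, where $\sigma$ is the positive generator of the 2-strand braid group (both strands oriented in parallel). The quantum annular Khovanov homology of $T_{2,n}$ is given by $$\mathrm{qAKh}^{i,j}(T_{2,n})=\begin{cases}V_2&\text{if }i=0\text{ and }j=-n,\\ V_0/(q^2+(-1)^i)&\text{if }-n+1\leqslant i\leqslant-1\text{ and }j=2i-n,\\ K(q^2-(-1)^i)&\text{if }-n\leqslant i\leqslant-2\text{ and }j=2i-n+2,\\ V_0&\text{if }i=-n\text{ and }j=-3n,\\ 0&\text{else},\end{cases}$$ where $V_0=\Bbbk$ is the trivial representation of $\mathcal U_q(\mathfrak{sl}_2)$, $V_2:=(V\otimes V)/\mathrm{span}_\Bbbk\{v_+\otimes v_-+q^{-1}v_-\otimes v_+\}$ is the simple representation of $\mathcal U_q(\mathfrak{sl}_2)$ of dimension 3, and $K(a):=\{v\in V_0\mid av=0\}$ for any $a\in\Bbbk$. Here $i$ and $j$ are respectively the homological and the quantum degree.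
   Context: $\Bbbk$ is a commutative unital ring with a fixed invertible element $q$; $I=[0,1]$. $\{d\}$ raises the internal degree by $d$: $M\{d\}_i=M_{i-d}$. $V=\mathrm{span}_\Bbbk\{v_+,v_-\}$, in quantum degree $0$. Chen–Khovanov bimodules. A flat $(m,n)$-tangle is an unoriented properly embedded 1-manifold in $\mathbb R\times I$ with $m$ bottom and $n$ top endpoints; $T'T$ is $T'$ stacked on top of $T$. A generalized cup diagram with $n$ termini is an isotopy class of collections of disjoint arcs in the lower half-plane attached to $n$ points (termini) on the horizontal line, each terminus being an end of exactly one arc, where each arc either joins two termini or joins a terminus to the left or the right platform (vertical lines hanging to the left and to the right of all termini). $GM^n(\lambda)$ is the set of those of weight $\lambda$ = (number of arcs ending on the right platform) $-$ (number ending on the left one); $a^!$ is the reflection of $a$ in the horizontal line. For a flat $(m,n)$-tangle $T$, $a\in GM^m(\lambda)$, $b\in GM^n(\lambda)$, let $b^!Ta$ be the collection of closed planar curves obtained by gluing $a$ to the bottom and $b^!$ to the top of $T$, identifying on each side the lower platform with the upper one with arc endpoints matched from inside out, and joining the unmatched endpoints (equally many on each side) by half-circles. $\mathcal F(b^!Ta)$ is the $\Bbbk$-module spanned by all decorations of these curves by dots, modulo: a diagram is zero if some curve meets one of the platforms twice, if a curve meeting a platform carries a dot, or if a curve carries two dots. Cobordisms act by: a birth inserts an undotted circle; a death removes a circle if it is dotted and is zero otherwise; a merge adds the dots; a split gives the sum of two diagrams, each obtained by adding one dot on one of the two resulting curves. $F_{CK}(T)=\bigoplus_\lambda\bigoplus_{a\in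 GM^m(\lambda),b\in GM^n(\lambda)}\mathcal F(b^!Ta)$, likewise for cobordisms. Gluing maps $\mu\colon F_{CK}(T)\otimes F_{CK}(T')\to F_{CK}(T'T)$ are zero on $\mathcal F(b^!Ta)\otimes\mathcal F(d^!T'c)$ if $b\ne c$ and are induced by the surgeries replacing $b\sqcup b^!$ by vertical lines if $b=c$. $A^n:=F_{CK}(n\text{ vertical lines})$ is an algebra with product $\mu$, and $F_{CK}(T)$ is an $(A^m,A^n)$-bimodule, graded by $\deg x=\ell+c-a-2d$, where $\ell$ is the number of loops of $T$, $c$ the number of arcs of $T$ joining bottom endpoints, $d$ the number of dots, and, with all curves oriented counterclockwise and cut by the platforms and the boundary lines of $T$ into vertical lines, caps and cups, $a$ is the number of caps and cups oriented clockwise. Quantum annular homology. For an oriented $(n,n)$-tangle diagram $T$ in $\mathbb R\times I$ with $n_\pm$ positive/negative crossings, let $C^i_{CK}(T)=\bigoplus_{|\xi|=i+n_-}F_{CK}(T_\xi)\{i+n_+-n_-\}$ over $\xi\in\{0,1\}^{\text{crossings}}$, where $T_\xi$ is the resolution (the 0-smoothing joins the two regions swept by rotating the overstrand counterclockwise, the 1-smoothing the other two), with differential the sum of maps induced by saddles changing a 0-smoothing to a 1-smoothing, with signs making squares anticommute. For a graded $(A,A)$-bimodule, $\mathrm{qHH}_0(A,M)=M/\mathrm{span}\{am-q^{|a|}ma\}$. $\mathrm{qAKh}(\widehat T)$ is the homology of the complex with terms $\mathrm{qHH}_0(A^n,C^i_{CK}(T))$, with $\widehat T$ the link in the thickened annulus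 obtained by closing $T$; $i$ is the homological degree and $j$ the degree induced by the grading of $F_{CK}$ (in which trivial circles contribute generators of degree $\pm1$ and essential circles generators of degree $0$). $\mathcal U_q(\mathfrak{sl}_2)$-structure. $\mathcal U_q(\mathfrak{sl}_2)$ has generators $E,F,K^{\pm1}$ with $KE=q^2EK$, $KF=q^{-2}FK$, $K-K^{-1}=(q-q^{-1})(EF-FE)$, comultiplication $E\mapsto E\otimes K+1\otimes E$, $F\mapsto F\otimes1+K^{-1}\otimes F$, $K\mapsto K\otimes K$. $V$ carries the actions $V_1$ ($Ev_-=v_+$, $Fv_+=v_-$, $Kv_\pm=q^{\pm1}v_\pm$, others $0$) and $V_1^*$ (the same with $E,F$ negated). $\mathrm{qHH}_0(A^n)\cong V^{\otimes n}$ with $V_1,V_1^*$ alternating (so $V\otimes V$ above is $V_1\otimes V_1^*$), so that $S^1\times\text{cap}$ and $S^1\times\text{cup}$ induce $\mathrm{ev}\colon v_+\otimes v_-\mapsto q,\ v_-\otimes v_+\mapsto1,\ v_\pm\otimes v_\pm\mapsto0$ and $\mathrm{coev}\colon1\mapsto v_+\otimes v_-+q^{-1}v_-\otimes v_+$; trivial circles contribute trivial representations. *)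

(* Defs.v *)
From HB Require Import structures.
From mathcomp Require Import all_boot all_order all_algebra.
From mathcomp Require Import ring.

Set Implicit Arguments.
Unset Strict Implicit.
Unset Printing Implicit Defensive.

Import Order.TTheory GRing.Theory Num.Theory.
Local Open Scope ring_scope.

(** * Generalized cup diagrams

    [w] is the number of termini.  [a i = inl j] means that an arc joins the
    termini [i] and [j]; [a i = inr s] that an arc joins [i] to the left
    ([s = false]) or right ([s = true]) platform.  An isotopy class is
    determined by this data, and the conditions below say that it is
    realized by disjoint arcs. *)

Section CupDiagrams.
Variable w : nat.

Definition is_cup_diagram (a : {ffun 'I_w -> 'I_w + bool}) : bool :=
  [&& [forall i, forall j, (a i == inl j) ==> (a j == inl i) && (i != j)],
      [forall i, forall j, forall k : 'I_w,
         (a i == inl j) && (i < k < j)%N ==>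
         (if a k is inl m then (i < m < j)%N else false)]
    & [forall i : 'I_w, forall j : 'I_w,
         (a i == inr false) && (a j == inr true) ==> (i < j)%N]].

Definition GM := {a : {ffun 'I_w -> 'I_w + bool} | is_cup_diagram a}.

Definition platform_arcs (a : GM) (s : bool) : nat :=
  #|[set i | val a i == inr s]|.

Definition weight (a : GM) : int :=
  (platform_arcs a true)%:Z - (platform_arcs a false)%:Z.

(** When a diagram is closed up, a platform becomes a row of points on the
    horizontal line, numbered from inside out: on the line one sees
    ..., (false,1), (false,0), termini, (true,0), (true,1), ...
    A platform has at most [w] ends of arcs. *)
Definition endpt := ('I_w + bool * 'I_w)%type.

Definition pos (x : endpt) : nat :=
  match x with
  | inl i => w + i
  | inr (false, m) => w.-1 - m
  | inr (true, m) => w + w + m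
  end.

(** Index, from inside out, of the end on the platform [s] of the arc
    starting at the terminus [i]. *)
Definition platform_index (a : GM) (s : bool) (i : 'I_w) : nat :=
  #|[set j : 'I_w | (val a j == inr s) && (if s then (i < j)%N else (j < i)%N)]|.

(** The arcs of [a], together with the half-circles that join the unused
    points of the two platforms.  If two diagrams [a], [b] of equal weight
    are glued, a platform point used in only one of them lies on the
    half-circle of the other one.  The points used in neither lie on undotted
    circles meeting both platforms once, which do not change the modules below
    (points with no partner in range are isolated); keeping them
    makes the set of platform points the same for all diagrams. *)
Definition arc (a : GM) (x y : endpt) : bool :=
  let end_of i (p : bool * 'I_w) :=
    (val a i == inr p.1) && (platform_index a p.1 i == p.2) in
  match x, y with
  | inl i, inl j => val a i == inl j
  | inl i, inr p => end_of i p
  | inr p, inl i => end_of i p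
  | inr (s, m), inr (s', m') =>
      [&& s != s', (platform_arcs a s <= m)%N, (platform_arcs a s' <= m')%N
        & (m - platform_arcs a s == m' - platform_arcs a s')%N]
  end.

Definition arcs (a : GM) : seq (endpt * endpt) :=
  [seq p <- enum {: endpt * endpt} | arc a p.1 p.2 && (pos p.1 < pos p.2)%N].

End CupDiagrams.

(** * Closed curves as connected components of a finite graph *)

Section Curves.
Variable P : finType.
Implicit Types (e : rel P) (p s : P) (S : {set P}).

Definition same_curve e p s : bool := connect [rel x y | e x y || e y x] p s.

Definition curve e p : {set P} := [set x | same_curve e p x].

(** A decorated diagram with at most one dot on each curve is encoded by the
    union [S] of its dotted curves. *)
Definition is_decoration e S : bool :=
  [forall x, forall y, same_curve e x y ==> ((x \in S) == (y \in S))].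

Definition dots e S : nat := #|[set curve e x | x in S]|.

(** Matrix entry, from [S] to [S'], of a saddle changing the diagram [e] into
    [e'], where [p] and [s] lie on different local arcs both before and after
    the surgery: a merge adds the dots, a split adds one dot to one of the two
    new curves, and two dots on the same curve give zero. *)
Definition saddle e e' p s S S' : bool :=
  [&& is_decoration e' S',
      [forall x, ~~ same_curve e p x && ~~ same_curve e s x ==>
                 ((x \in S') == (x \in S))]
    & if same_curve e p s
      then (p \in S') + (s \in S') == (p \in S) + 1
      else (p \in S') == (p \in S) + (s \in S) :> nat]%N.

End Curves.

(** * Flat tangles and their Chen-Khovanov modules

    A flat tangle is a stack, listed from bottom to top, of slices on [w]
    strands: [None] consists of vertical lines; [Some i] has a cap and a cup
    at the strands [i], [i+1] (the cap joins two points of the bottom line of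
    the slice, the cup two points of its top line). *)

Section FlatTangles.
Variable w : nat.

Definition slice := option 'I_w.-1.
Definition flat (l : nat) := l.-tuple slice.

Definition vertical : flat 0 := [tuple].

(** The [l+1] horizontal lines separating the slices, and the platforms. *)
Definition pt (l : nat) := ('I_l.+1 * 'I_w + bool * 'I_w)%type.

Definition at_line l (m : 'I_l.+1) (x : endpt w) : pt l :=
  match x with inl i => inl (m, i) | inr p => inr p end.

Definition turns (c : slice) (i j : 'I_w) : bool :=
  if c is Some r then (i == r :> nat) && (j == r.+1 :> nat) else false.

Definition passes (c : slice) (i j : 'I_w) : bool :=
  (i == j) &&
  (if c is Some r then (i != r :> nat) && (i != r.+1 :> nat) else true).

Definition strand l (T : flat l) (x y : pt l) : bool :=
  match x, y with
  | inl (m, i), inl (m', j) =>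
      [exists r : 'I_l,
        [|| [&& m == r :> nat, m' == r :> nat & turns (tnth T r) i j],
            [&& m == r.+1 :> nat, m' == r.+1 :> nat & turns (tnth T r) i j]
          | [&& m == r :> nat, m' == r.+1 :> nat & passes (tnth T r) i j]]]
  | _, _ => false
  end.

Definition arcs_at l (m : 'I_l.+1) (A : seq (endpt w * endpt w)) (x y : pt l)
    : bool :=
  has (fun p => (x == at_line m p.1) && (y == at_line m p.2)) A.

(** The closed curves [b^! T a]. *)
Definition closed_diagram l (T : flat l) (a b : GM w) : rel (pt l) :=
  [rel x y | [|| strand T x y, arcs_at ord0 (arcs a) x y
               | arcs_at ord_max (arcs b) x y]].

Definition meets_platform_twice l (e : rel (pt l)) : bool :=
  [exists s : bool, exists m : 'I_w, exists m' : 'I_w,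
     (m != m') && same_curve e (inr (s, m)) (inr (s, m'))].

(** Candidate generators of [F_CK(T)]: bottom diagram, top diagram, union of
    the dotted curves. *)
Definition gen l := (GM w * GM w * {set pt l})%type.
Definition gbot l (g : gen l) : GM w := g.1.1.
Definition gtop l (g : gen l) : GM w := g.1.2.
Definition gdot l (g : gen l) : {set pt l} := g.2.
Definition gcurves l (T : flat l) (g : gen l) : rel (pt l) :=
  closed_diagram T (gbot g) (gtop g).

(** The diagrams that are not set to zero; they form the basis of [F_CK(T)]. *)
Definition in_basis l (T : flat l) (g : gen l) : bool :=
  [&& weight (gbot g) == weight (gtop g),
      ~~ meets_platform_twice (gcurves T g),
      is_decoration (gcurves T g) (gdot g)
    & [forall p : bool * 'I_w, inr p \notin gdot g]].

(** The degree.  On a horizontal line, a closed curve oriented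
    counterclockwise crosses alternately downwards and upwards, starting with
    downwards at the leftmost crossing; a cap or a cup is then counterclockwise
    if and only if the curve goes down at its left end. *)
Definition clockwise l (e : rel (pt l)) (m : 'I_l.+1) (x : endpt w) : bool :=
  odd #|[set y | (pos y < pos x)%N && same_curve e (at_line m y) (at_line m x)]|.

(** Pairs of points on the line [m] joined by an arc of [T]. *)
Definition tangle_arcs l (T : flat l) (m : 'I_l.+1) : {set 'I_w * 'I_w} :=
  [set p : 'I_w * 'I_w | (p.1 < p.2)%N &&
           same_curve (strand T) (inl (m, p.1)) (inl (m, p.2))].

Definition clockwise_pieces l (T : flat l) (g : gen l) : nat :=
  (count (fun p => clockwise (gcurves T g) ord0 p.1) (arcs (gbot g))
   + count (fun p => clockwise (gcurves T g) ord_max p.1) (arcs (gtop g))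
   + #|[set p in tangle_arcs T ord0 | clockwise (gcurves T g) ord0 (inl p.1)]|
   + #|[set p in tangle_arcs T ord_max
        | clockwise (gcurves T g) ord_max (inl p.1)]|)%N.

Definition loops l (T : flat l) : nat :=
  #|[set C in [set curve (strand T) x | x in setT]
     | [forall x in C,
         if x is inl (m, _) then (0 < m < l)%N else false]]|.

Definition deg l (T : flat l) (g : gen l) : int :=
  (loops T)%:Z + (#|tangle_arcs T ord0|)%:Z
  - (clockwise_pieces T g)%:Z - (2 * dots (gcurves T g) (gdot g))%:Z.

(** ** Gluing *)

(** [(b^! T a) \sqcup (c^! T' b)] after the surgeries along the arcs of [b] in
    [done]: such an arc and its mirror image are replaced by two vertical
    lines. *)
Definition surgered l l' (T : flat l) (T' : flat l') (a b c : GM w)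
    (done : seq (endpt w * endpt w)) : rel (pt l + pt l') :=
  let todo := [seq p <- arcs b | p \notin done] in
  [rel x y |
    match x, y with
    | inl x, inl y =>
        [|| strand T x y, arcs_at ord0 (arcs a) x y | arcs_at ord_max todo x y]
    | inr x, inr y =>
        [|| strand T' x y, arcs_at ord0 todo x y | arcs_at ord_max (arcs c) x y]
    | inl x, inr y =>
        has (fun p => [exists u : endpt w,
               [&& (u == p.1) || (u == p.2), x == at_line ord_max u
                 & y == at_line ord0 u]]) done
    | inr _, inl _ => false
    end].

(** Composition of the surgeries along the arcs in [todo]: number of ways in
    which [S'] arises from [S]. *)
Fixpoint surgeries l l' (T : flat l) (T' : flat l') (a b c : GM w)
    (todo done : seq (endpt w * endpt w)) (S S' : {set (pt l + pt l')}) : nat :=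
  if todo is p :: todo' then
    (\sum_(S1 | saddle (surgered T T' a b c done)
                       (surgered T T' a b c (p :: done))
                       (inl (at_line ord_max p.1)) (inr (at_line ord0 p.2))
                       S S1)
       surgeries T T' a b c todo' (p :: done) S1 S')%N
  else (S == S').

(** The projection from the points of the two pieces to those of the stack;
    only used with [l'' = l + l']. *)
Definition stack l l' l'' (x : pt l + pt l') : pt l'' :=
  match x with
  | inl (inl (m, i)) => inl (inord m, i)
  | inr (inl (m, i)) => inl (inord (l + m), i)
  | inl (inr p) | inr (inr p) => inr p
  end.

Definition disjoint_union l l' (S : {set pt l}) (S' : {set pt l'})
    : {set (pt l + pt l')} :=
  [set x | match x with inl x => x \in S | inr x => x \in S' end].

(** Matrix entry of [mu] from [g], [g'] to [h], where [T''] is [T'] stacked on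
    top of [T]. *)
Definition mu_coef l l' l'' (T : flat l) (T' : flat l') (T'' : flat l'')
    (g : gen l) (g' : gen l') (h : gen l'') : nat :=
  if [&& gtop g == gbot g', gbot h == gbot g, gtop h == gtop g'
       & in_basis T'' h]
  then surgeries T T' (gbot g) (gtop g) (gtop g') (arcs (gtop g)) [::]
         (disjoint_union (gdot g) (gdot g')) (@stack l l' l'' @^-1: gdot h)
  else 0.

End FlatTangles.

(** * Presented modules and representations of U_q(sl_2) *)

Section Representations.
Variables (k : comPzRingType) (q qi : k).

Inductive span (V : lmodType k) (G : V -> Prop) : V -> Prop :=
| span_zero : span G 0
| span_add c v x : G v -> span G x -> span G (c *: v + x).

(** Powers of [q] with inverse [qi]. *)
Definition qpow (z : int) : k :=
  match z with Posz m => q ^+ m | Negz m => qi ^+ m.+1 end.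

(** The subquotient [num / den] of [amb], where [E], [F], [K], [K^-1] act
    through representatives. *)
Record Uq_obj := UqObj {
  amb : lmodType k;
  num : amb -> Prop;
  den : amb -> Prop;
  opE : amb -> amb;
  opF : amb -> amb;
  opK : amb -> amb;
  opKi : amb -> amb
}.

Definition preserves (M : Uq_obj) (X : amb M -> amb M) : Prop :=
  forall x, num x -> num (X x) /\ (den x -> den (X x)).

Definition is_Uq_module (M : Uq_obj) : Prop :=
  [/\ preserves (@opE M), preserves (@opF M), preserves (@opK M)
    & preserves (@opKi M)] /\
  forall x, @num M x ->
    [/\ den (opK (opKi x) - x),
        den (opKi (opK x) - x),
        den (opK (opE x) - q ^+ 2 *: opE (opK x)),
        den (opK (opF x) - qi ^+ 2 *: opF (opK x))
      & den (opK x - opKi x - (q - qi) *: (opE (opF x) - opF (opE x)))].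

(** [f], defined on representatives, commutes modulo [den] with an operator. *)
Definition intertwines (M N : Uq_obj) (f : amb M -> amb N)
    (X : amb M -> amb M) (Y : amb N -> amb N) : Prop :=
  forall x, num x -> num (X x) /\ den (f (X x) - Y (f x)).

(** [f] sends representatives to representatives and induces a linear
    bijection [num M / den M -> num N / den N] that commutes with the
    generators of U_q(sl_2). *)
Definition Uq_iso (M N : Uq_obj) : Prop :=
  exists f : amb M -> amb N,
    [/\ (forall x, num x -> num (f x)),
        (forall c x y, num x -> num y ->
           den (f (c *: x + y) - (c *: f x + f y))),
        (forall x, num x -> (den (f x) <-> den x))
      & (forall y, num y -> exists2 x, num x & den (y - f x))] /\
    [/\ intertwines f (@opE M) (@opE N),
        intertwines f (@opF M) (@opF N),
        intertwines f (@opK M) (@opK N)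
      & intertwines f (@opKi M) (@opKi N)].

(** Matrices of the action on [V_1]; [true] stands for [v_+]. *)
Definition matI (u v : bool) : k := (u == v)%:R.
Definition matE (u v : bool) : k := (u && ~~ v)%:R.
Definition matF (u v : bool) : k := (~~ u && v)%:R.
Definition matK (u v : bool) : k := (u == v)%:R * (if v then q else qi).
Definition matKi (u v : bool) : k := (u == v)%:R * (if v then qi else q).
(** [E] and [F] on [V_1^*]; there [K] acts as on [V_1]. *)
Definition matE_dual u v : k := - matE u v.
Definition matF_dual u v : k := - matF u v.

Definition VV := {ffun bool * bool -> k^o}.

Definition tens (X Y : bool -> bool -> k) (x : VV) : VV :=
  [ffun u => \sum_(v : bool * bool) X u.1 v.1 * Y u.2 v.2 * x v].

(** The action on [V_1 \otimes V_1^*] given by the comultiplication. *)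
Definition VV_E (x : VV) : VV := tens matE matK x + tens matI matE_dual x.
Definition VV_F (x : VV) : VV := tens matF matI x + tens matKi matF_dual x.
Definition VV_K (x : VV) : VV := tens matK matK x.
Definition VV_Ki (x : VV) : VV := tens matKi matKi x.

Definition vv (u : bool * bool) : VV := [ffun v => (v == u)%:R].
Definition coev1 : VV := vv (true, false) + qi *: vv (false, true).

Definition V2 : Uq_obj :=
  @UqObj VV (fun _ => True) (span (fun v => v = coev1)) VV_E VV_F VV_K VV_Ki.

Definition trivial_obj (N D : k^o -> Prop) : Uq_obj :=
  @UqObj k^o N D (fun _ => 0) (fun _ => 0) id id.

Definition V0 : Uq_obj := trivial_obj (fun _ => True) (fun v => v = 0).
(** [V_0 / a] *)
Definition V0_mod (a : k) : Uq_obj :=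
  trivial_obj (fun _ => True) (fun v => exists u : k, v = a * u).
Definition V0_ker (a : k) : Uq_obj :=
  trivial_obj (fun v => a * v = 0) (fun v => v = 0).
Definition zero_obj : Uq_obj :=
  trivial_obj (fun v => v = 0) (fun v => v = 0).

End Representations.

(** * The quantum annular homology of a braid closure *)

Section Homology.
Variables (k : comPzRingType) (q qi : k) (w : nat).

(** [F_CK(T)] is the submodule of [mod_amb l] spanned by [in_basis T]. *)
Definition mod_amb l := {ffun gen w l -> k^o}.

Definition in_FCK l (T : flat w l) (x : mod_amb l) : Prop :=
  forall g, x g != 0 -> in_basis T g.

Definition homogeneous l (T : flat w l) (d : int) (x : mod_amb l) : Prop :=
  forall g, x g != 0 -> deg T g = d.

Definition mu l l' l'' (T : flat w l) (T' : flat w l') (T'' : flat w l'')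
    (x : mod_amb l) (y : mod_amb l') : mod_amb l'' :=
  [ffun h => \sum_g \sum_g' (mu_coef T T' T'' g g' h)%:R * x g * y g'].

(** The elements [a m - q^|a| m a], where [A^w = F_CK(vertical w)]. *)
Definition q_commutator l (T : flat w l) (v : mod_amb l) : Prop :=
  exists (a : mod_amb 0) (m : mod_amb l) (d : int),
    [/\ in_FCK (vertical w) a, homogeneous (vertical w) d a, in_FCK T m
      & v = mu (vertical w) T T a m
            - qpow q qi d *: mu T (vertical w) T m a].

(** [F_CK(T) / qHH0_rel T] is [qHH_0(A^w, F_CK(T))]. *)
Definition qHH0_rel l (T : flat w l) : mod_amb l -> Prop :=
  span (q_commutator T).

(** A braid word, read from bottom to top, all strands oriented upwards:
    [(i, true)] is the positive and [(i, false)] the negative crossing of the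
    strands [i] and [i+1]. *)
Definition braid (n : nat) := n.-tuple ('I_w.-1 * bool).

Definition n_plus n (B : braid n) : nat := count (fun c => c.2) B.
Definition n_minus n (B : braid n) : nat := count (fun c => ~~ c.2) B.

Definition vertex (n : nat) := {ffun 'I_n -> bool}.
Definition height n (xi : vertex n) : nat := #|[set r | xi r]|.

(** In a positive (negative) crossing rotating the overstrand counterclockwise
    sweeps the regions above and below (to the left and to the right of) the
    crossing, hence the 0-smoothing consists of two vertical lines (of a cap
    and a cup). *)
Definition resolution n (B : braid n) (xi : vertex n) : flat w n :=
  [tuple (if xi r == (tnth B r).2 then Some (tnth B r).1 else None) | r < n].

(** The ambient module of the whole cube of resolutions. *)
Definition cube n := {ffun vertex n -> mod_amb n}.

Definition in_C n (B : braid n) (i j : int) (x : cube n) : Prop :=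
  forall xi g, x xi g != 0 ->
    [/\ in_basis (resolution B xi) g,
        (height xi)%:Z = i + (n_minus B)%:Z
      & deg (resolution B xi) g + (i + (n_plus B)%:Z - (n_minus B)%:Z) = j].

(** Diagonally opposite corners of the [r]-th crossing. *)
Definition corner n (B : braid n) (r : 'I_n) (top : bool) : pt w n -> bool :=
  fun x => if x is inl (m, i) then
    (m == r + top :> nat)%N && (i == (tnth B r).1 + top :> nat)%N else false.

Definition saddle_coef n (B : braid n) (xi xi' : vertex n) (r : 'I_n)
    (g h : gen w n) : bool :=
  [&& gbot h == gbot g, gtop h == gtop g, in_basis (resolution B xi') h
    & [exists p, exists s, [&& corner B r false p, corner B r true s
        & saddle (gcurves (resolution B xi) g) (gcurves (resolution B xi') g)
                 p s (gdot g) (gdot h)]]].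

Definition clear n (xi : vertex n) (r : 'I_n) : vertex n :=
  [ffun t => (t != r) && xi t].

Definition d_CK n (B : braid n) (x : cube n) : cube n :=
  [ffun xi' : vertex n => [ffun h : gen w n =>
    \sum_(r | xi' r)
       (-1) ^+ #|[set t : 'I_n | (t < r)%N && xi' t]| *
       \sum_g (saddle_coef B (clear xi' r) xi' r g h)%:R * x (clear xi' r) g]].

Definition in_rel n (B : braid n) (x : cube n) : Prop :=
  forall xi, qHH0_rel (resolution B xi) (x xi).

(** Cycles and boundaries, in bidegree [(i,j)], of the complex with terms
    [qHH_0(A^w, C^i_CK)]. *)
Definition cycle_CK n (B : braid n) (i j : int) (x : cube n) : Prop :=
  in_C B i j x /\ in_rel B (d_CK B x).

Definition boundary_CK n (B : braid n) (i j : int) (x : cube n) : Prop :=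
  exists2 y, in_C B (i - 1) j y & in_rel B (x - d_CK B y).

End Homology.

(** * The action of U_q(sl_2) on the homology of 2-braids *)

Section Action.
Variables (k : comPzRingType) (q qi : k).

Definition end_at (a : GM 2) (i : 'I_2) : option bool :=
  if val a i is inr s then Some s else None.

(** The isomorphism [qHH_0(A^2) -> V_1 \otimes V_1^*]: the class of the
    idempotent of [a], the undotted diagram in [F(a^! a)], goes to the tensor
    with [v_-] ([v_+]) for an arc ending on the left (right) platform and
    [coev 1] for an arc joining two termini; the other generators vanish in
    [qHH_0].  This makes S^1 x cup act as [coev], S^1 x cap act as [ev], and
    [K] act on the part of weight [lambda] as [q^lambda]. *)
Definition phi_idem (a : GM 2) : VV k :=
  match end_at a ord0, end_at a ord_max with
  | Some s, Some s' => vv k (s, s')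
  | _, _ => coev1 qi
  end.

Definition phi l (x : mod_amb k 2 l) : VV k := \sum_a x (a, a, set0) *: phi_idem a.

(** A section of [phi], hence the inverse map to [qHH_0(A^2)]. *)
Definition psi l (v : VV k) : mod_amb k 2 l :=
  [ffun g => if (gbot g == gtop g) && (gdot g == set0) then
     match end_at (gbot g) ord0, end_at (gbot g) ord_max with
     | Some s, Some s' =>
         if ~~ s && s' then v (false, true) - qi * v (true, false)
         else v (s, s')
     | _, _ => v (true, false)
     end
   else 0].

(** The action on the complex: if all slices are vertical, the closure of the
    resolution consists of two essential circles and the action is that on
    [V_1 \otimes V_1^*]; otherwise it consists of trivial circles only, and
    the representation is trivial ([X0] is the action of the generator on a
    trivial representation). *)
Definition act (X : VV k -> VV k) (X0 : forall l, mod_amb k 2 l -> mod_amb k 2 l)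
    n (B : braid 2 n) (x : cube k 2 n) : cube k 2 n :=
  [ffun xi : vertex n => if all (fun c => c == None) (resolution B xi)
              then psi n (X (phi (x xi))) else X0 n (x xi)].

Definition qAKh n (B : braid 2 n) (i j : int) : Uq_obj k :=
  @UqObj k (cube k 2 n) (cycle_CK q qi B i j) (boundary_CK q qi B i j)
    (act (@VV_E k q qi) (fun _ _ => 0) B)
    (act (@VV_F k q qi) (fun _ _ => 0) B)
    (act (@VV_K k q qi) (fun _ x => x) B)
    (act (@VV_Ki k q qi) (fun _ x => x) B).

(** [sigma^{-n}] *)
Definition sigma_neg (n : nat) : braid 2 n := [tuple (ord0, false) | r < n].

(** [(-1)^i] *)
Definition sgnz (i : int) : k := (-1) ^+ `|i|%N.

Definition qAKh_T2n_formula (n : nat) (i j : int) : Uq_obj k :=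
  if (i == 0) && (j == - n%:Z) then V2 q qi
  else if (- n%:Z + 1 <= i <= -1) && (j == 2 * i - n%:Z)
  then V0_mod (q ^+ 2 + sgnz i)
  else if (- n%:Z <= i <= -2) && (j == 2 * i - n%:Z + 2)
  then V0_ker (q ^+ 2 - sgnz i)
  else if (i == - n%:Z) && (j == - 3 * n%:Z) then V0 k
  else zero_obj k.

End Action.

(** * The modules in the formula are representations of U_q(sl_2) *)

Section Targets.
Variables (k : comPzRingType) (q qi : k).

Lemma trivial_Uq_module (N D : k^o -> Prop) :
  N 0 -> D 0 -> is_Uq_module q qi (trivial_obj N D).
Proof.
move=> N0 D0; split; first by split=> x /= Nx; split.
by move=> x _ /=; rewrite !(subrr, scaler0, subr0).
Qed.

Lemma tensE (X Y : bool -> bool -> k) (x : VV k) u :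
  tens X Y x u =
    X u.1 true * Y u.2 true * x (true, true)
    + X u.1 true * Y u.2 false * x (true, false)
    + (X u.1 false * Y u.2 true * x (false, true)
    + X u.1 false * Y u.2 false * x (false, false)).
Proof.
pose f a b := X u.1 a * Y u.2 b * x (a, b).
rewrite ffunE (eq_bigr (fun v => f v.1 v.2)); last by case.
by rewrite -(pair_bigA _ f) /= !big_bool.
Qed.

Lemma V2_preserves (X : VV k -> VV k) :
    (forall c x y, X (c *: x + y) = c *: X x + X y) ->
    (exists c, X (coev1 qi) = c *: coev1 qi) ->
  @preserves k (V2 q qi) X.
Proof.
move=> Xlin [c Xc] x _; split=> //=.
elim=> [|b _ y -> _ IH].
  have := Xlin (-1) 0 0.
  by rewrite scaleN1r oppr0 addr0 scaleN1r addNr => ->; apply: span_zero.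
by rewrite Xlin Xc scalerA; apply: span_add.
Qed.

Lemma tensP (X Y : bool -> bool -> k) (c : k) (x y : VV k) :
  tens X Y (c *: x + y) = c *: tens X Y x + tens X Y y.
Proof.
apply/ffunP=> u; rewrite !(tensE, ffunE) /GRing.scale /=; ring.
Qed.

Lemma V2_Uq_module (hq : q * qi = 1) : is_Uq_module q qi (V2 q qi).
Proof.
have hq' : qi * q = 1 by rewrite mulrC.
have lin2 X Y X' Y' (c : k) (x y : VV k) :
      tens X Y (c *: x + y) + tens X' Y' (c *: x + y)
    = c *: (tens X Y x + tens X' Y' x) + (tens X Y y + tens X' Y' y).
  by rewrite !tensP scalerDr addrACA.
split.
  split; apply: V2_preserves; do ?[exact: lin2 | exact: tensP].
  - exists 0; apply/ffunP=> -[[] []];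
      rewrite !(tensE, ffunE) /matK /matI /matE_dual /matE /= ?eqxx /=
        /GRing.scale /=; ring: hq.
  - exists 0; apply/ffunP=> -[[] []];
      rewrite !(tensE, ffunE) /matKi /matI /matF_dual /matF /= ?eqxx /=
        /GRing.scale /=; ring: hq.
  - exists 1; apply/ffunP=> -[[] []];
      rewrite !(tensE, ffunE) /matK /= ?eqxx /= /GRing.scale /=; ring: hq.
  - exists 1; apply/ffunP=> -[[] []];
      rewrite !(tensE, ffunE) /matKi /= ?eqxx /= /GRing.scale /=; ring: hq.
have den0 v : v = 0 -> span (fun v => v = coev1 qi) v.
  by move->; apply: span_zero.
move=> x _ /=; split; apply: den0; apply/ffunP=> -[[] []];
  rewrite /VV_K /VV_Ki /VV_E /VV_F !(tensE, ffunE) /=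
    /matK /matKi /matI /matE_dual /matF_dual /matE /matF /= /GRing.scale /=;
  ring: hq.
Qed.

Lemma formula_Uq_module n i j (hq : q * qi = 1) :
  is_Uq_module q qi (qAKh_T2n_formula q qi n i j).
Proof.
rewrite /qAKh_T2n_formula; case: ifP => _; first exact: V2_Uq_module.
by do 3?[case: ifP => _]; apply: trivial_Uq_module; rewrite ?mulr0 //;
  exists 0; rewrite mulr0.
Qed.

End Targets.

(* Main.v *)
Require Import Defs.
From mathcomp Require Import all_boot all_order all_algebra.
From mathcomp Require Import zify ring.

Set Implicit Arguments.
Unset Strict Implicit.
Unset Printing Implicit Defensive.
Import GRing.Theory.

(** A vertex of the cube of [sigma_neg n] is a stack of [n] slices, each vertical (1-smoothing) or
    turning (0-smoothing). Closing a stack with [z > 0] turning slices in the annulus gives [z]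
    trivial circles, so its [qHH_0] is free on the choices of dots. The all-vertical stack gives two
    essential circles, and there [qHH_0] is [V_1 \otimes V_1^*]. The complex is therefore modelled
    on words: [None] is a vertical slice, and [Some b] is a turning slice whose circle, the one just
    above it, is dotted iff [b]. The differential removes a letter and merges its circle with that
    of the cyclically preceding letter. A dot pushed through the seam, where the top line is glued
    to the bottom line, costs [q^-2]. The empty word stands for [coev1], the image of the last
    saddle.

    A word with [z] letters, [D] of them dotted, lies in bidegree [i = -z], [j = -n - 2D], so the
    complex splits according to [D]. For fixed [D] a discrete Morse matching inserts or deletes an
    undotted letter at the first position that carries no dotted letter. Only two words stay
    unmatched: [bottom_word n D] with [z = D] and, if [D < n], [open_word n D] with [z = D + 1]. Up
    to sign, the Morse differential between them is [gamma D], which is 1 for [D = 0] and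
    [q^-2 + (-1)^D] otherwise: an undotted last letter can be removed, with sign [(-1)^D], or can
    absorb the dot of the first letter through the seam, with factor [q^-2]. The homology is thus
    [k / gamma D] at [z = D] and the kernel of [gamma D] at [z = D + 1]. For [D > 0], [gamma D] is a
    unit times [q^2 + (-1)^D]. For [D = n] only the bottom word exists, which gives [V_0]. For
    [D = 0] the differential is invertible, so [coev1] becomes a boundary and [V_2] is left in
    degree 0.

    The group [qHH_0] is computed by [class_rel] and [class_kernel], and for the vertical stack by
    [classV_rel] and [phi_kernel]. The differentials are compared in [smoothing_circle],
    [smoothing_open] and [smoothing_vertical], which lead to [word_part_d] and [phi_d]. The matching
    is acyclic by [annular_d_insert]. The homology of words, over any commutative ring, is in
    [boundary_bottom], [boundary_open], [open_onto] and [acyclic]. It is carried back to the cube by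
    [model_iso] and [V2_iso]. *)

(** * Connected components of finite graphs through numerical labels *)

Section Labels.
Variable P : finType.
Implicit Types (e : rel P) (x y : P).

Lemma same_curve_refl e x : same_curve e x x.
Proof. exact: connect0. Qed.

Lemma same_curve_sym e x y : same_curve e x y = same_curve e y x.
Proof. by apply: sym_connect_sym => u v /=; rewrite orbC. Qed.

Lemma same_curve_trans e y x z :
  same_curve e x y -> same_curve e y z -> same_curve e x z.
Proof. exact: connect_trans. Qed.

Lemma same_curve1 e x y : e x y -> same_curve e x y.
Proof. by move=> exy; apply: connect1; rewrite /= exy. Qed.

Lemma eq_same_curve e e' : e =2 e' -> same_curve e =2 same_curve e'.
Proof. by move=> ee'; apply: eq_connect => x y /=; rewrite !ee'. Qed.

(** Such a function turns connectivity into equality of numbers. All curves below are handled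
    through labels, so that finite checks can be done by evaluation. *)
Definition labelled e (f : P -> nat) :=
  forall x y, same_curve e x y = (f x == f y).

Lemma labelledP e f :
  (forall x y, e x y -> f x = f y) ->
  (forall x y, f x = f y -> same_curve e x y) -> labelled e f.
Proof.
move=> ef fe x y; apply/idP/eqP; last exact: fe.
case/connectP=> p; elim: p x => [|z p IH] x /= => [_ -> //|].
by case/andP=> /orP[/ef ->|/ef <-] pz ly; apply: IH.
Qed.

End Labels.

Lemma same_curve_homo (P Q : finType) (e : rel P) (e' : rel Q) (h : P -> Q) :
  (forall x y, e x y -> same_curve e' (h x) (h y)) ->
  forall x y, same_curve e x y -> same_curve e' (h x) (h y).
Proof.
move=> he x y /connectP[p]; elim: p x => [|z p IH] x /=.
  by move=> _ ->; exact: same_curve_refl.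
case/andP=> xz pz ly; apply: same_curve_trans (IH _ pz ly).
by case/orP: xz => /he //; rewrite same_curve_sym.
Qed.

Section LabelComputation.
Variable P : finType.
Implicit Types (e : rel P) (x y : P).

(* The labels of the components of a graph whose components are labelled by
   [r], after the addition of the edges [E] between them. *)
Fixpoint lab_from (E : seq (nat * nat)) (r : nat -> nat) (v : nat) : nat :=
  if E is (a, b) :: E' then
    let ra := r a in let rb := r b in
    lab_from E' (fun w => let x := r w in if x == rb then ra else x) v
  else r v.

Definition lab E v := lab_from E id v.

(** Adding an edge renames the label of [w] into that of [u]; iterating this is the computation
    [lab]. *)
Lemma labelled_edge e0 g u w e : labelled e0 g ->
  (forall x y, e x y = e0 x y || ((x == u) && (y == w))) ->
  labelled e (fun x => if g x == g w then g u else g x).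
Proof.
move=> lg de.
have e0e x y : same_curve e0 x y -> same_curve e x y.
  apply: (same_curve_homo (h := id)) => x' y' h.
  by apply: same_curve1; rewrite de h.
have euw : same_curve e u w by apply: same_curve1; rewrite de !eqxx orbT.
apply: labelledP => x y.
  rewrite de => /orP[exy|/andP[/eqP-> /eqP->]]; last by rewrite eqxx; case: ifP.
  by have /eqP -> : g x == g y by rewrite -lg; apply: same_curve1.
have to_u z : g z = g w -> same_curve e z u.
  move=> h; rewrite same_curve_sym; apply: same_curve_trans euw _.
  by apply: e0e; rewrite lg h.
have rep z z' : g z = g z' -> same_curve e z z' by move=> h; apply: e0e; rewrite lg h.
case: eqP => [/to_u xu|_]; case: eqP => [/to_u yu|_] h.
- by apply: same_curve_trans xu _; rewrite same_curve_sym.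
- by apply: same_curve_trans xu _; exact: rep.
- by rewrite same_curve_sym in yu; apply: same_curve_trans yu; exact: rep.
- exact: rep.
Qed.

Lemma labelled_lab_from (A : seq (P * P)) f e0 r : labelled e0 (r \o f) ->
  forall e, (forall x y, e x y = e0 x y || has (fun p => (x == p.1) && (y == p.2)) A) ->
  labelled e (lab_from [seq (f p.1, f p.2) | p <- A] r \o f).
Proof.
elim: A e0 r => [|[u w] A IH] e0 r lr e de.
  by move=> x y; rewrite -lr; apply: eq_same_curve => x' y'; rewrite de orbF.
pose e1 x y := e0 x y || ((x == u) && (y == w)).
have l1 := @labelled_edge _ _ u w e1 lr (fun _ _ => erefl).
by apply: (IH e1 (fun v => if r v == r (f w) then r (f u) else r v)) => // x y;
  rewrite de /= orbA.
Qed.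

Lemma labelled_lab (A : seq (P * P)) e0 f : labelled e0 f ->
  forall e, (forall x y, e x y = e0 x y || has (fun p => (x == p.1) && (y == p.2)) A) ->
  labelled e (fun x => lab [seq (f p.1, f p.2) | p <- A] (f x)).
Proof. exact: (@labelled_lab_from A f e0 id). Qed.

(** Serves for the circles inside a tangle: no arc added from outside meets them, so [lab] leaves
    their labels alone. *)
Lemma lab_from_out E r v : ~~ has (fun p => (p.1 == v) || (p.2 == v)) E ->
  r v = v -> (forall u, r u = v -> u = v) -> lab_from E r v = v.
Proof.
elim: E r => [|[a b] E IH] r //=; rewrite !negb_or -!andbA.
case/and3P=> /eqP av /eqP bv vE rv ru; apply: IH => // [|u].
  by rewrite rv; case: eqP => // /esym/ru.
by case: eqP => [_ /ru //|_ /ru].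
Qed.

Lemma dots_size e f (S : {set P}) : labelled e f ->
  dots e S = size (undup [seq f x | x in S]).
Proof.
move=> lf; rewrite /dots.
rewrite cardE -(size_map (fun C : {set P} => [seq f x | x in C])).
pose h (n : nat) := [set x | f x == n].
have cE x : curve e x = h (f x) by apply/setP=> y; rewrite !inE lf eq_sym.
rewrite -[RHS](size_map h) size_map.
apply: perm_size; apply: uniq_perm; first exact: enum_uniq.
  rewrite map_inj_in_uniq ?undup_uniq // => m n.
  rewrite !mem_undup => /imageP[x _ ->] _ /setP/(_ x).
  by rewrite !inE eqxx => /esym/eqP.
move=> C; rewrite mem_enum; apply/imsetP/mapP => [[x xS ->]|[n]].
  by exists (f x); rewrite ?cE // mem_undup; apply/imageP; exists x.
by rewrite mem_undup => /imageP[x xS ->] ->; exists x; rewrite ?cE.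
Qed.

End LabelComputation.

(* The greatest element of [E] below [m]. *)
Fixpoint low (E : nat -> bool) (m : nat) : option nat :=
  if m is m'.+1 then if E m' then Some m' else low E m' else None.

Definition up (E : nat -> bool) (m l : nat) : bool := has E (iota m (l - m)).

Section Low.
Implicit Types (E : nat -> bool).

Lemma low_Some E m r :
  low E m = Some r <-> [/\ (r < m)%N, E r & forall t, (r < t < m)%N -> ~~ E t].
Proof.
elim: m => [|m IH] /=; first by split=> // -[].
case: ifP => [Em|Em].
  split=> [[<-]|[rm Er h]].
    by split=> // t; case: ltngtP => // a b; lia.
  congr Some; case: (ltngtP r m) rm => // [rm' _|]; last by lia.
  by move: (h m); rewrite rm' leqnn Em => /(_ isT).
rewrite IH; split=> -[rm Er h]; split=> //; try lia.
- move=> t /andP[rt]; rewrite ltnS leq_eqVlt => /orP[/eqP->|tm]; first by rewrite Em.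
  by apply: h; rewrite rt.
- case: (altP (r =P m)) Er => [->|/eqP]; [by rewrite Em|by lia].
- by move=> t /andP[rt tm]; apply: h; rewrite rt ltnW.
Qed.

Lemma low_None E m : low E m = None <-> forall t, (t < m)%N -> ~~ E t.
Proof.
elim: m => [|m IH] /=; first by split.
case: ifP => [Em|Em]; first by split=> // /(_ m); rewrite leqnn Em => /(_ isT).
rewrite IH; split=> h t => [|tm]; last by apply: h; rewrite ltnW.
by rewrite ltnS leq_eqVlt => /orP[/eqP->|/h//]; rewrite Em.
Qed.

Lemma upP E m l : reflect (exists2 t, (m <= t < l)%N & E t) (up E m l).
Proof.
apply: (iffP hasP) => -[t]; rewrite ?mem_iota => h Et; exists t => //;
  rewrite ?mem_iota; lia.
Qed.

Lemma eq_low E E' m : (forall t, (t < m)%N -> E t = E' t) -> low E m = low E' m.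
Proof.
elim: m => //= m IH h; rewrite h // IH // => t tm; apply: h; exact: ltnW.
Qed.

Lemma low_ex E m t : (t < m)%N -> E t -> exists r, low E m = Some r.
Proof.
move=> tm Et; case h: (low E m) => [r|]; first by exists r.
by move/low_None: h => /(_ _ tm); rewrite Et.
Qed.

Lemma low_rem E E' r m : E r ->
  (forall t, E' t = (t != r) && E t) ->
  low E' m = if low E m == Some r then low E r else low E m.
Proof.
move=> Er dE; elim: m => //= m IH; rewrite dE; case: (altP (m =P r)) IH => [->|mr] IH /=.
  rewrite Er eqxx; rewrite IH; case: eqP => // /low_Some[]; by rewrite ltnn.
by case: (E m) => //=; case: eqP => // -[/eqP]; rewrite (negPf mr).
Qed.

End Low.

Lemma I2P (i : 'I_2) : i = ord0 \/ i = ord_max.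
Proof. by case: i => [[|[|m]] h] //; [left|right]; apply: val_inj. Qed.

(** * The components of a flat tangle on two strands *)

Section StrandLabels.
Variables (l : nat) (T : flat 2 l).

Definition turning (r : nat) : bool := nth None T r != None.
Definition is_vertical : bool := low turning l == None.

(** In a tangle that is not vertical, a component on line [m] is determined by the last turning
    slice [r] below it. Label [6 + r] names the closed circle just above slice [r]. Labels 4 and 5
    are kept for the arcs at the bottom and at the top, or for the two strands of a vertical tangle.
    Labels 0 to 3 are the platform points. *)
Definition line_label (m i : nat) : nat :=
  if low turning m is Some r then (if up turning m l then 6 + r else 5)
  else (if up turning m l then 4 else 4 + i).

Definition strand_label (x : pt 2 l) : nat :=
  match x with inl (m, i) => line_label m i | inr (s, m) => 2 * s + m end.

Lemma turning_tnth (r : 'I_l) : turning r = (tnth T r != None).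
Proof. by rewrite /turning (tnth_nth None). Qed.

Lemma turningS (r : 'I_l) : turning r -> tnth T r = Some ord0.
Proof. by rewrite turning_tnth; case: (tnth T r) => // -[[|m] h] // _; congr Some; apply: val_inj. Qed.

Lemma turning_lt r : turning r -> (r < l)%N.
Proof.
by rewrite /turning ltnNge; apply: contraNN => h; rewrite nth_default // size_tuple.
Qed.

Lemma line_label_edge (r : 'I_l) i j : passes (tnth T r) i j ->
  line_label r i = line_label r.+1 j.
Proof.
case/andP=> /eqP<-; case e: (tnth T r) => [s|].
  by case: (I2P i) => -> /andP[] //; case: s e => [[|m] ?].
move=> _; have nr : turning r = false by rewrite turning_tnth e.
rewrite /line_label /= nr.
have -> // : up turning r l = up turning r.+1 l.
apply/upP/upP => -[t h Et]; exists t => //; last by lia.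
by case: (altP (t =P r :> nat)) Et h => [->|]; [rewrite nr|lia].
Qed.

Lemma line_label_cup (r : nat) i j : turning r ->
  line_label r.+1 i = line_label r.+1 j.
Proof. by rewrite /line_label /= => ->. Qed.

Lemma line_label_cap (r : nat) i j : turning r -> line_label r i = line_label r j.
Proof.
move=> Er; rewrite /line_label; have -> // : up turning r l.
by apply/upP; exists r => //; rewrite leqnn turning_lt.
Qed.

Lemma strand_pass (m : nat) (i : 'I_2) (h : (m < l)%N) (h1 : (m < l.+1)%N)
    (h2 : (m.+1 < l.+1)%N) : ~~ turning m ->
  same_curve (strand T) (inl (Ordinal h1, i)) (inl (Ordinal h2, i)).
Proof.
move=> nm; apply: same_curve1; apply/existsP; exists (Ordinal h).
rewrite -[m]/(val (Ordinal h)) turning_tnth negbK in nm.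
by rewrite /= (eqP nm) /passes !eqxx /= !orbT.
Qed.

Lemma strand_passes (m m' : 'I_l.+1) (i : 'I_2) : (m <= m')%N ->
  (forall t, (m <= t < m')%N -> ~~ turning t) ->
  same_curve (strand T) (inl (m, i)) (inl (m', i)).
Proof.
case: m' => m'; elim: m' => [|m' IH] h' /=.
  rewrite leqn0 => /eqP m0 _; have -> : m = Ordinal h' by apply: val_inj.
  exact: same_curve_refl.
rewrite leq_eqVlt => /orP[/eqP mm|mm] h.
  have -> : m = Ordinal h' by apply: val_inj.
  exact: same_curve_refl.
have h1 : (m' < l.+1)%N by lia.
apply: (same_curve_trans (y := inl (Ordinal h1, i))).
  by apply: IH => [|t /= tt]; [rewrite -ltnS|apply: h; lia].
by apply: strand_pass; [lia|apply: h; lia].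
Qed.

Lemma low_between (m m' : nat) : (m <= m')%N -> low turning m = low turning m' ->
  forall t, (m <= t < m')%N -> ~~ turning t.
Proof.
move=> mm e t tt; apply/negP=> Et.
have [|r lr] := low_ex (t := t) (m := m') _ Et; first by lia.
have := lr; rewrite -e => /low_Some[rm Er _].
case/low_Some: lr => _ _ /(_ t)/implyP; rewrite Et implybF => /negP; apply; lia.
Qed.

Lemma strand_low (m m' : 'I_l.+1) (i : 'I_2) : low turning m = low turning m' ->
  same_curve (strand T) (inl (m, i)) (inl (m', i)).
Proof.
wlog mm : m m' / (m <= m')%N.
  by case: (leqP m m') => [|/ltnW] h H e; [|rewrite same_curve_sym]; apply: H.
by move=> e; apply: strand_passes => //; apply: low_between.
Qed.

(** Slide along vertical lines to the cup of the last turning slice below or, if there is none, to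
    the cap of the first one above. *)
Lemma strand_turn (m : 'I_l.+1) (i j : 'I_2) : ~~ is_vertical ->
  same_curve (strand T) (inl (m, i)) (inl (m, j)).
Proof.
suff H : ~~ is_vertical -> same_curve (strand T) (inl (m, ord0)) (inl (m, ord_max)).
  by case: (I2P i) (I2P j) => -> [] -> /H; rewrite ?same_curve_refl // same_curve_sym.
move=> nv; suff [m' [em st]] : exists m' : 'I_l.+1, low turning m = low turning m' /\
    same_curve (strand T) (inl (m', ord0)) (inl (m', ord_max)).
  apply: same_curve_trans (strand_low _ em) _; apply: same_curve_trans st _.
  exact: strand_low.
have cup (r : 'I_l) (m' : 'I_l.+1) : turning r -> m' = r.+1 :> nat ->
    same_curve (strand T) (inl (m', ord0)) (inl (m', ord_max)).
  move=> Er e; apply: same_curve1; apply/existsP; exists r.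
  by rewrite (turningS Er) /= e /= !eqxx !orbT.
have cap (r : 'I_l) (m' : 'I_l.+1) : turning r -> m' = r :> nat ->
    same_curve (strand T) (inl (m', ord0)) (inl (m', ord_max)).
  move=> Er e; apply: same_curve1; apply/existsP; exists r.
  by rewrite (turningS Er) /= e /= !eqxx.
case lm : (low turning m) => [r|].
  have /low_Some[rm Er h] := lm.
  have rl := turning_lt Er.
  exists (Ordinal (rl : (r.+1 < l.+1)%N)); split; first by rewrite /= Er.
  exact: (cup (Ordinal rl)).
have /upP[t /andP[_ tl] Et] : up turning 0 l.
  apply/negPn/negP => nu; move: nv; rewrite /is_vertical; apply/negP/negPn/eqP.
  by apply/low_None => t tl; apply: contra nu => Et; apply/upP; exists t.
have ex : exists t, turning t by exists t.
case: (ex_minnP ex) => r Er min.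
have rl := turning_lt Er.
exists (Ordinal (ltnW rl : (r < l.+1)%N)); split; last exact: (cap (Ordinal rl)).
by symmetry; apply/low_None => t' /= t'r; apply/negP=> /min; rewrite leqNgt t'r.
Qed.

Lemma line_label_inj m m' i i' : (m <= l)%N -> (m' <= l)%N -> (i < 2)%N -> (i' < 2)%N ->
  line_label m i = line_label m' i' ->
  low turning m = low turning m' /\ (is_vertical -> i = i').
Proof.
(* If no turning slice lies at or above line [p], then the last one below [p] is the last one of
   all. This is why the label 5 determines [low]. *)
have key p : (p <= l)%N -> if up turning p l then ~~ is_vertical : Prop else low turning p = low turning l.
  move=> pl; case: upP => [[t /andP[_ tl] Et]|np].
    by apply/negP=> /eqP/low_None/(_ _ tl); rewrite Et.
  case e: (low turning p) => [r|]; symmetry.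
    case/low_Some: e => rp Er h; apply/low_Some; split=> //; first by lia.
    move=> t tt; case: (leqP p t) => pt; last by apply: h; lia.
    by apply/negP=> Et; apply: np; exists t => //; lia.
  apply/low_None => t tl; move/low_None: e => e.
  case: (leqP p t) => pt; last by apply: e.
  by apply/negP=> Et; apply: np; exists t => //; lia.
move=> ml ml' i2 i2'; rewrite /line_label.
have := key _ ml'; have := key _ ml; rewrite /is_vertical.
case: (up turning m l) => h1; case: (up turning m' l) => h2;
  move: h1 h2; case lm: (low turning m) => [r|]; case lm': (low turning m') => [r'|] h1 h2 h;
  rewrite -?h1 -?h2 //= in h1 h2 *.
all: try by [split=> //; congr Some; lia | lia | split=> // _; lia].
all: try by [split=> //; rewrite ?(negPf h1) ?(negPf h2)].
all: try by split; congruence.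
  by move/addnI: h => ->; rewrite (negPf h1).
by rewrite h1 h2 -h2.
Qed.

Lemma strand_labelled : labelled (strand T) strand_label.
Proof.
apply: labelledP => [[[m i]|[s m]]|[[m i]|[s m]]].
- case=> [[m' j]|//] /existsP[r /or3P[]] /and3P[/eqP em /eqP em'].
  + case e: (tnth T r) => [s|//] _ /=; rewrite em em'; apply: line_label_cap.
    by rewrite turning_tnth e.
  + case e: (tnth T r) => [s|//] _ /=; rewrite em em'; apply: line_label_cup.
    by rewrite turning_tnth e.
  + by move=> h /=; rewrite em em'; apply: line_label_edge.
- by case=> [[? ?]|[? ?]].
- have c (m' : nat) (i' : 'I_2) : (3 < line_label m' i')%N.
    by rewrite /line_label; case: (low _ _) => [?|]; case: ifP => //; lia.
  case=> [[m' j]|[s' m']] /=.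
    case/(line_label_inj (leq_ord m) (leq_ord m') (ltn_ord i) (ltn_ord j)) => e v.
    apply: same_curve_trans (strand_low _ e) _.
    case: (boolP is_vertical) => [/v/val_inj->|]; first exact: same_curve_refl.
    exact: strand_turn.
  by have := c m i; case: s' => /= h e; have := ltn_ord m'; lia.
- have c (m' : nat) (i' : 'I_2) : (3 < line_label m' i')%N.
    by rewrite /line_label; case: (low _ _) => [?|]; case: ifP => //; lia.
  case=> [[m' j]|[s' m']] /=.
    by have := c m' j; case: s => /= h e; have := ltn_ord m; lia.
  move=> e; have [-> /val_inj ->] : s = s' /\ m = m' :> nat; last exact: same_curve_refl.
  have := ltn_ord m; have := ltn_ord m'.
  by case: s s' e => -[] /= e ? ?; split=> //; lia.
Qed.

End StrandLabels.

(** * The four generalized cup diagrams on two termini *)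

Inductive cup := LL | LR | RR | CC.

Definition cup_fun (c : cup) (i : 'I_2) : 'I_2 + bool :=
  match c with
  | LL => inr false | RR => inr true | LR => inr (i == ord_max)
  | CC => inl (if i == ord0 then ord_max else ord0)
  end.

Lemma forallI2 (p : pred 'I_2) : [forall i, p i] = p ord0 && p ord_max.
Proof.
apply/forallP/andP=> [h|[h0 h1] i]; first by [].
by case: (I2P i) => ->.
Qed.

Lemma cup_diagram c : is_cup_diagram [ffun i => cup_fun c i].
Proof.
by rewrite /is_cup_diagram !forallI2 !ffunE; case: c; rewrite /= ?eqxx.
Qed.

Definition dia c : GM 2 := exist _ [ffun i => cup_fun c i] (cup_diagram c).

Lemma diaP (a : GM 2) : exists c, a = dia c.
Proof.
case: a => a ha.
suff [c ac] : exists c, forall i, a i = cup_fun c i.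
  by exists c; apply: val_inj => /=; apply/ffunP=> i; rewrite ffunE.
case/and3P: ha; rewrite !forallI2 => h1 h2 h3.
suff [c [ac0 ac1]] : exists c, a ord0 = cup_fun c ord0 /\ a ord_max = cup_fun c ord_max.
  by exists c => i; case: (I2P i) => ->.
case e0: (a ord0) h1 h2 h3 => [i|[]]; case e1: (a ord_max) => [j|[]]; rewrite ?e0 ?e1 /=.
all: try by [exists LL | exists LR | exists RR].
all: try (case: (I2P i) => ->); try (case: (I2P j) => ->) => //=.
all: by [exists CC|rewrite !eqxx ?andbF].
Qed.
Definition platform_arcsN c (s : bool) : nat :=
  match c with LL => (~~ s).*2 | RR => s.*2 | LR => 1 | CC => 0 end.

Definition platform_indexN c (s : bool) (i : nat) : nat :=
  match c with
  | LL => if s then 0 else i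
  | RR => if s then 1 - i else 0
  | LR => if s then i == 0 else i == 1
  | CC => 0 end.

Lemma cardI2 (p : pred 'I_2) : #|[set i | p i]| = p ord0 + p ord_max.
Proof.
rewrite -sum1_card (eq_bigl p); last by move=> i; rewrite inE.
rewrite big_mkcond !big_ord_recl big_ord0 /= addn0 (_ : lift _ _ = ord_max).
  by case: (p _); case: (p _).
exact: val_inj.
Qed.

Lemma platform_arcs_dia c s : platform_arcs (dia c) s = platform_arcsN c s.
Proof. by rewrite /platform_arcs cardI2 /= !ffunE; case: c s => -[]. Qed.

Lemma platform_index_dia c s i : platform_index (dia c) s i = platform_indexN c s i.
Proof.
rewrite /platform_index cardI2 /= !ffunE.
by case: (I2P i) => -> ; case: c s => -[].
Qed.

Definition weightN c : int := (platform_arcsN c true)%:Z - (platform_arcsN c false)%:Z.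

Lemma weight_dia c : weight (dia c) = weightN c.
Proof. by rewrite /weight !platform_arcs_dia. Qed.

Definition code (x : endpt 2) : nat :=
  match x with inl i => 4 + i | inr (s, m) => 2 * s + m end.

Definition endpoint (v : nat) : endpt 2 :=
  match v with
  | 0 => inr (false, ord0) | 1 => inr (false, ord_max)
  | 2 => inr (true, ord0) | 3 => inr (true, ord_max)
  | 4 => inl ord0 | _ => inl ord_max
  end.

Lemma codeK : cancel code endpoint.
Proof. by case=> [i|[[] i]]; case: (I2P i) => ->. Qed.

Lemma code_lt x : (code x < 6)%N.
Proof. by case: x => [i|[[] i]]; case: (I2P i) => ->. Qed.

Lemma endpointK v : (v < 6)%N -> code (endpoint v) = v.
Proof. by do 6?[case: v => [|v] //]. Qed.

(** The pairs follow the order of [enum], so that [arcs_dia] is an equality of sequences and fixes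
    the order of the surgeries. Pairs of codes below 4 are the half-circles between the
    platforms. *)
Definition arcN (c : cup) : seq (nat * nat) :=
  match c with
  | LL => [:: (0, 4); (1, 5)]
  | LR => [:: (5, 2); (0, 4); (1, 3)]
  | RR => [:: (4, 3); (5, 2)]
  | CC => [:: (4, 5); (0, 2); (1, 3)]
  end.

Lemma enum_endpt : enum {: endpt 2} = [seq endpoint v | v <- [:: 4; 5; 2; 3; 0; 1]].
Proof.
have eI : enum 'I_2 = [:: ord0; ord_max].
  rewrite !enum_ordSl (size0nil (size_enum_ord 0)) /=.
  by congr [:: _; _]; apply: val_inj.
rewrite enumT unlock /= /sum_enum -!enumT eI.
suff -> : enum {: bool * 'I_2} =
    [:: (true, ord0); (true, ord_max); (false, ord0); (false, ord_max)] by [].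
by rewrite enumT unlock /= /prod_enum eI enumT unlock.
Qed.

Lemma arc_dia c u v : (u < 6)%N -> (v < 6)%N ->
  Defs.arc (dia c) (endpoint u) (endpoint v) && (pos (endpoint u) < pos (endpoint v))%N
  = ((u, v) \in arcN c).
Proof.
have ea i s : (val (dia c) i == inr s) = (cup_fun c i == inr s) by rewrite /= ffunE.
have el i j : (val (dia c) i == inl j) = (cup_fun c i == inl j) by rewrite /= ffunE.
move=> hu hv; rewrite /Defs.arc.
do 6?[case: u hu => [|u] hu //]; do 6?[case: v hv => [|v] hv //];
  rewrite /= ?ffunE ?platform_index_dia ?platform_arcs_dia; by case: c {ea el}.
Qed.

Lemma arcs_dia c :
  arcs (dia c) = [seq (endpoint p.1, endpoint p.2) | p <- arcN c].
Proof.
have h p : p \in [seq (u, v) | u <- [:: 4; 5; 2; 3; 0; 1], v <- [:: 4; 5; 2; 3; 0; 1]] ->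
    (p.1 < 6)%N && (p.2 < 6)%N.
  by move=> hp; have := allP (isT : all (fun p => (p.1 < 6)%N && (p.2 < 6)%N)
     [seq (u, v) | u <- [:: 4; 5; 2; 3; 0; 1], v <- [:: 4; 5; 2; 3; 0; 1]]) _ hp.
rewrite /arcs.
have -> : enum {: endpt 2 * endpt 2} = [seq (endpoint p.1, endpoint p.2) | p <-
    [seq (u, v) | u <- [:: 4; 5; 2; 3; 0; 1], v <- [:: 4; 5; 2; 3; 0; 1]]].
  by rewrite enumT unlock /= /prod_enum enum_endpt.
rewrite filter_map; congr map.
rewrite (eq_in_filter (a2 := fun p => p \in arcN c)); first by case: c.
by move=> [u v] /h /andP[hu hv] /=; apply: arc_dia.
Qed.

(** * The curves of closed diagrams *)

(** Seen from its bottom or top line, a tangle only shows whether it is vertical ([V]) or joins the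
    two points there. This reduces gluing to two cases, whatever the height of the stack. *)
Definition bot_label (V : bool) (v : nat) : nat := if (v < 4) || V then v else 4.
Definition top_label (V : bool) (v : nat) : nat := if (v < 4) || V then v else 5.

Lemma code_inl (i : 'I_2) : code (inl i) = 4 + i. Proof. by []. Qed.

Section ClosedLabels.
Variables (l : nat) (T : flat 2 l).

Lemma is_verticalE : is_vertical T = ~~ up (turning T) 0 l.
Proof.
apply/eqP/idP => [/low_None h|h].
  by apply/negP=> /upP[t /andP[_ tl] Et]; have := h t tl; rewrite Et.
by apply/low_None => t tl; apply: contra h => Et; apply/upP; exists t.
Qed.

Lemma strand_label_bot x :
  strand_label T (at_line ord0 x) = bot_label (is_vertical T) (code x).
Proof.
case: x => [i|[s m]] /=; last first.
  by rewrite /bot_label; case: s; case: (I2P m) => ->.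
by rewrite /bot_label /line_label /= is_verticalE; case: up.
Qed.

Lemma strand_label_top x :
  strand_label T (at_line ord_max x) = top_label (is_vertical T) (code x).
Proof.
case: x => [i|[s m]] /=; last first.
  by rewrite /top_label; case: s; case: (I2P m) => ->.
rewrite /top_label /line_label /is_vertical /= /up subnn /=.
by case: (low (turning T) l).
Qed.

Definition edges V a b : seq (nat * nat) :=
  [seq (bot_label V p.1, bot_label V p.2) | p <- arcN a]
  ++ [seq (top_label V p.1, top_label V p.2) | p <- arcN b].

Definition diagram_label a b (x : pt 2 l) : nat :=
  lab (edges (is_vertical T) a b) (strand_label T x).

Lemma arcN_lt c p : p \in arcN c -> (p.1 < 6) && (p.2 < 6).
Proof.
by move=> h; apply: (allP (_ : all (fun p => (p.1 < 6) && (p.2 < 6)) (arcN c)) _ h); case: c {h}.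
Qed.

Lemma closed_labelled a b :
  labelled (closed_diagram T (dia a) (dia b)) (diagram_label a b).
Proof.
have := labelled_lab (A := [seq (at_line ord0 p.1, at_line ord0 p.2) | p <- arcs (dia a)]
  ++ [seq (at_line ord_max p.1, at_line ord_max p.2) | p <- arcs (dia b)])
  (strand_labelled T).
move=> /(_ (closed_diagram T (dia a) (dia b))) h x y; rewrite h => [|{}x {}y]; last first.
  by rewrite /= has_cat !has_map.
rewrite /diagram_label; set E := map _ _; suff -> : E = edges (is_vertical T) a b by [].
rewrite /E /edges map_cat !arcs_dia -!map_comp.
by congr (_ ++ _); apply/eq_in_map => p /arcN_lt /andP[h1 h2] /=;
  rewrite ?strand_label_bot ?strand_label_top !endpointK.
Qed.

End ClosedLabels.

(** * Two stacked pieces in the course of the surgeries *)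

Section TwoPieces.
Variables (l l' : nat) (T : flat 2 l) (T' : flat 2 l') (o1 o2 : nat -> nat).
Hypotheses (o1_inj : injective o1) (o2_inj : injective o2)
  (o12 : forall x y, o1 (strand_label T x) <> o2 (strand_label T' y)).

(** The offsets keep the labels of the pieces apart. In use, one piece is the identity tangle, with
    labels below 6, and the labels of the other are shifted by 6. *)
Definition two_label (x : pt 2 l + pt 2 l') : nat :=
  match x with inl x => o1 (strand_label T x) | inr y => o2 (strand_label T' y) end.

Definition two_strands : rel (pt 2 l + pt 2 l') := [rel x y |
  match x, y with
  | inl x, inl y => strand T x y | inr x, inr y => strand T' x y | _, _ => false end].

Lemma two_labelled : labelled two_strands two_label.
Proof.
apply: labelledP => [[x|x] [y|y]|[x|x] [y|y]] //=.
- by move=> h; have /eqP -> : strand_label T x == strand_label T y;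
    rewrite -?strand_labelled //; apply: same_curve1.
- by move=> h; have /eqP -> : strand_label T' x == strand_label T' y;
    rewrite -?strand_labelled //; apply: same_curve1.
- move/o1_inj/eqP; rewrite -strand_labelled.
  by apply: same_curve_homo => u v h; apply: same_curve1.
- by move/o12.
- by move/esym/o12.
- move/o2_inj/eqP; rewrite -strand_labelled.
  by apply: same_curve_homo => u v h; apply: same_curve1.
Qed.

(** The graph [surgered] on labels: [b1], [t1] read the labels on the bottom and top lines of the
    first piece, [b2], [t2] those of the second, and [d] lists the arcs already replaced by vertical
    lines. *)
Definition edges2 (b1 t1 b2 t2 : nat -> nat) a b c (d : seq (nat * nat)) : seq (nat * nat) :=
  let todo := [seq p <- arcN b | p \notin d] in
  [seq (b1 p.1, b1 p.2) | p <- arcN a] ++ [seq (t1 p.1, t1 p.2) | p <- todo]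
  ++ [seq (b2 p.1, b2 p.2) | p <- todo] ++ [seq (t2 p.1, t2 p.2) | p <- arcN c]
  ++ flatten [seq [:: (t1 p.1, b2 p.1); (t1 p.2, b2 p.2)] | p <- d].

Let V := is_vertical T.
Let V' := is_vertical T'.

Definition arc_ends (p : nat * nat) := (endpoint p.1, endpoint p.2).

Lemma arc_ends_inj c : {in arcN c &, injective arc_ends}.
Proof.
move=> [p1 p2] [r1 r2] /arcN_lt/andP[/= h1 h2] /arcN_lt/andP[/= h3 h4].
case=> /(congr1 code) e1 /(congr1 code) e2.
by rewrite !endpointK // in e1 e2; rewrite e1 e2.
Qed.

Definition two_diagram_label a b c d x :=
  lab (edges2 (o1 \o bot_label V) (o1 \o top_label V) (o2 \o bot_label V')
     (o2 \o top_label V') a b c d) (two_label x).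

Lemma surgered_labelled a b c d : {subset d <= arcN b} ->
  labelled (surgered T T' (dia a) (dia b) (dia c) (map arc_ends d))
    (two_diagram_label a b c d).
Proof.
move=> db.
pose todo := [seq p <- arcN b | p \notin d].
pose A := [seq (inl (at_line ord0 p.1), inl (at_line ord0 p.2)) | p <- arcs (dia a)]
  ++ [seq (inl (at_line ord_max p.1), inl (at_line ord_max p.2)) | p <- map arc_ends todo]
  ++ [seq (inr (at_line ord0 p.1), inr (at_line ord0 p.2)) | p <- map arc_ends todo]
  ++ [seq (inr (at_line ord_max p.1), inr (at_line ord_max p.2)) | p <- arcs (dia c)]
  ++ flatten [seq [:: (inl (at_line ord_max p.1), inr (at_line ord0 p.1));
       (inl (at_line ord_max p.2), inr (at_line ord0 p.2))] | p <- map arc_ends d]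
  : seq ((pt 2 l + pt 2 l') * (pt 2 l + pt 2 l')).
have htodo : [seq p <- arcs (dia b) | p \notin map arc_ends d] = map arc_ends todo.
  rewrite arcs_dia filter_map; congr map; apply: eq_in_filter => p pb /=.
  congr (~~ _); apply/mapP/idP => [[r rd e]|pd]; last by exists p.
  by rewrite (arc_ends_inj pb (db _ rd) e).
have h x y : surgered T T' (dia a) (dia b) (dia c) (map arc_ends d) x y =
   two_strands x y || has (fun p => (x == p.1) && (y == p.2)) A.
  rewrite /surgered htodo /A !has_cat !has_map.
  case: x => x; case: y => y /=; rewrite /arcs_at ?has_map.
  - rewrite [X in _ = _ || (_ || (_ || X))](_ : _ = false) ?orbF //.
    apply/negbTE; rewrite !negb_or; apply/and3P; split; apply/hasPn => p //=.
    by case/flatten_mapP => r _; rewrite !inE => /orP[] /eqP-> /=; rewrite andbF.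
  - rewrite !orbA [X in _ = X || _](_ : _ = false) /=; last first.
      by apply/negbTE; rewrite !negb_or -!andbA; do ?[apply/andP; split] => //;
        apply/hasPn => p //= _; rewrite andbF.
    elim: d {db todo htodo A} => //= p d ->; rewrite orbA; congr (_ || _).
    apply/existsP/idP => [[u /and3P[/orP[]/eqP-> /eqP-> /eqP->]]|].
    + by rewrite !eqxx.
    + by rewrite !eqxx orbT.
    + by case/orP=> /andP[/eqP[->] /eqP[->]];
        [exists (arc_ends p).1|exists (arc_ends p).2]; rewrite !eqxx ?orbT.
  - symmetry; apply: negbTE; rewrite !negb_or; apply/and5P; split; apply/hasPn => p //= ;
      rewrite ?andbF //.
    by case/flatten_mapP => r _; rewrite !inE => /orP[] /eqP-> /=.
  - rewrite [X in _ = _ || X]orbA [X in _ = _ || (X || _)](_ : _ = false); last first.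
      by apply/negbTE; rewrite !negb_or; apply/andP; split; apply/hasPn => p.
    rewrite [X in _ = _ || (_ || (_ || (_ || X)))](_ : _ = false) ?orbF //.
    apply/negbTE/hasPn => p.
    by case/flatten_mapP => r _; rewrite !inE => /orP[] /eqP-> /=.
have {}h := labelled_lab two_labelled h.
move=> x y; rewrite h /two_diagram_label.
set E := map _ A; suff -> : E = edges2 (o1 \o bot_label V) (o1 \o top_label V)
   (o2 \o bot_label V') (o2 \o top_label V') a b c d by [].
rewrite /E /edges2 /A !map_cat !arcs_dia -!map_comp map_flatten -!map_comp.
have todo_lt p : p \in todo -> (p.1 < 6) && (p.2 < 6).
  by rewrite mem_filter => /andP[_ /arcN_lt].
congr (_ ++ _); last congr (_ ++ _); last congr (_ ++ _); last congr (_ ++ _).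
- by apply/eq_in_map => p /arcN_lt /andP[h1 h2] /=; rewrite !strand_label_bot !endpointK.
- by apply/eq_in_map => p /todo_lt /andP[h1 h2] /=; rewrite !strand_label_top !endpointK.
- by apply/eq_in_map => p /todo_lt /andP[h1 h2] /=; rewrite !strand_label_bot !endpointK.
- by apply/eq_in_map => p /arcN_lt /andP[h1 h2] /=; rewrite !strand_label_top !endpointK.
congr flatten; apply/eq_in_map => p /db /arcN_lt /andP[h1 h2] /=.
by rewrite !strand_label_top !strand_label_bot !endpointK.
Qed.

End TwoPieces.

(** * Decorations as bit lists, and saddles computed on them *)

(** The bits [B] decorate the labels that surgeries can meet; [rest] decorates the circles beyond,
    which are carried along unchanged. *)
Definition dotted N (B : seq bool) (rest : nat -> bool) (v : nat) : bool :=
  if v < N then nth false B v else rest (v - N).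

Definition small_edges N (E : seq (nat * nat)) : bool :=
  all (fun p => (p.1 < N) && (p.2 < N)) E.

Lemma lab_big N E v : small_edges N E -> N <= v -> lab E v = v.
Proof.
move=> sE Nv; apply: lab_from_out => //; apply/hasPn => p pE.
by have /= /andP[? ?] := allP sE p pE; rewrite negb_or; apply/andP; split; apply/eqP; lia.
Qed.

Lemma lab_from_small N E r v : small_edges N E -> (forall w, w < N -> r w < N) ->
  v < N -> lab_from E r v < N.
Proof.
elim: E r => [|[a b] E IH] r /=; first by move=> _; apply.
by case/andP=> /andP[/= aN bN] sE rN; apply: IH => // w wN; case: ifP => _; apply: rN.
Qed.

Lemma lab_small N E v : small_edges N E -> v < N -> lab E v < N.
Proof. by move=> sE; apply: lab_from_small. Qed.

Section Bits.
Variables (N : nat) (E E' : seq (nat * nat)) (u0 v0 : nat) (B : seq bool).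

Definition is_decorationN (B : seq bool) : bool :=
  all (fun u => all (fun v => (lab E' u == lab E' v) ==> (nth false B u == nth false B v))
    (iota 0 N)) (iota 0 N).

Definition affected (v : nat) : bool := (lab E v == lab E u0) || (lab E v == lab E v0).

(** A saddle only alters the curves through [u0] and [v0], so its outcome is determined by the two
    bits there; [saddleN] tries all four pairs. *)
Definition candidate (d : bool * bool) : seq bool :=
  mkseq (fun v => if affected v then (if lab E' v == lab E' u0 then d.1 else d.2)
                  else nth false B v) N.

Definition valid_candidate (d : bool * bool) : bool :=
  [&& (lab E' u0 == lab E' v0) ==> (d.1 == d.2), is_decorationN (candidate d)
    & if lab E u0 == lab E v0 then d.1 + d.2 == nth false B u0 + 1
      else d.1 == nth false B u0 + nth false B v0 :> nat].

Definition saddleN : seq (seq bool) :=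
  [seq candidate d | d <- [:: (true, true); (true, false); (false, true); (false, false)]
     & valid_candidate d].

Definition saddle_ok : bool :=
  [&& small_edges N E, small_edges N E', u0 < N, v0 < N &
    all (fun v => affected v ==> (lab E' v \in [:: lab E' u0; lab E' v0])) (iota 0 N)].

Variables (P : finType) (f : P -> nat) (e e' : rel P) (p s : P) (rest : nat -> bool).
Hypotheses (f_onto : forall v, v < N -> exists x, f x = v)
  (lE : labelled e (fun x => lab E (f x))) (lE' : labelled e' (fun x => lab E' (f x)))
  (fp : f p = u0) (fs : f s = v0).

Definition deco B : {set P} := [set x | dotted N B rest (f x)].

Lemma is_decoration_deco B1 : small_edges N E' ->
  is_decoration e' (deco B1) = is_decorationN B1.
Proof.
move=> sE'.
apply/forallP/allP => [h u|h x].
  rewrite mem_iota add0n => /andP[_ u_lt]; apply/allP => v.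
  rewrite mem_iota add0n => /andP[_ v_lt].
  have [x fx] := f_onto u_lt; have [y fy] := f_onto v_lt.
  move/forallP: (h x) => /(_ y); rewrite lE' !inE fx fy /dotted u_lt v_lt.
  by [].
apply/forallP=> y; rewrite lE' !inE; apply/implyP => /eqP exy.
case: (ltnP (f x) N) => fx; last first.
  rewrite (lab_big sE' fx) in exy; case: (ltnP (f y) N) => fy.
    by have := lab_small sE' fy; rewrite -exy ltnNge fx.
  by rewrite (lab_big sE' fy) in exy; rewrite exy.
have fy : f y < N.
  rewrite ltnNge; apply/negP => fy; rewrite (lab_big sE' fy) in exy.
  by have := lab_small sE' fx; rewrite exy ltnNge fy.
rewrite /dotted fx fy; have := h (f x); rewrite mem_iota fx => /(_ isT)/allP/(_ (f y)).
by rewrite mem_iota fy exy eqxx => /(_ isT).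
Qed.

(** A decoration produced by the saddle is recovered from its values at [p] and [s], because
    [saddle_ok] puts every affected label on one of the two new curves. *)
Lemma saddle_sum (F : {set P} -> nat) : saddle_ok ->
  \sum_(S | saddle e e' p s (deco B) S) F S = \sum_(B1 <- saddleN) F (deco B1).
Proof.
case/and5P=> sE sE' uN vN /allP ok.
rewrite /saddleN big_map big_filter.
have -> : \sum_(d <- [:: (true, true); (true, false); (false, true); (false, false)]
     | valid_candidate d) F (deco (candidate d)) =
     \sum_(d | valid_candidate d) F (deco (candidate d)).
  apply: perm_big; apply: uniq_perm => //; first by rewrite index_enum_uniq.
  by move=> -[[] []]; rewrite mem_index_enum.
(* If [p] and [s] end on the same curve, only pairs with equal bits are hit; the first clause of
   [valid_candidate] matches this. *)
rewrite (reindex_onto (fun d => deco (candidate d)) (fun S => (p \in S, s \in S))) => [|S].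
  apply: eq_bigl => d.
  have pd : (p \in deco (candidate d)) = d.1.
    by rewrite inE fp /dotted uN nth_mkseq // /affected !eqxx.
  have sd : (s \in deco (candidate d)) = if lab E' v0 == lab E' u0 then d.1 else d.2.
    by rewrite inE fs /dotted vN nth_mkseq // /affected !eqxx orbT.
  rewrite /valid_candidate /saddle lE pd sd fp fs !inE fp fs /dotted uN vN.
  rewrite (is_decoration_deco _ sE').
  have -> : [forall x, ~~ same_curve e p x && ~~ same_curve e s x ==>
      ((x \in deco (candidate d)) == (x \in deco B))].
    apply/forallP=> x; rewrite !lE fp fs ![_ == lab E (f x)]eq_sym -negb_or -/(affected _).
    apply/implyP => /negPf na; rewrite !inE /dotted; case: ltnP => // fx.
    by rewrite nth_mkseq // na.
  rewrite /= -!pair_eqE /= eqxx /= [lab E' v0 == _]eq_sym.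
  case: (lab E' u0 =P lab E' v0) => h /=; last by rewrite eqxx andbT.
  case: (d.1 =P d.2) => [->|hd] /=; first by rewrite andbT.
  by rewrite ?andbF; case: d.1 d.2 hd => -[].
case/and3P=> /forallP dS /forallP oS _; apply/setP => x; rewrite inE /dotted.
have eS y z : lab E' (f y) = lab E' (f z) -> (y \in S) = (z \in S).
  by move=> h; apply/eqP; have /forallP/(_ z) := dS y; rewrite lE' h eqxx.
case: (boolP (affected (f x))) => ax; last first.
  have := oS x; rewrite !lE fp fs ![_ == lab E (f x)]eq_sym -negb_or -/(affected _) ax.
  move/eqP=> ->; rewrite inE /dotted; case: ltnP => // fx.
  by rewrite nth_mkseq // (negPf ax).
have fx : f x < N.
  rewrite ltnNge; apply/negP=> Nx; move: ax; rewrite /affected (lab_big sE Nx).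
  by have := lab_small sE uN; have := lab_small sE vN => h1 h2 /orP[]/eqP h; lia.
rewrite fx nth_mkseq // ax; have := ok (f x); rewrite mem_iota fx ax => /(_ isT).
rewrite !inE => /orP[/eqP h|/eqP h].
  by rewrite h eqxx; apply: eS; rewrite fp h.
by case: eqP => h'; apply: eS; rewrite ?fp ?fs.
Qed.

End Bits.

Section Surgeries.
Variables (b1 t1 b2 t2 : nat -> nat) (a b c : cup).
Implicit Types (todo d : seq (nat * nat)) (B : seq bool).

Let stage d := edges2 b1 t1 b2 t2 a b c d.

(** The bound 12 counts the six visible labels of each of the two pieces; circles inside the tangle
    lie above it. *)
Fixpoint surgeriesN todo d B : seq (seq bool) :=
  if todo is p :: todo' then
    flatten [seq surgeriesN todo' (p :: d) B1
            | B1 <- saddleN 12 (stage d) (stage (p :: d)) (t1 p.1) (b2 p.2) B]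
  else [:: B].

Fixpoint surgeries_ok todo d : bool :=
  if todo is p :: todo' then
    saddle_ok 12 (stage d) (stage (p :: d)) (t1 p.1) (b2 p.2) && surgeries_ok todo' (p :: d)
  else true.

End Surgeries.

Section SurgeriesSpec.
Variables (l l' : nat) (T : flat 2 l) (T' : flat 2 l') (o1 o2 : nat -> nat).
Hypotheses (o1_inj : injective o1) (o2_inj : injective o2)
  (o12 : forall x y, o1 (strand_label T x) <> o2 (strand_label T' y)).
Let b1 := o1 \o bot_label (is_vertical T).
Let t1 := o1 \o top_label (is_vertical T).
Let b2 := o2 \o bot_label (is_vertical T').
Let t2 := o2 \o top_label (is_vertical T').
Hypothesis onto : forall v, v < 12 -> exists x, two_label T T' o1 o2 x = v.

Lemma surgeries_sum a b c rest S' todo d B :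
  {subset todo <= arcN b} -> {subset d <= arcN b} ->
  surgeries_ok b1 t1 b2 t2 a b c todo d ->
  surgeries T T' (dia a) (dia b) (dia c) (map arc_ends todo) (map arc_ends d)
    (deco 12 (two_label T T' o1 o2) rest B) S' =
  \sum_(B1 <- surgeriesN b1 t1 b2 t2 a b c todo d B)
    (deco 12 (two_label T T' o1 o2) rest B1 == S').
Proof.
elim: todo d B => [|p todo IH] d B /= sub_t sub_d; first by rewrite big_seq1.
case/andP=> okp oks.
have pb : p \in arcN b by apply: sub_t; rewrite inE eqxx.
have /andP[p1 p2] := arcN_lt pb.
have sub_pd : {subset p :: d <= arcN b}.
  by move=> r; rewrite inE => /orP[/eqP->|/sub_d].
have sub_t' : {subset todo <= arcN b}.
  by move=> r rt; apply: sub_t; rewrite inE rt orbT.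
have lE := surgered_labelled o1_inj o2_inj o12 a c sub_d.
have lE' := surgered_labelled o1_inj o2_inj o12 a c sub_pd.
have fp : two_label T T' o1 o2 (inl (at_line ord_max (arc_ends p).1)) = t1 p.1.
  by rewrite /= strand_label_top endpointK.
have fs : two_label T T' o1 o2 (inr (at_line ord0 (arc_ends p).2)) = b2 p.2.
  by rewrite /= strand_label_bot endpointK.
rewrite (saddle_sum B rest onto lE lE' fp fs _ okp).
rewrite big_flatten big_map /=; apply: eq_bigr => B1 _.
exact: (IH (p :: d)).
Qed.

End SurgeriesSpec.

(** * Gluing the identity tangle to the bottom or the top of a tangle *)

Lemma strand_label_onto l (T : flat 2 l) v : v < 6 -> exists x, strand_label T x = v.
Proof.
move=> v6; case: (altP (v =P 5)) => [->|v5].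
  by exists (at_line ord_max (endpoint 5)); rewrite strand_label_top /top_label; case: ifP.
exists (at_line ord0 (endpoint v)); rewrite strand_label_bot endpointK // /bot_label.
by case: ltnP => //= h; case: ifP => // _; apply/eqP; rewrite eqn_leq h; case: ltngtP v5 v6 => //; lia.
Qed.

Lemma vertical_label_lt x : strand_label (vertical 2) x < 6.
Proof.
case: x => [[m i]|[s m]] /=; last by case: s; case: (I2P m) => ->.
by case: m => -[|m] hm //; rewrite /line_label /=; case: (I2P i) => ->.
Qed.

Definition mkgen l (T : flat 2 l) (a b : cup) (B : seq bool) (rest : nat -> bool) : gen 2 l :=
  (dia a, dia b, deco 6 (strand_label T) rest B).

(** In the stack the points of the identity piece are those of the bottom line of [T]: the filter
    demands that the bits agree there, and [drop 6] keeps those of [T]. *)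
Definition left_outcomes V a b c B0 B : seq (seq bool) :=
  [seq drop 6 B1 | B1 <- surgeriesN (bot_label true) (top_label true) (addn 6 \o bot_label V) (addn 6 \o top_label V)
                          a b c (arcN b) [::] (B0 ++ B)
   & all (fun v => nth false B1 v == nth false B1 (6 + bot_label V v)) (iota 0 6)].

Definition right_outcomes V a b c B0 B : seq (seq bool) :=
  [seq drop 6 B1 | B1 <- surgeriesN (addn 6 \o bot_label V) (addn 6 \o top_label V) (bot_label true) (top_label true)
                          a b c (arcN b) [::] (B0 ++ B)
   & all (fun v => nth false B1 v == nth false B1 (6 + top_label V v)) (iota 0 6)].

(** The tangle enters only through [V], so this is a finite check on two cases and 64 triples of
    diagrams. *)
Lemma left_ok V a b c :
  surgeries_ok (bot_label true) (top_label true) (addn 6 \o bot_label V) (addn 6 \o top_label V) a b c (arcN b) [::].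
Proof. by case: V a b c => -[] [] []; vm_compute. Qed.

Lemma right_ok V a b c :
  surgeries_ok (addn 6 \o bot_label V) (addn 6 \o top_label V) (bot_label true) (top_label true) a b c (arcN b) [::].
Proof. by case: V a b c => -[] [] []; vm_compute. Qed.

Lemma vertical_is_vertical : is_vertical (vertical 2). Proof. by []. Qed.

Section Basis.
Variables (l : nat) (T : flat 2 l).
Let V := is_vertical T.

Definition basisN V a b (B : seq bool) : bool :=
  let E := edges V a b in
  [&& weightN a == weightN b, (lab E 0 != lab E 1) && (lab E 2 != lab E 3),
      is_decorationN 6 E B & ~~ has (nth false B) (iota 0 4)].

Lemma edges_small a b : small_edges 6 (edges V a b).
Proof. by case: V a b => -[] []. Qed.

Lemma in_basis_mkgen a b B rest : in_basis T (mkgen T a b B rest) = basisN V a b B.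
Proof.
have lE := closed_labelled T a b.
rewrite /in_basis /basisN /gcurves /gbot /gtop /gdot /= !weight_dia.
rewrite (is_decoration_deco (f := strand_label T) _ _ lE _ (edges_small a b));
  last exact: strand_label_onto.
congr [&& _, _, _ & _].
  rewrite /meets_platform_twice -negb_or; congr (~~ _).
  apply/existsP/orP => [[s /existsP[m /existsP[m' /andP[mm]]]]|].
    rewrite lE /diagram_label /=.
    case: (I2P m) (I2P m') mm => -> [] -> //= _; case: s => //= /eqP e;
      by [left; rewrite e|right; rewrite e].
  by case=> h; [exists false|exists true]; apply/existsP; exists ord0;
     apply/existsP; exists ord_max; rewrite lE.
rewrite /= orbF; apply/forallP/idP => [h|].
  move: (h (false, ord0)) (h (false, ord_max)) (h (true, ord0)) (h (true, ord_max)).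
  by rewrite !inE /dotted /= => /negPf-> /negPf-> /negPf-> /negPf->.
rewrite !negb_or => /and4P[h0 h1 h2 h3] [s m]; rewrite inE /dotted /=.
by case: s; case: (I2P m) => ->.
Qed.

(** Points with the same strand label lie on one closed curve, so a decoration is a function of the
    strand label. *)
Lemma in_basisP (g : gen 2 l) : in_basis T g ->
  exists a b B rest, size B = 6 /\ g = mkgen T a b B rest.
Proof.
case: g => [[ga gb] S]; have [a ->] := diaP ga; have [b ->] := diaP gb.
case/and4P => _ _ /forallP dS _; exists a, b.
pose h n := [exists x, (strand_label T x == n) && (x \in S)].
exists (mkseq h 6), (fun n => h (6 + n)); split; first by rewrite size_mkseq.
congr (_, _, _); apply/setP=> x; rewrite inE /dotted.
have -> : (if strand_label T x < 6 then nth false (mkseq h 6) (strand_label T x)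
   else h (6 + (strand_label T x - 6))) = h (strand_label T x).
  by case: ltnP => hx; [rewrite nth_mkseq|rewrite subnKC].
apply/idP/existsP => [xS|[y /andP[/eqP e yS]]]; first by exists x; rewrite eqxx.
have /forallP/(_ x) := dS y; rewrite closed_labelled /diagram_label e eqxx => /eqP <- //.
Qed.

Lemma nth_drop6 (B1 : seq bool) v : nth false (drop 6 B1) v = nth false B1 (6 + v).
Proof. by rewrite nth_drop. Qed.

Lemma stack_left (x : pt 2 l) : @stack 2 0 l l (inr x) = x.
Proof. by case: x => [[m i]|p] //=; rewrite inord_val. Qed.

Lemma stack_right (x : pt 2 l) : @stack 2 l 0 l (inl x) = x.
Proof. by case: x => [[m i]|p] //=; rewrite inord_val. Qed.

Lemma at_line_vertical (x : pt 2 0) (m : 'I_1) :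
  exists2 v, v < 6 & x = at_line m (endpoint v).
Proof.
exists (code (match x with inl (_, i) => inl i | inr p => inr p end)); first exact: code_lt.
by rewrite codeK; case: x => [[m' i]|//]; rewrite (ord1 m) (ord1 m').
Qed.

Lemma at_line_vertical_label (m : 'I_1) v : v < 6 ->
  strand_label (vertical 2) (at_line m (endpoint v)) = v.
Proof.
move=> v6; rewrite (ord1 m) strand_label_bot endpointK // vertical_is_vertical.
by rewrite /bot_label orbT.
Qed.

Lemma glue_left B1 rest (H : {set pt 2 l}) :
  (deco 12 (two_label (vertical 2) T id (addn 6)) rest B1 == @stack 2 0 l l @^-1: H) =
  all (fun v => nth false B1 v == nth false B1 (6 + bot_label V v)) (iota 0 6)
  && (H == deco 6 (strand_label T) rest (drop 6 B1)).
Proof.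
have mem_r x : (inr x \in @stack 2 0 l l @^-1: H) = (x \in H).
  by rewrite inE; exact: (congr1 (fun y => y \in H) (stack_left x)).
have inE_r x : (inr x \in deco 12 (two_label (vertical 2) T id (addn 6)) rest B1)
    = (x \in deco 6 (strand_label T) rest (drop 6 B1)).
  by rewrite !inE /dotted /= -[12]/(6 + 6) ltn_add2l nth_drop6 subnDl.
have inE_l m v : v < 6 -> (inl (at_line m (endpoint v)) \in
    deco 12 (two_label (vertical 2) T id (addn 6)) rest B1) = nth false B1 v.
  by move=> v6; rewrite inE /dotted /= at_line_vertical_label // (ltn_trans v6).
have in_bot v : v < 6 -> (at_line ord0 (endpoint v) \in
    deco 6 (strand_label T) rest (drop 6 B1)) = nth false B1 (6 + bot_label V v).
  move=> v6; rewrite inE /dotted strand_label_bot endpointK // nth_drop6.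
  by rewrite (_ : bot_label _ v < 6) // /bot_label; case: ifP.
have stk (m : 'I_1) v : @stack 2 0 l l (inl (at_line m (endpoint v))) = at_line ord0 (endpoint v).
  case: (endpoint v) => [i|p] //=; congr (inl (_, _)); apply: val_inj.
  by rewrite (ord1 m) /= inordK.
have mem_l (m : 'I_1) v : (inl (at_line m (endpoint v)) \in @stack 2 0 l l @^-1: H)
    = (at_line ord0 (endpoint v) \in H).
  by rewrite inE; exact: (congr1 (fun y => y \in H) (stk m v)).
apply/eqP/andP => [e|[/allP h /eqP eH]].
  have eH : H = deco 6 (strand_label T) rest (drop 6 B1).
    by apply/setP=> x; rewrite -inE_r e mem_r.
  split; last exact/eqP.
  apply/allP=> v; rewrite mem_iota => /andP[_ v6]; rewrite -in_bot // -eH.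
  by rewrite -(inE_l ord0) // e mem_l.
apply/setP=> -[x|x]; last by rewrite inE_r mem_r eH.
have [v v6 ->] := at_line_vertical x ord0.
rewrite inE_l // mem_l eH in_bot //; apply/eqP/h.
by rewrite mem_iota.
Qed.

Lemma glue_right B1 rest (H : {set pt 2 l}) :
  (deco 12 (two_label T (vertical 2) (addn 6) id) rest B1 == @stack 2 l 0 l @^-1: H) =
  all (fun v => nth false B1 v == nth false B1 (6 + top_label V v)) (iota 0 6)
  && (H == deco 6 (strand_label T) rest (drop 6 B1)).
Proof.
have mem_r x : (inl x \in @stack 2 l 0 l @^-1: H) = (x \in H).
  by rewrite inE; exact: (congr1 (fun y => y \in H) (stack_right x)).
have inE_r x : (inl x \in deco 12 (two_label T (vertical 2) (addn 6) id) rest B1)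
    = (x \in deco 6 (strand_label T) rest (drop 6 B1)).
  by rewrite !inE /dotted /= -[12]/(6 + 6) ltn_add2l nth_drop6 subnDl.
have inE_l m v : v < 6 -> (inr (at_line m (endpoint v)) \in
    deco 12 (two_label T (vertical 2) (addn 6) id) rest B1) = nth false B1 v.
  by move=> v6; rewrite inE /dotted /= at_line_vertical_label // (ltn_trans v6).
have in_top v : v < 6 -> (at_line ord_max (endpoint v) \in
    deco 6 (strand_label T) rest (drop 6 B1)) = nth false B1 (6 + top_label V v).
  move=> v6; rewrite inE /dotted strand_label_top endpointK // nth_drop6.
  by rewrite (_ : top_label _ v < 6) // /top_label; case: ifP.
have stk (m : 'I_1) v : @stack 2 l 0 l (inr (at_line m (endpoint v))) = at_line ord_max (endpoint v).
  case: (endpoint v) => [i|p] //=; congr (inl (_, _)); apply: val_inj.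
  by rewrite (ord1 m) /= inordK addn0.
have mem_l (m : 'I_1) v : (inr (at_line m (endpoint v)) \in @stack 2 l 0 l @^-1: H)
    = (at_line ord_max (endpoint v) \in H).
  by rewrite inE; exact: (congr1 (fun y => y \in H) (stk m v)).
apply/eqP/andP => [e|[/allP h /eqP eH]].
  have eH : H = deco 6 (strand_label T) rest (drop 6 B1).
    by apply/setP=> x; rewrite -inE_r e mem_r.
  split; last exact/eqP.
  apply/allP=> v; rewrite mem_iota => /andP[_ v6]; rewrite -in_top // -eH.
  by rewrite -(inE_l ord0) // e mem_l.
apply/setP=> -[x|x]; first by rewrite inE_r mem_r eH.
have [v v6 ->] := at_line_vertical x ord0.
rewrite inE_l // mem_l eH in_top //; apply/eqP/h.
by rewrite mem_iota.
Qed.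

Lemma mu_left a b c B0 B r0 rest h : size B0 = 6 ->
  mu_coef (vertical 2) T T (mkgen (vertical 2) a b B0 r0) (mkgen T b c B rest) h =
  (\sum_(B1 <- left_outcomes V a b c B0 B) (in_basis T h && (h == mkgen T a c B1 rest)))%N.
Proof.
move=> sB0; rewrite /mu_coef /gtop /gbot /gdot /= eqxx /=.
case: h => [[ha hb] H] /=.
case: (altP (ha =P dia a)) => [->|na] /=; last first.
  by rewrite big1 // => B1 _; rewrite /mkgen !xpair_eqE (negPf na) andbF.
case: (altP (hb =P dia c)) => [->|nb] /=; last first.
  by rewrite big1 // => B1 _; rewrite /mkgen !xpair_eqE (negPf nb) !andbF.
case: ifP => _ /=; last by rewrite big1_eq.
have o12 : forall x y, id (strand_label (vertical 2) x) <> 6 + strand_label T y.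
  by move=> x y; have := vertical_label_lt x; lia.
pose f := two_label (vertical 2) T id (addn 6).
have onto v : v < 12 -> exists x, f x = v.
  case: (ltnP v 6) => [v6 _|v6 v12].
    by have [x <-] := strand_label_onto (vertical 2) v6; exists (inl x).
  have [|x e] := @strand_label_onto _ T (v - 6); first by lia.
  by exists (inr x); rewrite /f /= e subnKC.
have -> : disjoint_union (deco 6 (strand_label (vertical 2)) r0 B0)
      (deco 6 (strand_label T) rest B) = deco 12 f rest (B0 ++ B).
  apply/setP=> -[x|x]; rewrite !inE /dotted /= nth_cat sB0.
    by have lx := vertical_label_lt x; rewrite lx (ltn_trans lx).
  by rewrite -[12]/(6 + 6) ltn_add2l subnDl addKn [6 + _ < 6]ltnNge leq_addr.
rewrite arcs_dia -/arc_ends.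
rewrite (surgeries_sum (o1 := id) (o2 := addn 6) (fun _ _ => id) (@addnI 6) o12 onto rest _
  (todo := arcN b) (d := [::]) (B0 ++ B) _ _ (left_ok V a b c)) //.
rewrite big_map big_filter [RHS]big_mkcond; apply: eq_bigr => B1 _.
by rewrite glue_left /mkgen !xpair_eqE !eqxx; case: (all _ _).
Qed.

Lemma mu_right a b c B0 B r0 rest h : size B0 = 6 ->
  mu_coef T (vertical 2) T (mkgen T a b B rest) (mkgen (vertical 2) b c B0 r0) h =
  (\sum_(B1 <- right_outcomes V a b c B0 B) (in_basis T h && (h == mkgen T a c B1 rest)))%N.
Proof.
move=> sB0; rewrite /mu_coef /gtop /gbot /gdot /= eqxx /=.
case: h => [[ha hb] H] /=.
case: (altP (ha =P dia a)) => [->|na] /=; last first.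
  by rewrite big1 // => B1 _; rewrite /mkgen !xpair_eqE (negPf na) andbF.
case: (altP (hb =P dia c)) => [->|nb] /=; last first.
  by rewrite big1 // => B1 _; rewrite /mkgen !xpair_eqE (negPf nb) !andbF.
case: ifP => _ /=; last by rewrite big1_eq.
have o12 : forall x y, 6 + strand_label T x <> id (strand_label (vertical 2) y).
  by move=> x y; have := vertical_label_lt y; lia.
pose f := two_label T (vertical 2) (addn 6) id.
have onto v : v < 12 -> exists x, f x = v.
  case: (ltnP v 6) => [v6 _|v6 v12].
    by have [x <-] := strand_label_onto (vertical 2) v6; exists (inr x).
  have [|x e] := @strand_label_onto _ T (v - 6); first by lia.
  by exists (inl x); rewrite /f /= e subnKC.
have -> : disjoint_union (deco 6 (strand_label T) rest B)
      (deco 6 (strand_label (vertical 2)) r0 B0) = deco 12 f rest (B0 ++ B).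
  apply/setP=> -[x|x]; rewrite !inE /dotted /= nth_cat sB0; last first.
    by have lx := vertical_label_lt x; rewrite lx (ltn_trans lx).
  by rewrite -[12]/(6 + 6) ltn_add2l subnDl addKn [6 + _ < 6]ltnNge leq_addr.
rewrite arcs_dia -/arc_ends.
rewrite (surgeries_sum (o1 := addn 6) (o2 := id) (@addnI 6) (fun _ _ => id) o12 onto rest _
  (todo := arcN b) (d := [::]) (B0 ++ B) _ _ (right_ok V a b c)) //.
rewrite big_map big_filter [RHS]big_mkcond; apply: eq_bigr => B1 _.
by rewrite glue_right /mkgen !xpair_eqE !eqxx; case: (all _ _).
Qed.

End Basis.

(** * The degree of a generator in terms of its bits *)

Definition posN (v : nat) : nat := nth 0 [:: 1; 0; 4; 5; 2; 3] v.

Definition clockwiseN E (lbl : nat -> nat) (v : nat) : bool :=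
  odd (count (fun u => (posN u < posN v) && (lab E (lbl u) == lab E (lbl v)))
             [:: 4; 5; 2; 3; 0; 1]).

Definition clockwise_piecesN V a b : nat :=
  let E := edges V a b in
  count (fun p => clockwiseN E (bot_label V) p.1) (arcN a)
  + count (fun p => clockwiseN E (top_label V) p.1) (arcN b)
  + (~~ V && clockwiseN E (bot_label V) 4) + (~~ V && clockwiseN E (top_label V) 4).

Definition dotsN V a b B : nat :=
  size (undup [seq lab (edges V a b) v | v <- iota 0 6 & nth false B v]).

Lemma card_endpt (p : pred (endpt 2)) :
  #|[set x | p x]| = count (fun v => p (endpoint v)) [:: 4; 5; 2; 3; 0; 1].
Proof. by rewrite cardsE cardE size_filter -enumT enum_endpt count_map; apply: eq_count. Qed.

Lemma posE v : v < 6 -> pos (endpoint v) = posN v.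
Proof. by do 6?[case: v => [|v] //]. Qed.

Lemma card_if_set1 (U : finType) (u : U) (b : bool) (p : pred U) :
  #|[set x in (if b then [set u] else set0) | p x]| = b && p u.
Proof.
case: b => /=; last by apply/eqP; rewrite cards_eq0; apply/eqP/setP=> x; rewrite !inE.
case pu: (p u).
  by rewrite (_ : [set _ in _ | _] = [set u]) ?cards1 //; apply/setP=> x; rewrite !inE;
    case: eqP => // ->.
by apply/eqP; rewrite cards_eq0; apply/eqP/setP=> x; rewrite !inE; case: eqP => // ->.
Qed.

Section Degree.
Variables (l : nat) (T : flat 2 l).
Let V := is_vertical T.

(** Marks the turning slices whose circle, of label [6 + r], closes up inside [T] below the next
    turning slice. *)
Definition inner (r : nat) : bool := turning T r && up (turning T) r.+1 l.

Definition rest_dots (rest : nat -> bool) : nat := #|[set r : 'I_l | inner r && rest r]|.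

Lemma inner_label x r : strand_label T x = 6 + r -> inner r.
Proof.
case: x => [[m i]|[s m]] /=; last by case: s; have := ltn_ord m => /=; lia.
rewrite /line_label; case lm: (low _ _) => [t|]; case: ifP => [um|_] //; try lia.
- move/addnI=> <-; have /low_Some[tm Et _] := lm; rewrite /inner Et /=.
  by case/upP: um => w h Ew; apply/upP; exists w => //; lia.
- by have := ltn_ord i; lia.
Qed.

Lemma inner_point (r : 'I_l) i : inner r ->
  strand_label T (inl (lift ord0 r, i)) = 6 + r.
Proof. by case/andP=> Er ur; rewrite /= /line_label /= Er ur. Qed.

Lemma deco_labels E B rest : small_edges 6 E ->
  size (undup [seq lab E (strand_label T x) | x in deco 6 (strand_label T) rest B]) =
  size (undup [seq lab E v | v <- iota 0 6 & nth false B v]) + rest_dots rest.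
Proof.
move=> sE; rewrite /rest_dots cardE -(size_map (fun r : 'I_l => 6 + r)) -size_cat.
apply: perm_size; apply: uniq_perm; first exact: undup_uniq.
  rewrite cat_uniq undup_uniq map_inj_uniq ?enum_uniq ?andbT; last first.
    by move=> r r' /addnI/val_inj.
  apply/hasPn => v /mapP[r _ ->]; rewrite mem_undup; apply/mapP => -[w].
  rewrite mem_filter mem_iota => /andP[_ /andP[_ w6]] e.
  by have := lab_small sE w6; rewrite -e; lia.
move=> v; rewrite mem_cat !mem_undup; apply/imageP/orP => [[x]|[/mapP[w]|/mapP[r]]].
- rewrite inE /dotted; case: ltnP => x6 dx ->.
    by left; apply: map_f; rewrite mem_filter dx mem_iota.
  have [r er] : exists r, strand_label T x = 6 + r by exists (strand_label T x - 6); lia.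
  have ir := inner_label er; have /andP[Er _] := ir.
  right; apply/mapP; exists (Ordinal (turning_lt Er)); last by rewrite (lab_big sE x6).
  by rewrite mem_enum inE /= ir; rewrite er addKn in dx.
- rewrite mem_filter mem_iota => /andP[Bw /andP[_ w6]] ->.
  have [x ex] := strand_label_onto T w6; exists x; last by rewrite ex.
  by rewrite inE /dotted ex w6.
- rewrite mem_enum inE => /andP[ir rr] ->; exists (inl (lift ord0 r, ord0)).
    by rewrite inE /dotted inner_point // ltnNge leq_addr addKn.
  by rewrite inner_point // (lab_big sE) ?leq_addr.
Qed.

Lemma dots_mkgen a b B rest :
  dots (gcurves T (mkgen T a b B rest)) (gdot (mkgen T a b B rest)) =
  dotsN V a b B + rest_dots rest.
Proof.
rewrite /gcurves /gbot /gtop /gdot /= (dots_size _ (closed_labelled T a b)).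
exact: deco_labels (edges_small T a b).
Qed.

(** The loops are the components with label at least 6, since the smaller labels are met on the
    bottom line, the top line or the platforms. *)
Lemma loops_inner : loops T = rest_dots predT.
Proof.
pose S := deco 6 (strand_label T) predT [::].
have l0 : labelled (strand T) (fun x => lab [::] (strand_label T x)) := strand_labelled T.
have := dots_size S l0; rewrite deco_labels //= add0n => <-; rewrite /dots /loops.
congr #|pred_of_set _|; apply/setP=> K; rewrite inE.
have inS x : (x \in S) = (6 <= strand_label T x).
  by rewrite inE /dotted; case: ltnP => //; rewrite nth_nil.
apply/andP/imsetP => [[/imsetP[x _ ->] /forallP h]|[x xS ->]].
  exists x => //; rewrite inS leqNgt; apply/negP => x6.
  have hx y : strand_label T y = strand_label T x -> if y is inl (m, _) then (0 < m < l)%N else false.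
    move=> e; have /implyP := h y; apply; rewrite inE (l0 x y) /= e; exact: eqxx.
  have nx m v : v < 6 -> strand_label T (at_line m (endpoint v)) = strand_label T x ->
       (0 < m < l)%N by move=> _ /hx; case: (endpoint v) => [i|p].
  have := nx ord0; have := nx ord_max => h1 h2.
  case: (altP (strand_label T x =P 5)) => [e|ne].
    have := h1 5 isT; rewrite strand_label_top e /top_label /=.
    by case: ifP => _ /(_ erefl); rewrite ltnn andbF.
  have := h2 (strand_label T x) x6; rewrite strand_label_bot endpointK // /bot_label.
  suff -> : (if (strand_label T x < 4) || is_vertical T then strand_label T x else 4)
    = strand_label T x by move/(_ erefl).
  by case: ltnP => //= h4; case: ifP => // _; move/eqP: ne; lia.
split; first by apply/imsetP; exists x.
apply/forallP=> y; apply/implyP; rewrite inE (l0 x y) /= => /eqP e.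
have {}e : strand_label T x = strand_label T y := e; rewrite inS e in xS.
case: y {e} xS => [[m i]|[s m]] /=; last by case: s; have := ltn_ord m => /=; lia.
rewrite /line_label; case lm: (low _ _) => [t|]; case: ifP => [um|_] //; try lia.
  move=> _; have /low_Some[tm _ _] := lm; case/upP: um => w h _.
  by apply/andP; split; lia.
by have := ltn_ord i; lia.
Qed.

Lemma clockwise_label a b B rest m lbl v :
  (forall x, strand_label T (at_line m x) = lbl (code x)) -> v < 6 ->
  clockwise (gcurves T (mkgen T a b B rest)) m (endpoint v) =
  clockwiseN (edges V a b) lbl v.
Proof.
move=> hl v6; rewrite /clockwise card_endpt /clockwiseN; congr odd.
apply: eq_in_count => u hu; have u6 : u < 6 by move: hu; rewrite !inE; lia.
by rewrite !posE // closed_labelled /diagram_label !hl !endpointK.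
Qed.

Lemma tangle_arcs_label (m : 'I_l.+1) lbl :
  (forall x, strand_label T (at_line m x) = lbl (code x)) ->
  tangle_arcs T m = if lbl 4 == lbl 5 then [set (ord0, ord_max)] else set0.
Proof.
move=> hl; apply/setP=> -[i j]; rewrite inE /=.
have e : same_curve (strand T) (inl (m, i)) (inl (m, j)) = (lbl (4 + i) == lbl (4 + j)).
  by rewrite strand_labelled -!code_inl -!hl.
rewrite e; case: (I2P i) (I2P j) => -> [] -> /=; case: eqP; by rewrite !inE.
Qed.

(** The summand [~~ V] counts the arc joining the two bottom points, present unless [T] is
    vertical. *)
Lemma deg_mkgen a b B rest :
  deg T (mkgen T a b B rest) =
  (Posz (rest_dots predT + ~~ V) - Posz (clockwise_piecesN V a b)
  - Posz (2 * (dotsN V a b B + rest_dots rest)))%R.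
Proof.
have cb := strand_label_bot T; have ct := strand_label_top T.
rewrite /deg loops_inner dots_mkgen.
have lb : bot_label V 4 == bot_label V 5 = ~~ V by rewrite /bot_label /=; case: V.
have lt : top_label V 4 == top_label V 5 = ~~ V by rewrite /top_label /=; case: V.
have -> : clockwise_pieces T (mkgen T a b B rest) = clockwise_piecesN V a b.
  rewrite /clockwise_pieces /clockwise_piecesN /gbot /gtop /= !arcs_dia !count_map.
  rewrite (tangle_arcs_label cb) (tangle_arcs_label ct) lb lt.
  congr (_ + _ + _ + _)%N.
  - apply: eq_in_count => p /arcN_lt/andP[p6 _] /=; exact: clockwise_label.
  - apply: eq_in_count => p /arcN_lt/andP[p6 _] /=; exact: clockwise_label.
  - by rewrite card_if_set1 (clockwise_label a b B rest cb (isT : 4 < 6)).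
  - by rewrite card_if_set1 (clockwise_label a b B rest ct (isT : 4 < 6)).
rewrite (tangle_arcs_label cb) lb PoszD; congr (_ + _ - _ - _)%R.
by case: V; rewrite ?cards0 ?cards1.
Qed.

End Degree.

Local Open Scope ring_scope.

(** * Linear extension of maps given on a basis *)

Definition delta (k : comPzRingType) (X : finType) (x : X) : {ffun X -> k^o} :=
  [ffun y => (y == x)%:R].

Section Linear.
Variables (k : comPzRingType) (X : finType) (U : lmodType k).

Definition lin (F : X -> U) (x : {ffun X -> k^o}) : U := \sum_u (x u : k) *: F u.

Lemma lin_linear F : linear (lin F).
Proof.
move=> a x y; rewrite /lin scaler_sumr -big_split; apply: eq_bigr => g _ /=.
by rewrite !ffunE scalerDl scalerA.
Qed.

Lemma lin_delta F u : lin F (delta k u) = F u.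
Proof.
rewrite /lin (bigD1 u) //= big1 ?addr0 => [|v /negPf vu]; first by rewrite ffunE eqxx scale1r.
by rewrite ffunE vu scale0r.
Qed.

Lemma lin0 F : lin F 0 = 0.
Proof. by rewrite /lin big1 // => u _; rewrite ffunE scale0r. Qed.

Lemma linD F x y : lin F (x + y) = lin F x + lin F y.
Proof. by have := lin_linear F 1 x y; rewrite !scale1r. Qed.

Lemma linZ F a x : lin F (a *: x) = a *: lin F x.
Proof. by have := lin_linear F a x 0; rewrite lin0 !addr0. Qed.

Lemma linB F x y : lin F (x - y) = lin F x - lin F y.
Proof. by rewrite linD -[- y]scaleN1r linZ scaleN1r. Qed.

Lemma lin_sum F (J : finType) (P : pred J) (f : J -> {ffun X -> k^o}) :
  lin F (\sum_(j | P j) f j) = \sum_(j | P j) lin F (f j).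
Proof. by elim/big_rec2: _ => [|j x y _ <-]; rewrite ?lin0 ?linD. Qed.

End Linear.

Lemma lin_comp (k : comPzRingType) (X Y : finType) (U : lmodType k) (G : Y -> U)
  (F : X -> {ffun Y -> k^o}) x : lin G (lin F x) = lin (fun u => lin G (F u)) x.
Proof. rewrite [lin F x]/lin lin_sum; apply: eq_bigr => u _; exact: linZ. Qed.

(** * Words of dotted and undotted circles, and merging of circles *)

(** [None] is a vertical slice; [Some b] is a turning slice whose circle above it is dotted iff [b].
    For the last letter this circle passes through the seam. *)
Definition word n := {ffun 'I_n -> option bool}.

Section Words.
Variable n : nat.
Implicit Types (w : word n) (r s : 'I_n) (t : nat).

Definition supp w (t : nat) : bool := if insub t is Some r then w r != None else false.
Definition dot w (t : nat) : bool := if insub t is Some r then w r == Some true else false.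

Lemma suppE w r : supp w r = (w r != None).
Proof. by rewrite /supp (valK r). Qed.

Lemma dotE w r : dot w r = (w r == Some true).
Proof. by rewrite /dot (valK r). Qed.

Lemma supp_lt w t : supp w t -> (t < n)%N.
Proof. by rewrite /supp; case: insubP. Qed.

Lemma dot_supp w t : dot w t -> supp w t.
Proof. by rewrite /dot /supp; case: insubP => // r _ _ /eqP ->. Qed.

(* A cell is a word together with the dot of the circle below all slices. *)
Definition cell := (bool * word n)%type.

Definition slot_dot (c : cell) (p : option nat) : bool :=
  if p is Some t then dot c.2 t else c.1.

Definition previous w (r : nat) : option nat := low (supp w) r.

(** Making slice [r] vertical merges its circle with that of the previous letter, which inherits a
    dot of either one. Without a previous letter the dot goes to the bottom circle, see [remove]. *)
Definition remove_letter w r : word n :=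
  [ffun t : 'I_n => if t == r then None
    else if Some (t : nat) == previous w r then Some (dot w t || dot w r) else w t].

Definition remove (c : cell) r : cell :=
  (c.1 || ((previous c.2 r == None) && dot c.2 r), remove_letter c.2 r).

Definition removable (c : cell) r : bool := ~~ (dot c.2 r && slot_dot c (previous c.2 r)).

Lemma previous_lt w r t : previous w r = Some t -> (t < r)%N /\ supp w t.
Proof. by case/low_Some. Qed.

Lemma supp_remove w r t : supp (remove_letter w r) t = (t != r :> nat) && supp w t.
Proof.
case: (ltnP t n) => tn; last first.
  by rewrite /supp insubF ?andbF //; apply/negbTE; rewrite -leqNgt.
rewrite -[t]/(val (Ordinal tn)) !suppE ffunE -val_eqE.
case: ifP => //= _; case: ifP => // /eqP/esym /previous_lt[_].
by rewrite -[t]/(val (Ordinal tn)) suppE => ->.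
Qed.

Lemma dot_remove w r t : dot (remove_letter w r) t =
  (t != r :> nat) && (dot w t || (Some t == previous w r) && dot w r).
Proof.
case: (ltnP t n) => tn; last first.
  rewrite /dot insubF; last by apply/negbTE; rewrite -leqNgt.
  case: (Some t =P previous w r) => [/esym/previous_lt[tr _]|_]; last by rewrite andbF.
  by have := ltn_ord r; lia.
rewrite -[t]/(val (Ordinal tn)) !dotE ffunE -val_eqE.
case: ifP => //= _; case: ifP => //= _; last by rewrite orbF -dotE.
by rewrite -(dotE w (Ordinal tn)) -(dotE w r) /=; case: (_ || _).
Qed.

Lemma previous_remove w r m : w r != None ->
  previous (remove_letter w r) m = if previous w m == Some (r : nat) then previous w r else previous w m.
Proof.
move=> wr; apply: low_rem; first by rewrite suppE.
exact: supp_remove.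
Qed.

Lemma word_ext w w' : (forall t, supp w t = supp w' t) -> (forall t, dot w t = dot w' t) -> w = w'.
Proof.
move=> hs hd; apply/ffunP=> r; have := hs r; have := hd r; rewrite !suppE !dotE.
by case: (w r) => [[]|]; case: (w' r) => [[]|].
Qed.

Lemma slot_dot_remove c r p : p != Some (r : nat) ->
  slot_dot (remove c r) p = slot_dot c p || (p == previous c.2 r) && dot c.2 r.
Proof.
case: p => [t|] pr /=; last by rewrite [_ == None]eq_sym.
by rewrite dot_remove; have -> : t != r :> nat by apply: contra_neq pr => ->.
Qed.

Lemma previous_neq w r s : w s != None -> (r < s)%N -> previous w r <> Some (s : nat).
Proof. by move=> _ rs /previous_lt[]; lia. Qed.

(** The two merges interact only if [r] is the letter preceding [s]. Then three circles become one,
    and either order is nonzero iff at most one of them is dotted. *)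
Lemma remove_comm_lt (c : cell) r s : (r < s)%N -> c.2 r != None -> c.2 s != None ->
  remove (remove c r) s = remove (remove c s) r /\
  removable c r && removable (remove c r) s = removable c s && removable (remove c s) r.
Proof.
move=> rs cr cs.
have rs' : s != r :> nat by lia.
have sr' : r != s :> nat by lia.
have prs : previous c.2 r != Some (s : nat) by apply/eqP/previous_neq.
have prr : previous c.2 r != Some (r : nat) by apply/eqP=> /previous_lt[]; rewrite ltnn.
have pss : previous c.2 s != Some (s : nat) by apply/eqP=> /previous_lt[]; rewrite ltnn.
have e1 : previous (remove c r).2 s = if previous c.2 s == Some (r : nat) then previous c.2 r else previous c.2 s.
  exact: previous_remove.
have e2 : previous (remove c s).2 r = previous c.2 r.
  by rewrite previous_remove // (negPf prs).
have dr : dot (remove c s).2 r = dot c.2 r || (Some (r : nat) == previous c.2 s) && dot c.2 s.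
  by rewrite dot_remove sr'.
have ds : dot (remove c r).2 s = dot c.2 s.
  by rewrite dot_remove rs' [Some _ == _]eq_sym (negPf prs) orbF.
split.
  congr (_, _).
    rewrite /= -/(remove c r) -/(remove c s) /= !dot_remove !previous_remove // (negPf prs).
    rewrite rs' sr' [Some (s : nat) == _]eq_sym (negPf prs) /= orbF.
    rewrite [Some (r : nat) == _]eq_sym.
    case: (previous c.2 s =P Some (r : nat)) => [->|] /=; last first.
      by rewrite orbF -!orbA [X in _ || X]orbC.
    by case: (previous c.2 r == None); rewrite /= ?orbF //= -orbA.
  apply: word_ext => t; rewrite /= ?supp_remove; first by rewrite !andbA [X in X && _]andbC.
  rewrite !dot_remove !previous_remove // (negPf prs) rs' sr' [Some (s : nat) == _]eq_sym (negPf prs) /= orbF.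
  rewrite [Some (r : nat) == _]eq_sym.
  case: (altP (t =P s :> nat)) => [->|ts] /=.
    by rewrite [Some (s : nat) == _]eq_sym (negPf prs) ?andbF.
  case: (altP (t =P r :> nat)) => [->|tr] /=.
    rewrite eq_sym; case: ifP => [_|h]; last by rewrite h.
    by rewrite (negPf prr).
  case: (previous c.2 s =P Some (r : nat)) => [e|e] /=.
    rewrite e (_ : (Some t == Some (r : nat)) = false) /= ?orbF; last by apply/eqP=> -[] /eqP; rewrite (negPf tr).
    by case: (dot c.2 t); case: (dot c.2 r); case: (dot c.2 s); rewrite ?orbF ?andbT ?andbF ?orbT //; case: (_ == _).
  by rewrite orbF orbAC.
rewrite /removable e1 e2 dr ds.
rewrite slot_dot_remove; last by case: ifP => [_|/negbT].
rewrite slot_dot_remove // [Some (r : nat) == _]eq_sym.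
case: (previous c.2 s =P Some (r : nat)) => [e|e] /=.
  rewrite e eqxx (negbTE prr) /=.
  by case: (dot c.2 s); case: (dot c.2 r); case: (slot_dot c _).
have ne : (previous c.2 s == previous c.2 r) = false.
  apply/eqP => h; case er: (previous c.2 r) h => [t|] h.
    have [tr _] := previous_lt er; case/low_Some: h => _ _ /(_ r).
    by rewrite tr rs suppE cr => /(_ isT).
  by move/low_None: h => /(_ _ rs); rewrite suppE cr.
by rewrite ne [previous c.2 r == _]eq_sym ne /= !orbF andbC.
Qed.

End Words.

Lemma scaler_swap (k : comPzRingType) (U : lmodType k) (a b : k) (v : U) :
  a *: (b *: v) = b *: (a *: v).
Proof. by rewrite !scalerA mulrC. Qed.

(** * The differential on linear cells and on annular words *)

Section Differential.
Variables (k : comPzRingType) (qi : k) (n : nat).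
Implicit Types (w : word n) (r s : 'I_n).

(** Counts the 1-smoothings before [r], hence gives the sign of the saddle at [r] in [d_CK]. *)
Definition gaps w r : nat := #|[set t : 'I_n | (t < r)%N && (w t == None)]|.

Definition linear_term (c : cell n) r : {ffun cell n -> k^o} :=
  ((-1) ^+ gaps c.2 r * (removable c r)%:R) *: delta k (remove c r).

Definition linear_d (c : cell n) : {ffun cell n -> k^o} :=
  \sum_(r | c.2 r != None) linear_term c r.

Lemma remove_None (c : cell n) r s : ((remove c r).2 s == None) = (s == r) || (c.2 s == None).
Proof.
by apply: negb_inj; rewrite -suppE supp_remove suppE negb_or.
Qed.

Lemma gaps_remove_lt (c : cell n) r s : (r < s)%N -> c.2 r != None ->
  gaps (remove c r).2 s = (gaps c.2 s).+1.
Proof.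
move=> rs cr; rewrite /gaps.
rewrite (_ : [set _ | _ ] = r |: [set t : 'I_n | (t < s)%N && (c.2 t == None)]).
  by rewrite cardsU1 inE rs (negPf cr).
apply/setP=> t; rewrite !inE remove_None; case: eqP => [->|] //=.
by rewrite rs.
Qed.

Lemma gaps_remove_gt (c : cell n) r s : (r < s)%N ->
  gaps (remove c s).2 r = gaps c.2 r.
Proof.
move=> rs; rewrite /gaps; congr #|pred_of_set _|; apply/setP=> t; rewrite !inE remove_None.
by case: eqP => // -> /=; rewrite ltnNge ltnW.
Qed.

Lemma linear_dd c : lin linear_d (linear_d c) = 0.
Proof.
rewrite lin_sum.
pose F r s := ((-1) ^+ gaps c.2 r * (-1) ^+ gaps (remove c r).2 s
   * (removable c r && removable (remove c r) s)%:R) *: delta k (remove (remove c r) s).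
have e r : c.2 r != None -> lin linear_d (linear_term c r) =
    \sum_(s | (c.2 s != None) && (s != r)) F r s.
  move=> cr; rewrite linZ lin_delta /linear_d scaler_sumr.
  rewrite (eq_bigl (fun s => (c.2 s != None) && (s != r))); last first.
    by move=> s; rewrite remove_None negb_or andbC.
  apply: eq_bigr => s _; rewrite /linear_term scalerA /F; congr (_ *: _).
  by rewrite -mulnb natrM mulrACA mulrA.
rewrite (eq_bigr _ e).
(* Removing [r] first creates a gap before [s], whereas removing [s] first changes no gap before
   [r]: the signs are opposite. *)
have F_anti r s : (r < s)%N -> c.2 r != None -> c.2 s != None -> F r s + F s r = 0.
  move=> rs cr cs; have [e1 e2] := remove_comm_lt rs cr cs.
  rewrite /F e1 e2 gaps_remove_lt // gaps_remove_gt // exprS -scalerDl.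
  by rewrite [X in X *: _](_ : _ = 0) ?scale0r //; ring.
rewrite (eq_bigr (fun r => \sum_(s | (c.2 s != None) && (r < s)%N) F r s
   + \sum_(s | (c.2 s != None) && (s < r)%N) F r s)); last first.
  move=> r _; rewrite (bigID (fun s : 'I_n => (r < s)%N)) /=.
  by congr (_ + _); apply: eq_bigl => s; rewrite -andbA; congr (_ && _);
    rewrite -val_eqE /=; case: ltngtP.
rewrite big_split /= [X in _ + X](exchange_big_dep (fun s => c.2 s != None)) /=; last first.
  by move=> i j _ /andP[].
apply/eqP; rewrite addr_eq0 -sumrN; apply/eqP; apply: eq_bigr => r cr; rewrite -sumrN.
apply: eq_big => s; first by rewrite cr.
by case/andP=> cs rs; apply/eqP; rewrite -addr_eq0 F_anti.
Qed.

Definition last_letter w : option nat := low (supp w) n.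

Definition add_dot w (p : nat) : word n :=
  [ffun t : 'I_n => if t == p :> nat then Some true else w t].

(* Moving the dot of the bottom circle through the seam, onto the top circle. *)
Definition close (c : cell n) : {ffun word n -> k^o} :=
  if c.1 then
    if last_letter c.2 is Some p then
      if dot c.2 p then 0 else qi ^+ 2 *: delta k (add_dot c.2 p)
    else 0
  else delta k c.2.

Definition annular_d w : {ffun word n -> k^o} := lin close (linear_d (false, w)).

Lemma supp_add_dot w p t : (p < n)%N -> supp w p -> supp (add_dot w p) t = supp w t.
Proof.
move=> pn wp; case: (ltnP t n) => tn; last first.
  by rewrite /supp !insubF //; apply/negbTE; rewrite -leqNgt.
rewrite -[t]/(val (Ordinal tn)) !suppE ffunE /=; case: ifP => [/eqP e|] //.
by rewrite -suppE /= e wp.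
Qed.

Lemma dot_add_dot w p t : (p < n)%N -> dot (add_dot w p) t = (t == p) || dot w t.
Proof.
move=> pn; case: (ltnP t n) => tn; last first.
  rewrite /dot !insubF //; try by apply/negbTE; rewrite -leqNgt.
  by apply/esym/negbTE; rewrite orbF; lia.
by rewrite -[t]/(val (Ordinal tn)) !dotE ffunE /=; case: ifP.
Qed.

Lemma previous_add_dot w p r : (p < n)%N -> supp w p -> previous (add_dot w p) r = previous w r.
Proof. by move=> pn wp; apply: eq_low => t _; apply: supp_add_dot. Qed.

Lemma last_add_dot w p : (p < n)%N -> supp w p -> last_letter (add_dot w p) = last_letter w.
Proof. by move=> pn wp; apply: eq_low => t _; apply: supp_add_dot. Qed.

Lemma gaps_add_dot w p r : (p < n)%N -> supp w p -> gaps (add_dot w p) r = gaps w r.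
Proof.
move=> pn wp; congr #|pred_of_set _|; apply/setP=> t; rewrite !inE; congr (_ && _).
by apply: negb_inj; rewrite -!suppE supp_add_dot.
Qed.

Lemma last_remove w r : w r != None -> last_letter (remove_letter w r) =
  if last_letter w == Some (r : nat) then previous w r else last_letter w.
Proof. exact: previous_remove. Qed.

Lemma last_exists w r : w r != None -> exists p, last_letter w = Some p.
Proof. by rewrite -suppE => /(low_ex (ltn_ord r)). Qed.

Lemma previous_last w r p : last_letter w = Some p -> previous w r != Some p \/ w r = None.
Proof.
move=> lp; case wr: (w r) => [b|]; last by right.
left; apply/eqP => h; have [pr _] := previous_lt h; case/low_Some: lp => _ _ /(_ r).
by rewrite pr ltn_ord suppE wr => /(_ isT).
Qed.

(** A dot on the bottom circle may be moved through the seam before or after a letter is removed; if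
    the last letter is already dotted, both ways give zero. *)
Lemma term_close_true w r p : w r != None -> last_letter w = Some p ->
  lin close (linear_term (true, w) r) =
  if dot w p then 0 else qi ^+ 2 *: lin close (linear_term (false, add_dot w p) r).
Proof.
move=> wr lp; have [pn wp _] := (low_Some _ _ _).1 lp.
rewrite /linear_term !linZ !lin_delta /=.
rewrite gaps_add_dot // -[LHS]scalerA; case: (boolP (dot w p)) => dp.
  suff -> : (removable (true, w) r)%:R *: close (remove (true, w) r) = 0 by rewrite scaler0.
  rewrite /close /= last_remove // lp; case: eqP => [[e]|e]; last first.
    rewrite dot_remove dp /=; case: eqP => [e'|_]; last by rewrite scaler0.
    by case: e; rewrite e'.
  rewrite e in dp; rewrite /removable /= dp /=.
  case er: (previous w r) => [t|] /=; last by rewrite scale0r.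
  have [tr _] := previous_lt er.
  rewrite dot_remove er eqxx dp andbT orbT; case: (dot w t); rewrite ?scale0r //=.
  by rewrite (_ : t != r) ?scaler0 //; lia.
rewrite -(scalerA ((-1) ^+ gaps w r)) [RHS]scaler_swap; congr (_ *: _).
have prp : previous w r != Some p by case: (previous_last r lp) => // /eqP; rewrite (negPf wr).
have e1 : previous (add_dot w p) r = previous w r by exact: previous_add_dot.
have e2 : dot (add_dot w p) r = (r == p :> nat) || dot w r by exact: dot_add_dot.
have rem_add : r != p :> nat -> remove_letter (add_dot w p) r = add_dot (remove_letter w r) p.
  move=> rp; have sp : supp (remove_letter w r) p by rewrite supp_remove eq_sym rp.
  apply: word_ext => t.
    by rewrite supp_add_dot // !supp_remove supp_add_dot.
  rewrite dot_add_dot // !dot_remove !dot_add_dot // e1 (negPf rp) /=.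
  by case: (altP (t =P p)) => [->|] //=; rewrite eq_sym rp.
(* If the last letter itself is removed, the dot ends up on the new last letter either way; if no
   letter remains, both sides vanish. *)
case: (altP (r =P p :> nat)) => [rp|rp].
  subst p; have dr : dot w r = false by exact: negbTE.
  rewrite /removable /= e1 e2 dr eqxx /=.
  rewrite scale1r /close /= e1 e2 eqxx /= andbT last_remove // lp eqxx.
  case er: (previous w r) => [t|] /=; last first.
    rewrite last_remove; last by rewrite ffunE eqxx.
    by rewrite last_add_dot // lp eqxx e1 er !scaler0.
  have [tr wt] := previous_lt er.
  rewrite dot_remove dot_add_dot // dr andbF orbF.
  rewrite (_ : (t != r) = true) /=; last by lia.
  rewrite (_ : (t == r) = false) /=; last by lia.
  case: (boolP (dot w t)) => dt /=; first by rewrite scale0r scaler0.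
  rewrite scale1r; congr (_ *: delta _ _).
  have tn : (t < n)%N by lia.
  have st : supp (remove_letter w r) t by rewrite supp_remove wt andbT; lia.
  apply: word_ext => u.
    by rewrite supp_add_dot // !supp_remove supp_add_dot.
  rewrite dot_add_dot // !dot_remove dot_add_dot // e1 e2 dr eqxx /= er.
  rewrite andbF andbT orbF.
  case: (altP (u =P r :> nat)) => [->|ur] /=; first by lia.
  rewrite orbC; congr (_ || _); by apply/eqP/eqP => [->|[]].
rewrite /removable /= e1 e2 (negPf rp) /=.
have sd : slot_dot (true, w) (previous w r) = slot_dot (false, add_dot w p) (previous w r) || (previous w r == None).
  case er: (previous w r) prp => [t|] //= tp; rewrite dot_add_dot // orbF.
  by case: eqP => // e; rewrite e eqxx in tp.
rewrite sd /close /= e1 e2 (negPf rp) /= last_remove // lp.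
rewrite (_ : (Some p == Some (r : nat)) = false); last by apply/eqP=> -[e]; rewrite e eqxx in rp.
rewrite dot_remove (negPf dp) [p == _]eq_sym rp /= [Some p == _]eq_sym (negPf prp) /= -rem_add //.
case: (altP (previous w r =P None)) => [e|ne] /=; last by rewrite orbF [RHS]scaler_swap.
rewrite e; case: (boolP (dot w r)) => dr; last by rewrite /= !scale1r.
rewrite /= scale0r last_remove; last by rewrite -suppE supp_add_dot // suppE.
rewrite last_add_dot // lp (_ : (Some p == Some (r : nat)) = false); last first.
  by apply/eqP=> -[h]; rewrite h eqxx in rp.
by rewrite dot_remove dot_add_dot // eqxx eq_sym rp /= !scaler0.
Qed.

(** [close] intertwines the two differentials, so the annular differential squares to zero because
    the linear one does. *)
Lemma close_linear_d c : lin close (linear_d c) = lin annular_d (close c).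
Proof.
case: c => [[|] w]; last by rewrite [close (false, w)]/close /= lin_delta.
rewrite /linear_d lin_sum [close (true, w)]/close /=.
move e0: (last_letter w) => o; case: o e0 => [p|] lp; last first.
  rewrite lin0; apply: big1 => r wr.
  by have [p e] := last_exists wr; rewrite e in lp.
have [pn wp _] := (low_Some _ _ _).1 lp.
transitivity (\sum_(r | w r != None) if dot w p then 0
    else qi ^+ 2 *: lin close (linear_term (false, add_dot w p) r)).
  by apply: eq_bigr => r wr; apply: term_close_true.
case: ifP => dp; first by rewrite lin0 big1.
rewrite linZ lin_delta /annular_d /linear_d lin_sum -scaler_sumr; congr (_ *: _).
by apply: eq_bigl => r; rewrite -!suppE supp_add_dot.
Qed.

Lemma annular_dd w : lin annular_d (annular_d w) = 0.
Proof.
have -> : lin annular_d (annular_d w) = lin close (lin linear_d (linear_d (false, w))).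
  rewrite [RHS]lin_comp [annular_d w]/annular_d lin_comp.
  by apply: eq_bigr => c _; rewrite close_linear_d.
by rewrite linear_dd lin0.
Qed.

End Differential.

(** * A discrete Morse matching on words *)

Section Morse.
Variables (k : comPzRingType) (qi : k) (n : nat).
Implicit Types (w v : word n) (r s : 'I_n).

Definition annular_term w r : {ffun word n -> k^o} := lin (close qi (n := n)) (linear_term k (false, w) r).

Lemma annular_dE w : annular_d qi w = \sum_(r | w r != None) annular_term w r.
Proof. by rewrite /annular_d /linear_d lin_sum. Qed.

Lemma close_neq0 c w : close qi c w <> 0 ->
  if c.1 then exists p, [/\ last_letter c.2 = Some p, ~~ dot c.2 p & w = add_dot c.2 p]
  else w = c.2.
Proof.
rewrite /close; case: ifP => _; last by rewrite ffunE; case: eqP.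
move e: (last_letter _) => o; case: o e => [p|] e; last by rewrite ffunE.
case: ifP => [_|dp]; first by rewrite ffunE.
rewrite !ffunE; case: (w =P _) => [-> _|_]; first by exists p; rewrite dp.
by rewrite [_ *: _]mulr0.
Qed.

Lemma annular_term_neq0 w r u : annular_term w r u <> 0 ->
  removable (false, w) r /\ close qi (remove (false, w) r) u <> 0.
Proof.
rewrite /annular_term linZ lin_delta ffunE; case: removable => h.
  by split=> // h0; apply: h; rewrite h0 scaler0.
by case: h; rewrite mulr0 scale0r.
Qed.

Definition letters w : nat := #|[set t : 'I_n | w t != None]|.
Definition dotted_letters w : nat := #|[set t : 'I_n | w t == Some true]|.

Lemma letters_remove w r : w r != None -> letters w = (letters (remove_letter w r)).+1.
Proof.
move=> wr; rewrite /letters (cardsD1 r) inE wr add1n; congr _.+1; apply: eq_card => t.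
by rewrite !inE -!suppE supp_remove.
Qed.

Lemma dotted_letters_remove w r : removable (false, w) r ->
  dotted_letters w = ((remove (false, w) r).1 + dotted_letters (remove_letter w r))%N.
Proof.
rewrite /removable /= => ok; rewrite /dotted_letters.
case: (boolP (dot w r)) ok => dr /=; last first.
  rewrite andbF add0n => _; apply: eq_card => t; rewrite !inE -!dotE dot_remove (negPf dr) andbF orbF.
  by case: eqP => // /val_inj ->; rewrite (negPf dr).
rewrite (cardsD1 r) inE -dotE dr andbT.
move ep: (previous w r) => o; case: o ep => [p|] ep /= ok.
  have [pr _] := previous_lt ep; have pn : (p < n)%N by have := ltn_ord r; lia.
  rewrite [RHS](cardsD1 (Ordinal pn)) inE -dotE dot_remove /= ep eqxx dr orbT andbT.
  rewrite (_ : p != r) /=; last by lia.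
  rewrite ?add0n; congr (_ + _)%N; apply: eq_card => t; rewrite !inE -!dotE dot_remove -!val_eqE /= ep dr andbT.
  have -> : (Some (t : nat) == Some p) = (t == p :> nat) by apply/eqP/eqP => [[]|->].
  case: (altP (t =P p :> nat)) => [->|] /=; last by rewrite orbF.
  by rewrite (negPf ok) andbF.
congr (_ + _)%N; apply: eq_card => t; rewrite !inE -!dotE dot_remove ep -val_eqE.
by rewrite (_ : (Some (t : nat) == None) = false) ?orbF.
Qed.

Lemma letters_add_dot w p : (p < n)%N -> supp w p -> letters (add_dot w p) = letters w.
Proof. by move=> pn wp; apply: eq_card => t; rewrite !inE -!suppE supp_add_dot. Qed.

Lemma dotted_letters_add_dot w p : (p < n)%N -> ~~ dot w p ->
  dotted_letters (add_dot w p) = (dotted_letters w).+1.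
Proof.
move=> pn dp; rewrite /dotted_letters (cardsD1 (Ordinal pn)) inE -dotE dot_add_dot // eqxx add1n.
congr _.+1; apply: eq_card => t; rewrite !inE -!dotE dot_add_dot // -val_eqE /=.
by case: eqP => //= ->; rewrite (negPf dp).
Qed.

Lemma annular_term_graded w r u : w r != None -> annular_term w r u <> 0 ->
  letters w = (letters u).+1 /\ dotted_letters u = dotted_letters w.
Proof.
move=> wr /annular_term_neq0 [ok] /close_neq0.
have := dotted_letters_remove ok; rewrite (letters_remove wr).
case: ifP => [_ -> [p [/= lp dp ->]]|_ -> -> //].
have [pn wp _] := (low_Some _ _ _).1 lp.
by rewrite letters_add_dot // dotted_letters_add_dot.
Qed.

(** Each removal loses one letter, and unless it vanishes the dots are moved but never created or
    destroyed: the complex splits by their number. *)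
Lemma annular_d_graded w u : annular_d qi w u <> 0 ->
  letters w = (letters u).+1 /\ dotted_letters u = dotted_letters w.
Proof.
rewrite annular_dE sum_ffunE => h.
case: (boolP [exists r, (w r != None) && (annular_term w r u != 0)]).
  by case/existsP => r /andP[wr /eqP]; apply: annular_term_graded.
rewrite negb_exists => /forallP h0; case: h; rewrite big1 // => r wr.
by have := h0 r; rewrite wr /= negbK => /eqP.
Qed.

(** The length of the initial run of dotted letters. The position [lead w], free of dots, is where
    the matching inserts or deletes an undotted letter. *)
Definition lead w : nat := find (fun t => ~~ dot w t) (iota 0 n).

Lemma lead_le w : (lead w <= n)%N.
Proof. by rewrite -[X in (_ <= X)%N](size_iota 0 n) find_size. Qed.

Lemma lead_dot w t : (t < lead w)%N -> dot w t.
Proof.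
move=> h; have := before_find 0 h; rewrite nth_iota ?add0n; first by move/negbFE.
exact: leq_trans h (lead_le w).
Qed.

Lemma lead_undotted w : (lead w < n)%N -> ~~ dot w (lead w).
Proof.
move=> h; have : has (fun t => ~~ dot w t) (iota 0 n) by rewrite has_find size_iota.
by move/(nth_find 0); rewrite nth_iota.
Qed.

Lemma lead_eq w a : (a < n)%N -> (forall t, (t < a)%N -> dot w t) -> ~~ dot w a -> lead w = a.
Proof.
move=> an da na; case: (ltngtP (lead w) a) => // h.
  by have := lead_undotted (ltn_trans h an); rewrite da.
by rewrite (lead_dot h) in na.
Qed.

(** Matched words are those with some letter after the lead position. Whether that position is empty
    ([lower]) or holds an undotted letter ([upper]) tells the two ends of a matched pair apart. *)
Definition beyond w : bool := (lead w < n)%N && up (supp w) (lead w).+1 n.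
Definition lower w : bool := beyond w && ~~ supp w (lead w).
Definition upper w : bool := beyond w && supp w (lead w).

Definition insert w : word n := [ffun t : 'I_n => if t == lead w :> nat then Some false else w t].
Definition delete w : word n := [ffun t : 'I_n => if t == lead w :> nat then None else w t].

Lemma supp_insert w t : (lead w < n)%N -> supp (insert w) t = (t == lead w) || supp w t.
Proof.
move=> an; case: (ltnP t n) => tn; last first.
  by rewrite /supp !insubF ?orbF; [lia|apply/negbTE; rewrite -leqNgt..].
by rewrite -[t]/(val (Ordinal tn)) !suppE ffunE /=; case: ifP.
Qed.

Lemma dot_insert w t : (lead w < n)%N -> dot (insert w) t = dot w t.
Proof.
move=> an; case: (ltnP t n) => tn; last first.
  by rewrite /dot !insubF //; apply/negbTE; rewrite -leqNgt.
rewrite -[t]/(val (Ordinal tn)) !dotE ffunE /=; case: ifP => // /eqP e.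
by rewrite -dotE /= e; have := lead_undotted an => /negPf ->.
Qed.

Lemma supp_delete w t : (lead w < n)%N -> supp (delete w) t = (t != lead w) && supp w t.
Proof.
move=> an; case: (ltnP t n) => tn; last first.
  by rewrite /supp !insubF ?andbF //; apply/negbTE; rewrite -leqNgt.
by rewrite -[t]/(val (Ordinal tn)) !suppE ffunE /=; case: ifP.
Qed.

Lemma dot_delete w t : (lead w < n)%N -> dot (delete w) t = dot w t.
Proof.
move=> an; case: (ltnP t n) => tn; last first.
  by rewrite /dot !insubF //; apply/negbTE; rewrite -leqNgt.
rewrite -[t]/(val (Ordinal tn)) !dotE ffunE /=; case: ifP => // /eqP e.
by rewrite -dotE /= e; have := lead_undotted an => /negPf ->.
Qed.

Lemma lead_insert w : (lead w < n)%N -> lead (insert w) = lead w.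
Proof. by move=> an; apply: eq_find => t; rewrite dot_insert. Qed.

Lemma lead_delete w : (lead w < n)%N -> lead (delete w) = lead w.
Proof. by move=> an; apply: eq_find => t; rewrite dot_delete. Qed.

Lemma insert_upper w : lower w -> upper (insert w).
Proof.
case/andP=> /andP[an /upP[t ht st]] _; rewrite /upper /beyond lead_insert // an supp_insert // eqxx.
by rewrite andbT /=; apply/upP; exists t => //; rewrite supp_insert // st orbT.
Qed.

Lemma delete_lower w : upper w -> lower (delete w).
Proof.
case/andP=> /andP[an /upP[t ht st]] _; rewrite /lower /beyond lead_delete // an supp_delete // eqxx.
rewrite andbT /=; apply/upP; exists t => //; rewrite supp_delete // st andbT; lia.
Qed.

Lemma deleteK w : upper w -> insert (delete w) = w.
Proof.
case/andP=> /andP[an _] ns; apply: word_ext => t; last by rewrite dot_insert ?dot_delete // lead_delete.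
by rewrite supp_insert ?lead_delete // supp_delete //; case: eqP => // ->; rewrite ns.
Qed.

Lemma letters_insert w : lower w -> letters (insert w) = (letters w).+1.
Proof.
case/andP=> /andP[an _] ns; rewrite /letters (cardsD1 (Ordinal an)) inE -suppE supp_insert // eqxx add1n.
congr _.+1; apply: eq_card => t; rewrite !inE -!suppE supp_insert // -val_eqE /=.
by case: eqP => //= ->; rewrite (negPf ns).
Qed.

Lemma dotted_letters_insert w : lower w -> dotted_letters (insert w) = dotted_letters w.
Proof.
by case/andP=> /andP[an _] _; apply: eq_card => t; rewrite !inE -!dotE dot_insert.
Qed.

Definition last_undotted w : bool :=
  if last_letter w is Some p then ~~ dot w p else false.

(** The order in which the matching is triangular: first the state of the last letter, then the
    length of the initial run. The weight [n.+1] exceeds every value of [n - lead w]. *)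
Definition rank w : nat := ((if last_undotted w then n.+1 else 0) + (n - lead w))%N.

Lemma last_insert w : lower w -> last_letter (insert w) = last_letter w.
Proof.
case/andP=> /andP[an /upP[t /andP[at_ tn] st]] ns.
have [p lp] : exists p, last_letter w = Some p := low_ex tn st.
rewrite lp; case/low_Some: lp => pn wp hp; apply/low_Some; split=> //.
  by rewrite supp_insert // wp orbT.
move=> u hu; rewrite supp_insert // negb_or hp // andbT; apply/eqP => e.
case/andP: hu => pu _; have pt : (p < t)%N by apply: ltn_trans pu _; rewrite e.
by have /negP[] := hp t (introT andP (conj pt tn)).
Qed.

(** All earlier positions hold letters, so no gap contributes a sign, and merging an undotted circle
    just erases it. *)
Lemma annular_term_insert_lead w (an : (lead w < n)%N) : lower w ->
  annular_term (insert w) (Ordinal an) = delta k w.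
Proof.
move=> lw; have /andP[_ ns] := lw; set a := Ordinal an.
have da : dot (insert w) a = false by rewrite dot_insert //; apply/negbTE/lead_undotted.
rewrite /annular_term linZ lin_delta /removable /= da /= mulr1.
have -> : gaps (insert w) a = 0%N.
  apply/eqP; rewrite cards_eq0; apply/eqP/setP=> t; rewrite !inE; apply/negbTE/negP.
  case/andP=> ta; apply/negP; rewrite -suppE supp_insert // dot_supp ?orbT //.
  exact: lead_dot.
rewrite expr0 scale1r /close /= da andbF /=; congr delta; apply: word_ext => t.
  by rewrite supp_remove supp_insert //=; case: eqP => // ->; rewrite (negPf ns).
rewrite dot_remove da andbF orbF dot_insert //=; case: eqP => // ->.
by rewrite (negPf (lead_undotted an)).
Qed.

Lemma rank_type m x y : (m.+1 + x <= 0 + (m - y))%N = false.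
Proof. lia. Qed.

Lemma rank_lead m a (b b' : bool) : (b' <= b)%N -> (a < m)%N ->
  ((if b then m.+1 else 0) + (m - a) <= (if b' then m.+1 else 0) + (m - a.+1))%N = false.
Proof. case: b; case: b' => //; lia. Qed.

(** Removing any other letter of [insert w] gives zero, an upper word, or a lower word of strictly
    smaller rank. *)
Lemma annular_term_insert w u r : lower w -> lower u -> (rank w <= rank u)%N ->
  insert w r != None -> r != lead w :> nat -> annular_term (insert w) r u = 0.
Proof.
move=> lw lu ruw vr ra; apply/eqP/negPn/negP => /eqP /annular_term_neq0 [ok] /close_neq0.
have /andP[/andP[an bw] ns] := lw; have /andP[/andP[bn bu] nsu] := lu.
set v := insert w in vr ok *; set a := lead w in an bw ns ra.
have lv : last_letter v = last_letter w := last_insert lw.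
have dv t : dot v t = dot w t by exact: dot_insert.
have va : supp v a by rewrite supp_insert // eqxx.
have da : dot v a = false by rewrite dv; apply/negbTE/lead_undotted.
have leadv t : (t < a)%N -> dot v t by rewrite dv; apply: lead_dot.
have [t /andP[at_ tn] st] := upP _ _ _ bw.
have [p lp] : exists p, last_letter w = Some p := low_ex tn st.
have [pn wp hp] := (low_Some _ _ _).1 lp.
have pa : (a < p)%N.
  case: (leqP t p) => tp; first exact: leq_trans at_ tp.
  by have /negP[] := hp t (introT andP (conj tp tn)).
(* Before the lead position two dotted circles would merge, except when [r] is the first letter: its
   dot then passes the seam and dots the last letter, which lowers the rank. *)
case: (ltngtP r a) ra => // ra _; rewrite /=.
  have pr : (p == r :> nat) = false := gtn_eqF (ltn_trans ra pa).
  have dr : dot v r := leadv r ra.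
  rewrite dr andbT; case: (posnP r) => [er|r_gt0].
    have e0 : previous v r = None by rewrite /previous er.
    rewrite e0 eqxx => -[p' []]; rewrite last_remove // lv lp.
    have -> : (Some p == Some (r : nat)) = false := pr.
    case=> <-; rewrite dot_remove e0 /= orbF pr /= => dp eu; move: ruw; rewrite /rank.
    have sp : supp (remove_letter v r) p by rewrite supp_remove supp_insert // wp orbT andbT pr.
    have -> : last_undotted u = false.
      rewrite /last_undotted eu last_add_dot // last_remove // lv lp.
      have -> : (Some p == Some (r : nat)) = false := pr.
      by rewrite dot_add_dot // eqxx.
    have -> : last_undotted w by rewrite /last_undotted lp -dv.
    by rewrite rank_type.
  have er : r = r.-1.+1 :> nat by rewrite prednK.
  have r1a : (r.-1 < a)%N by rewrite -er ltnW.
  have e0 : previous v r = Some r.-1.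
    by rewrite /previous [X in low _ X]er /= dot_supp // leadv.
  by move: ok; rewrite /removable /= dr e0 /= leadv.
have [r' pr] : exists r' : nat, previous v r = Some r' by apply: (low_ex (t := a)).
have [r'r sr' hr'] := (low_Some _ _ _).1 pr.
have r'a : (a <= r')%N.
  by rewrite leqNgt; apply/negP => h; have := hr' a; rewrite h ra va => /(_ isT).
have ar : (a == r :> nat) = false := ltn_eqF ra.
rewrite pr /= => eu.
have lead_u t' : (t' < a)%N -> dot u t'.
  by move=> ta; rewrite eu dot_remove leadv // andbT (ltn_eqF (ltn_trans ta ra)).
(* Either position [a] stays undotted and [u] is upper, or it receives the dot of [r]. In the latter
   case position [a.+1] is empty, so the initial run grows by exactly one. *)
case: (boolP ((r' == a) && dot v r)) => [/andP[/eqP ea dr]|h]; last first.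
  have du : ~~ dot u a.
    rewrite eu dot_remove da /= pr (_ : (Some a == Some r') = (r' == a)).
      by rewrite (negPf h) andbF.
    by rewrite eq_sym.
  have eL : lead u = a by apply: lead_eq.
  by move: nsu; rewrite eL eu supp_remove va andbT ar.
have dua : dot u a by rewrite eu dot_remove da pr ea eqxx dr ar.
have nsa : ~~ supp u a.+1.
  rewrite eu supp_remove; case: (altP (a.+1 =P r :> nat)) => //= ne.
  by apply: hr'; rewrite ea leqnn ltn_neqAle ne ra.
have an1 : (a.+1 < n)%N := leq_ltn_trans ra (ltn_ord r).
have eL : lead u = a.+1.
  apply: lead_eq => // [t'|]; last by apply: contra nsa; apply: dot_supp.
  by rewrite ltnS leq_eqVlt => /orP[/eqP->|/lead_u].
move: ruw; rewrite /rank eL -/a rank_lead //.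
rewrite /last_undotted [last_letter u](_ : _ = last_letter (remove_letter v r)) ?eu //.
rewrite last_remove // lv lp; case: eqP => [[e]|ne].
  by rewrite pr ea -eu dua.
rewrite dot_remove dv pr ea (_ : (p != r)); last by apply/eqP => e; apply: ne; rewrite e.
by rewrite (_ : (Some p == Some a) = false) ?orbF //; exact: gtn_eqF.
Qed.

Lemma annular_d_insert w u : lower w -> lower u -> (rank w <= rank u)%N ->
  annular_d qi (insert w) u = (u == w)%:R.
Proof.
move=> lw lu ruw; have /andP[/andP[an _] _] := lw.
rewrite annular_dE sum_ffunE (bigD1 (Ordinal an)); last first.
  by rewrite -suppE supp_insert // eqxx.
rewrite annular_term_insert_lead // ffunE big1; first exact: addr0.
by move=> r /andP[vr ra]; apply: annular_term_insert.
Qed.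

End Morse.

(** * Two functionals that detect the critical words *)

Lemma card_ord_lt n m : (m <= n)%N -> #|[set t : 'I_n | (t < m)%N]| = m.
Proof.
move=> mn; rewrite -[RHS]card_ord -(card_imset predT (f := widen_ord mn)); last first.
  by move=> i j /(congr1 val) /= /val_inj.
apply: eq_card => t; rewrite inE; apply/idP/imsetP => [tm|[i _ ->]]; last exact: (ltn_ord i).
by exists (Ordinal tm) => //; apply: val_inj.
Qed.

Section Functionals.
Variables (k : comPzRingType) (q qi : k) (n : nat).
Hypothesis hq : q * qi = 1.
Implicit Types (w v : word n) (r s p m : 'I_n).

Definition before w r : nat := #|[set t : 'I_n | (t < r)%N && (w t != None)]|.

Lemma gaps_before w r : (gaps w r + before w r)%N = r.
Proof.
rewrite -[RHS](card_ord_lt (ltnW (ltn_ord r))) /gaps /before.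
rewrite -(cardsID [set t | w t == None] [set t : 'I_n | (t < r)%N]).
by congr (_ + _)%N; apply: eq_card => t; rewrite !inE // andbC.
Qed.

Lemma letters_exists w : (0 < letters w)%N -> exists r, w r != None.
Proof. by rewrite card_gt0 => /set0Pn[r]; rewrite inE => h; exists r. Qed.

Lemma last_letter_ord w r : w r != None -> exists2 m : 'I_n, last_letter w = Some (m : nat) & w m != None.
Proof.
move=> /last_exists[p lp]; have [pn wp _] := (low_Some _ _ _).1 lp.
by exists (Ordinal pn) => //; rewrite -suppE.
Qed.

Lemma last_max w m r : last_letter w = Some (m : nat) -> w r != None -> (r <= m)%N.
Proof.
move=> /low_Some[_ _ h] wr; rewrite leqNgt; apply/negP => mr.
by have /negP[] := h r (introT andP (conj mr (ltn_ord r))); rewrite suppE.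
Qed.

Lemma previous_uniq w p r s : w r != None -> w s != None ->
  previous w r = Some (p : nat) -> previous w s = Some (p : nat) -> r = s.
Proof.
wlog rs : r s / (r < s)%N.
  move=> h wr ws er es; case: (ltngtP r s) => rs; [exact: h|exact/esym/h|exact: val_inj].
move=> wr ws /low_Some[pr _ _] /low_Some[_ _ h].
by have /negP[] := h r (introT andP (conj pr rs)); rewrite suppE.
Qed.

Lemma next_letter w p m : w p != None -> last_letter w = Some (m : nat) -> p != m ->
  exists2 s, w s != None & previous w s = Some (p : nat).
Proof.
move=> wp lm pm; have [mn wm _] := (low_Some _ _ _).1 lm.
have pltm : (p < m)%N by rewrite ltn_neqAle pm (last_max lm wp).
have ex : exists t, (p < t)%N && supp w t by exists m; rewrite pltm wm.
case: (ex_minnP ex) => t /andP[pt wt] tmin.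
have tn : (t < n)%N := supp_lt wt.
exists (Ordinal tn); first by rewrite -suppE.
apply/low_Some; split=> //; first by rewrite suppE.
move=> u /andP[pu ut]; apply/negP => wu; have := tmin u; rewrite pu wu => /(_ isT).
by rewrite leqNgt ut.
Qed.

Lemma before_next w p s : previous w s = Some (p : nat) -> before w s = (before w p).+1.
Proof.
case/low_Some=> ps wp h; rewrite /before (cardsD1 p) inE ps -suppE wp add1n.
congr _.+1; apply: eq_card => t; rewrite !inE -!suppE -val_eqE /=.
case: (ltngtP t p) => //= tp.
  by rewrite (ltn_trans tp ps).
case: (boolP (t < s)%N) => //= ts.
by apply/negbTE/h; rewrite tp ts.
Qed.

Lemma before_first w r : previous w r = None -> before w r = 0%N.
Proof.
move/low_None => h; apply/eqP; rewrite cards_eq0; apply/eqP/setP=> t; rewrite !inE -suppE.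
by case: (boolP (t < r)%N) => //= /h/negPf.
Qed.

(** Since [gaps] and [before] add up to the position, this rescaling trades the sign counting gaps
    for one counting letters, see [sign_gaps]. That sign alternates from one letter to the next,
    which produces the cancellations below. *)
Definition eps w : k := (-1) ^+ (\sum_(r | w r != None) r)%N.

Lemma eps_remove w r : w r != None -> eps w = (-1) ^+ r * eps (remove_letter w r).
Proof.
move=> wr; rewrite /eps (bigD1 r) //= exprD; congr (_ * _ ^+ _).
by apply: eq_bigl => t; rewrite -!suppE supp_remove andbC.
Qed.

Lemma eps_add_dot w (p : nat) : supp w p -> (p < n)%N -> eps (add_dot w p) = eps w.
Proof.
by move=> wp pn; rewrite /eps; congr (_ ^+ _); apply: eq_bigl => t; rewrite -!suppE supp_add_dot.
Qed.

Lemma signM (a : nat) : (-1) ^+ a * (-1) ^+ a = 1 :> k.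
Proof. by rewrite -exprD addnn -mul2n exprM sqrrN expr1n expr1n. Qed.

Lemma sign_gaps w r : w r != None ->
  (-1) ^+ gaps w r * eps (remove_letter w r) = (-1) ^+ before w r * eps w :> k.
Proof.
move=> wr; rewrite (eps_remove wr).
have -> : (-1) ^+ r = (-1) ^+ before w r * (-1) ^+ gaps w r :> k.
  by rewrite mulrC -exprD gaps_before.
by rewrite !mulrA signM mul1r.
Qed.

(** Extended linearly, [eps_part] reads off the class of a chain with [z = D], and [open_part] that
    of a cycle with [z = D + 1]. *)
Definition eps_part w : k^o := eps w.
Definition open_part w : k^o := eps w * (last_undotted w)%:R.

Lemma functional_term (F : word n -> k^o) w r :
  lin F (annular_term qi w r) =
  (-1) ^+ gaps w r * ((removable (false, w) r)%:R * (lin F (close qi (remove (false, w) r)) : k)) :> k.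
Proof. rewrite /annular_term linZ lin_delta linZ; apply: esym; exact: mulrA. Qed.

Lemma lin_annular (F : word n -> k^o) w :
  lin F (annular_d qi w) = \sum_(r | w r != None)
  (-1) ^+ gaps w r * ((removable (false, w) r)%:R * (lin F (close qi (remove (false, w) r)) : k)) :> k.
Proof. by rewrite annular_dE lin_sum; apply: eq_bigr => r _; apply: functional_term. Qed.

Lemma total_close (c : cell n) : lin eps_part (close qi c) =
  (if c.1 then if last_undotted c.2 then qi ^+ 2 else 0 else 1) * eps c.2 :> k.
Proof.
rewrite /close /last_undotted; case: c.1; last by rewrite lin_delta mul1r.
move e: (last_letter _) => o; case: o e => [p|] e; last by rewrite lin0 mul0r.
have [pn wp _] := (low_Some _ _ _).1 e.
case: (dot _ _); first by rewrite lin0 mul0r.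
rewrite linZ lin_delta; congr (_ * _); exact: eps_add_dot.
Qed.

Lemma open_close (c : cell n) : lin open_part (close qi c) =
  (~~ c.1 && last_undotted c.2)%:R * eps c.2 :> k.
Proof.
rewrite /close; case: c.1; last by rewrite lin_delta /open_part mulrC.
rewrite mul0r; move e: (last_letter _) => o; case: o e => [p|] e; last by rewrite lin0.
have [pn wp _] := (low_Some _ _ _).1 e.
case: (dot _ _); first by rewrite lin0.
rewrite linZ lin_delta /open_part /last_undotted last_add_dot // e dot_add_dot // eqxx.
by rewrite mulr0 scaler0.
Qed.

Lemma lin_total w : lin eps_part (annular_d qi w) = eps w *
  \sum_(r | w r != None) (-1) ^+ before w r * ((removable (false, w) r)%:R *
    (if (previous w r == None) && dot w r
     then if last_undotted (remove_letter w r) then qi ^+ 2 else 0 else 1)) :> k.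
Proof.
rewrite lin_annular mulr_sumr; apply: eq_bigr => r wr; rewrite total_close /=.
set b := _%:R; set F := (X in b * (X * _)).
rewrite mulrCA (mulrCA _ F) (mulrA b F) sign_gaps //.
by rewrite mulrC -mulrA mulrCA.
Qed.

Lemma lin_open w : lin open_part (annular_d qi w) = eps w *
  \sum_(r | w r != None) (-1) ^+ before w r * ((removable (false, w) r)%:R *
    (~~ ((previous w r == None) && dot w r) && last_undotted (remove_letter w r))%:R) :> k.
Proof.
rewrite lin_annular mulr_sumr; apply: eq_bigr => r wr; rewrite open_close /=.
set b := _%:R; set F := (X in b * (X * _)).
rewrite mulrCA (mulrCA _ F) (mulrA b F) sign_gaps //.
by rewrite mulrC -mulrA mulrCA.
Qed.

Definition undotted w : {set 'I_n} := [set r | w r == Some false].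

Lemma card_undotted w : letters w = (dotted_letters w + #|undotted w|)%N.
Proof.
rewrite /letters -(cardsID [set r | w r == Some true]); congr (_ + _)%N.
  by apply: eq_card => t; rewrite !inE; case: (w t) => [[]|].
by apply: eq_card => t; rewrite !inE; case: (w t) => [[]|].
Qed.

Lemma undottedE w r : (r \in undotted w) = (w r != None) && ~~ dot w r.
Proof. by rewrite inE dotE; case: (w r) => [[]|]. Qed.

(** The Morse differential from [open_word n D] to [bottom_word n D], up to signs. For [D = 0] the
    seam term is absent, as no dot is there to travel. *)
Definition gamma (D : nat) : k := if D is 0 then 1 else qi ^+ 2 + (-1) ^+ D.

(** The word has one undotted letter [p]. Removing [p] cancels against removing the next letter,
    whose dot drops onto [p]. If [p] is last, the cyclically next letter is the first one, and its
    dot arrives through the seam with factor [qi ^+ 2]. *)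
Lemma lin_total_annular D w : letters w = D.+1 -> dotted_letters w = D ->
  lin eps_part (annular_d qi w) = gamma D * (open_part w : k) :> k.
Proof.
move=> lw dw; have /cards1P[p up] : #|undotted w| == 1%N.
  by have := card_undotted w; rewrite lw dw; lia.
have pU r : (r \in undotted w) = (r == p) by rewrite up inE.
have : p \in undotted w by rewrite pU.
rewrite undottedE => /andP[wp dp].
have dr r : w r != None -> r != p -> dot w r.
  by move=> wr rp; apply/negPn; move: (pU r); rewrite undottedE wr (negPf rp) /= => ->.
have [m lm wm] := last_letter_ord wp.
have last_m : last_undotted w = (m == p).
  by rewrite /last_undotted lm; have := pU m; rewrite undottedE wm /= => ->.
rewrite lin_total /open_part last_m mulrCA; congr (_ * _).
have remp : removable (false, w) p by rewrite /removable /= (negPf dp).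
pose t r : k := (-1) ^+ before w r * ((removable (false, w) r)%:R *
    (if (previous w r == None) && dot w r
     then if last_undotted (remove_letter w r) then qi ^+ 2 else 0 else 1)).
have tp : t p = (-1) ^+ before w p by rewrite /t remp (negPf dp) andbF !mulr1.
(* A dotted letter whose predecessor is dotted cannot be removed. *)
have t_mid r b : w r != None -> r != p -> previous w r = Some b -> b != p -> t r = 0.
  move=> wr rp e bp; rewrite /t e /= /removable /= dr // e /=.
  have [_ wb] := previous_lt e; have bn := supp_lt wb.
  by rewrite -[b]/(val (Ordinal bn)) dr // -?suppE // mul0r mulr0.
have t_first r : w r != None -> r != p -> previous w r = None ->
    t r = if m == p then qi ^+ 2 else 0.
  move=> wr rp e; rewrite /t e /= /removable /= dr // e /= before_first // !mul1r.
  have rm : r != m.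
    apply/eqP => rm; have := last_max lm wp; rewrite -rm leq_eqVlt => /orP[/eqP /val_inj h|pr].
      by rewrite h eqxx in rp.
    by move/low_None: e => /(_ _ pr); rewrite suppE wp.
  rewrite /last_undotted last_remove // lm (_ : (Some (m : nat) == Some (r : nat)) = false); last first.
    by apply/negbTE; rewrite eq_sym; apply: contraNneq rm => -[/val_inj ->].
  rewrite dot_remove e /= orbF [m == r :> nat]eq_sym (_ : (r != m :> nat)) //=.
  by have := pU m; rewrite undottedE wm /= => ->.
rewrite -[\sum_(r | _) _]/(\sum_(r | w r != None) t r) (bigD1 p) //= tp.
case: (altP (m =P p)) => mp; last first.
  rewrite mulr0; have pm : p != m by rewrite eq_sym.
  have [s ws es] := next_letter wp lm pm.
  have sp : s != p by apply/eqP=> h; have [] := previous_lt es; rewrite h ltnn.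
  rewrite (bigD1 s) ?ws //= big1 ?addr0 => [|r /andP[/andP[wr rp] rs]].
    rewrite /t (before_next es) es /= /removable /= es /= (negPf dp) andbF !mulr1 exprS.
    by ring.
  case er: (previous w r) => [b|]; last by rewrite t_first // (negPf mp).
  apply: (t_mid r b) => //; apply: contra rs => /eqP bp.
  by rewrite bp in er; rewrite (previous_uniq wr ws er es).
(* Now [p] is the last letter, so all [D] dotted letters precede it. *)
have bp : before w p = D.
  rewrite /before -[RHS]dw /dotted_letters; apply: eq_card => r; rewrite !inE -dotE -suppE.
  apply/andP/idP => [[rp wr]|drr].
    by apply: dr; rewrite -?suppE //; apply: contraTneq rp => ->; rewrite ltnn.
  have wr := dot_supp drr; split=> //; rewrite suppE in wr.
  have := last_max lm wr; rewrite mp leq_eqVlt => /orP[/eqP /val_inj h|//].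
  by rewrite -h drr in dp.
rewrite bp mulr1.
case: D lw dw bp => [|D] lw dw bp.
  rewrite /gamma expr0 big1 ?addr0 // => r /andP[wr rp].
  have := dr r wr rp; rewrite dotE => h.
  have : (0 < dotted_letters w)%N by rewrite card_gt0; apply/set0Pn; exists r; rewrite inE.
  by rewrite dw.
have [r0 wr0 fr0] : exists2 r0, w r0 != None & previous w r0 = None.
  have ex : exists u, supp w u by exists p; rewrite suppE.
  case: (ex_minnP ex) => u wu umin; have un := supp_lt wu.
  exists (Ordinal un); first by rewrite -suppE.
  by apply/low_None => v vu; apply/negP=> /umin; rewrite leqNgt vu.
have r0p : r0 != p by apply/eqP => h; have := before_first fr0; rewrite h bp.
rewrite (bigD1 r0) ?wr0 //= t_first // mp eqxx big1 ?addr0 => [|r /andP[/andP[wr rp] rr0]].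
  by rewrite /gamma addrC.
case er: (previous w r) => [b|].
  apply: (t_mid r b) => //; apply/eqP => bp'.
  have [pr _] := previous_lt er; have := last_max lm wr; rewrite mp -bp' leqNgt pr.
  by [].
case/eqP: rr0; case: (ltngtP r r0) => h; last exact: val_inj.
  by move/low_None: fr0 => /(_ _ h); rewrite suppE wr.
by move/low_None: er => /(_ _ h); rewrite suppE wr0.
Qed.

End Functionals.

(** * Elimination along the matching and the homology of words *)

Section Homology.
Variables (k : comPzRingType) (q qi : k) (n : nat).
Hypothesis hq : q * qi = 1.
Implicit Types (w v : word n) (r s p m : 'I_n).

(** There are two undotted letters. A word with undotted last letter can only come from one whose
    last letter is undotted, and then removing the other undotted letter [p] cancels against
    removing the letter after it. *)
Lemma lin_open_annular D w : letters w = D.+2 -> dotted_letters w = D ->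
  lin (@open_part k n) (annular_d qi w) = 0.
Proof.
move=> lw dw; rewrite lin_open.
have [r0 wr0] : exists r, w r != None by apply: letters_exists; rewrite lw.
have [m lm wm] := last_letter_ord wr0.
pose t r : k := (-1) ^+ before w r * ((removable (false, w) r)%:R *
    (~~ ((previous w r == None) && dot w r) && last_undotted (remove_letter w r))%:R).
rewrite -[\sum_(r | _) _]/(\sum_(r | w r != None) t r).
have lu_remove r : w r != None -> r != m ->
    last_undotted (remove_letter w r) = ~~ (dot w m || (Some (m : nat) == previous w r) && dot w r).
  move=> wr rm; rewrite /last_undotted last_remove // lm.
  rewrite (_ : (Some (m : nat) == Some (r : nat)) = false).
    by rewrite dot_remove (_ : (m != r :> nat)) // eq_sym.
  by apply/negbTE; rewrite eq_sym; apply: contraNneq rm => -[/val_inj ->].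
have lu_last b : previous w m = Some b -> last_undotted (remove_letter w m) = ~~ (dot w b || dot w m).
  move=> e; rewrite /last_undotted last_remove // lm eqxx e dot_remove e eqxx /=.
  by have [bm _] := previous_lt e; rewrite (ltn_eqF bm).
(* With a dotted last letter every removal leaves the last letter dotted or leaves no term. *)
case: (boolP (dot w m)) => dm.
  rewrite big1 ?mulr0 // => r wr; rewrite /t.
  case: (altP (r =P m)) => [->|rm]; last by rewrite lu_remove // dm andbF !mulr0.
  case e: (previous w m) => [b|] /=; first by rewrite (lu_last b) // dm orbT !mulr0.
  by rewrite dm !mulr0.
have mU : m \in undotted w by rewrite undottedE wm.
have : #|undotted w :\ m| == 1%N.
  have := cardsD1 m (undotted w); rewrite mU => h.
  by have := card_undotted w; rewrite lw dw h -[D.+2]addn2 => /addnI/eqP; rewrite eq_sym.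
case/cards1P => p up.
have pU r : (r \in undotted w :\ m) = (r == p) by rewrite up inE.
have : p \in undotted w :\ m by rewrite pU.
rewrite !inE => /andP[pm hp].
have wp : w p != None by rewrite (eqP hp).
have dp : ~~ dot w p by rewrite dotE (eqP hp).
have dr r : w r != None -> r != p -> r != m -> dot w r.
  move=> wr rp rm; apply/negPn; move: (pU r).
  by rewrite inE undottedE wr (negPf rp) /= inE rm /= => ->.
have [s ws es] := next_letter wp lm pm.
have sp : s != p by apply/eqP=> h; have [] := previous_lt es; rewrite h ltnn.
have remp : removable (false, w) p by rewrite /removable /= (negPf dp).
have tp : t p = (-1) ^+ before w p.
  by rewrite /t remp (negPf dp) andbF lu_remove // (negPf dm) (negPf dp) andbF !mulr1.
have ts : t s = (-1) ^+ (before w p).+1.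
  rewrite /t (before_next es) es /= /removable /= es /= (negPf dp) andbF.
  case: (altP (s =P m)) => [sm|sm].
    by rewrite sm (lu_last p) ?sm // -?sm // (negPf dp) sm (negPf dm) !mulr1.
  rewrite lu_remove // es (negPf dm) (_ : (Some (m : nat) == Some (p : nat)) = false) ?mulr1 //.
  by apply/negbTE; rewrite eq_sym; apply: contraNneq pm => -[/val_inj ->].
rewrite (bigD1 p) //= (bigD1 s) ?ws //= big1 ?addr0 => [|r /andP[/andP[wr rp] rs]].
  by rewrite tp ts exprS mulN1r subrr mulr0.
have prev_dot b : previous w r = Some b -> dot w b.
  move=> er; have [br wb] := previous_lt er; have bn := supp_lt wb.
  rewrite -[b]/(val (Ordinal bn)); apply: dr; first by rewrite -suppE.
    by apply: contraNneq rs => bp; rewrite (previous_uniq wr ws _ es) // -bp.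
  apply/eqP => bm; have := last_max lm wr; rewrite leqNgt => /negP[].
  by rewrite -bm.
rewrite /t; case: (altP (r =P m)) => [rm|rm].
  case er: (previous w r) => [b|].
    by rewrite rm (lu_last b) -?rm // (prev_dot b er) /= !mulr0.
  have ps := (previous_lt es).1; have := last_max lm ws; rewrite -rm => sr.
  by move/low_None: er => /(_ _ (leq_trans ps sr)); rewrite suppE wp.
rewrite /removable /= dr // lu_remove //.
case er: (previous w r) => [b|] /=; last by rewrite !mulr0.
by rewrite (prev_dot b er) mul0r mulr0.
Qed.

Notation chain := {ffun word n -> k^o}.
Implicit Types (x y : chain) (z D b : nat).

Definition graded z D x : Prop :=
  forall w, x w <> 0 -> letters w = z /\ dotted_letters w = D.

Definition word_diff x : chain := lin (annular_d qi (n := n)) x.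

Lemma diffE x u : word_diff x u = \sum_w (x w : k) * (annular_d qi w u : k) :> k.
Proof. by rewrite /word_diff /lin sum_ffunE; apply: eq_bigr => w _; rewrite ffunE. Qed.

Lemma sum_neq0 (J : finType) (h : J -> k) : \sum_j h j <> 0 -> exists j, h j <> 0.
Proof.
move=> hs; case: (boolP [exists j, h j != 0]) => [/existsP[j /eqP hj]|]; first by exists j.
rewrite negb_exists => /forallP h0; case: hs; apply: big1 => j _.
by have := h0 j; rewrite negbK => /eqP.
Qed.

Lemma graded_diff z D x : graded z.+1 D x -> graded z D (word_diff x).
Proof.
move=> gx u; rewrite diffE => /sum_neq0[w hw].
have xw : x w <> 0 by move=> e; apply: hw; rewrite e mul0r.
have dw : annular_d qi w u <> 0 by move=> e; apply: hw; rewrite e mulr0.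
have [lw dw'] := gx _ xw; have [h1 h2] := annular_d_graded dw.
by split; [apply: succn_inj; rewrite -h1|rewrite h2].
Qed.

Lemma gradedB z D x y : graded z D x -> graded z D y -> graded z D (x - y).
Proof.
move=> gx gy w h; case: (x w =P 0) => [x0|/gx //]; apply: gy => y0.
by apply: h; rewrite !ffunE x0 y0 subrr.
Qed.

Lemma gradedD z D x y : graded z D x -> graded z D y -> graded z D (x + y).
Proof.
move=> gx gy w h; case: (x w =P 0) => [x0|/gx //]; apply: gy => y0.
by apply: h; rewrite !ffunE x0 y0 addr0.
Qed.

Lemma diff_diff x : word_diff (word_diff x) = 0.
Proof.
rewrite /word_diff lin_comp /lin big1 // => w _; rewrite -/(lin _ _) annular_dd.
exact: scaler0.
Qed.

(** Gaussian elimination from the highest rank downwards; [b] bounds the ranks of the lower words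
    still present. *)
Lemma eliminate_rank z D b x : graded z D x ->
    (forall u, lower u -> (b <= rank u)%N -> x u = 0) ->
  exists y, [/\ graded z.+1 D y, (forall w, y w <> 0 -> upper w)
            & forall u, lower u -> (x - word_diff y) u = 0].
Proof.
elim: b x => [|b IH] x gx hx.
  exists 0; split=> [w|w|u lu]; rewrite ?ffunE //.
  by rewrite /word_diff lin0 ffunE subr0; apply: hx.
(* By triangularity the boundary of [y0] equals [x] on lower words of rank [b] and is zero on those
   of higher rank. *)
pose y0 : chain := \sum_(u | lower u && (rank u == b)) (x u : k) *: delta k (insert u).
have y0P w : y0 w <> 0 -> exists u, [/\ lower u, x u <> 0 & w = insert u].
  rewrite sum_ffunE => h.
  have [u] : exists u, (if lower u && (rank u == b) then ((x u : k) *: delta k (insert u)) w else 0) <> 0.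
    by apply: sum_neq0; rewrite -big_mkcond.
  case: ifP => // /andP[lu _]; rewrite !ffunE => hu; exists u; split=> //.
    by move=> e; apply: hu; rewrite e scale0r.
  by apply/eqP/negPn/negP => /negPf e; apply: hu; rewrite e scaler0.
have gy0 : graded z.+1 D y0.
  move=> w /y0P[u [lu xu ->]]; have [h1 h2] := gx _ xu.
  by rewrite letters_insert // dotted_letters_insert // h1.
have dy0 u : lower u -> (b <= rank u)%N -> word_diff y0 u = x u.
  move=> lu bu; rewrite /word_diff lin_sum sum_ffunE.
  rewrite (eq_bigr (fun v => (x v : k) * (u == v)%:R)); last first.
    move=> v /andP[lv /eqP rv]; rewrite linZ lin_delta ffunE annular_d_insert // rv //.
  case: (rank u =P b) => [rb|rb].
    rewrite (bigD1 u) /= ?lu ?rb ?eqxx // mulr1 big1; first exact: addr0.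
    by move=> v /andP[_ /negPf]; rewrite eq_sym => ->; rewrite mulr0.
  rewrite big1 => [|v /andP[_ /eqP rv]].
    by rewrite hx // ltn_neqAle bu andbT eq_sym; apply/eqP.
  by case: eqP => [e|]; rewrite ?mulr0 //; case: rb; rewrite e.
have [y1 [gy1 uy1 hy1]] : exists y, [/\ graded z.+1 D y, (forall w, y w <> 0 -> upper w)
            & forall u, lower u -> (x - word_diff y0 - word_diff y) u = 0].
  apply: IH; first by apply: gradedB gx (graded_diff gy0).
  by move=> u lu bu; rewrite !ffunE dy0 // subrr.
exists (y0 + y1); split; first exact: gradedD.
  move=> w h; case: (y0 w =P 0) => [e|/y0P[u [lu _ ->]]]; last exact: insert_upper.
  by apply: uy1 => e1; apply: h; rewrite !ffunE e e1 addr0.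
by move=> u lu; rewrite /word_diff linD opprD addrA; apply: hy1.
Qed.

Lemma rank_lt w : (rank w < (n + n).+2)%N.
Proof.
rewrite ltnS -addSn; apply: leq_add; last exact: leq_subr.
by case: ifP.
Qed.

Lemma eliminate z D x : graded z D x ->
  exists y, [/\ graded z.+1 D y, (forall w, y w <> 0 -> upper w)
            & forall u, lower u -> (x - word_diff y) u = 0].
Proof.
move=> gx; apply: (@eliminate_rank _ _ (n + n).+2) => // u _; rewrite leqNgt => /negP[].
exact: rank_lt.
Qed.

(** The same triangularity read as injectivity: the coefficients at [insert u] vanish by downward
    induction on the rank of [u]. *)
Lemma upper_diff_inj x : (forall w, x w <> 0 -> upper w) ->
  (forall u, lower u -> word_diff x u = 0) -> x = 0.
Proof.
move=> ux dx.
have key b u : lower u -> ((n + n).+2 - rank u <= b)%N -> x (insert u) = 0.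
  elim: b u => [|b IH] u lu hb.
    exfalso; move: hb; rewrite leqn0 subn_eq0 leqNgt => /negP[].
    exact: rank_lt.
  have := dx u lu; rewrite diffE (bigD1 (insert u)) //= annular_d_insert // eqxx mulr1.
  rewrite big1 => [|w wu]; first by move=> <-; exact/esym/addr0.
  case: (x w =P 0) => [->|xw]; first exact: mul0r.
  have uw := ux _ xw; have lw := delete_lower uw; rewrite -(deleteK uw).
  case: (leqP (rank (delete w)) (rank u)) => ruw.
    rewrite annular_d_insert // (_ : (u == delete w) = false) ?mulr0 //.
    by apply/negbTE; apply: contraNneq wu => ->; rewrite deleteK.
  rewrite IH ?mul0r //.
  rewrite -ltnS; apply: leq_trans hb; apply: ltn_sub2l => //.
  exact: rank_lt.
apply/ffunP=> w; rewrite ffunE; case: (x w =P 0) => // xw.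
by have uw := ux _ xw; rewrite -(deleteK uw) (key _ _ (delete_lower uw) (leqnn _)).
Qed.

(** This and [open_word] are the unmatched words. *)
Definition bottom_word D : word n := [ffun t : 'I_n => if (t < D)%N then Some true else None].
Definition open_word D : word n :=
  [ffun t : 'I_n => if (t < D)%N then Some true else if t == D :> nat then Some false else None].

Lemma dotted_bottom D : (D <= n)%N -> dotted_letters (bottom_word D) = D.
Proof.
move=> Dn; rewrite -[RHS](card_ord_lt Dn); apply: eq_card => t; rewrite !inE ffunE.
by case: ifP.
Qed.

Lemma letters_bottom D : (D <= n)%N -> letters (bottom_word D) = D.
Proof.
move=> Dn; rewrite -[RHS](card_ord_lt Dn); apply: eq_card => t; rewrite !inE ffunE.
by case: ifP.
Qed.

Lemma dotted_open D : (D < n)%N -> dotted_letters (open_word D) = D.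
Proof.
move=> Dn; rewrite -[RHS](card_ord_lt (ltnW Dn)); apply: eq_card => t; rewrite !inE ffunE.
by case: ifP => //; case: ifP.
Qed.

Lemma letters_open D : (D < n)%N -> letters (open_word D) = D.+1.
Proof.
move=> Dn; rewrite -[RHS](card_ord_lt Dn); apply: eq_card => t; rewrite !inE ffunE.
by rewrite [RHS]ltnS [RHS]leq_eqVlt; case: ltngtP.
Qed.

Lemma critical w : ~~ lower w -> ~~ upper w ->
  w = bottom_word (dotted_letters w) \/
  (dotted_letters w < n)%N /\ w = open_word (dotted_letters w).
Proof.
rewrite /lower /upper => h1 h2.
have nb : ~~ beyond w by move: h1 h2; case: beyond => //=; case: supp.
have nsupp t : (lead w < t)%N -> (t < n)%N -> ~~ supp w t.
  move=> at_ tn; move: nb; rewrite /beyond (ltn_trans at_ tn) /=; apply: contra => st.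
  by apply/upP; exists t => //; rewrite at_.
have dE t : (t < n)%N -> dot w t = (t < lead w)%N.
  move=> tn; case: (ltngtP t (lead w)) => h; first exact: lead_dot.
    by apply/negbTE; apply: contra (nsupp _ h tn); apply: dot_supp.
  by apply/negbTE; rewrite h; apply: lead_undotted; rewrite -h.
have -> : dotted_letters w = lead w.
  rewrite -[RHS](card_ord_lt (lead_le w)); apply: eq_card => t.
  by rewrite !inE -dotE dE.
case: (boolP ((lead w < n)%N && supp w (lead w))) => [/andP[an sw]|ns]; [right; split=> //|left].
  apply: word_ext => t; case: (ltnP t n) => tn;
    try by rewrite /supp /dot !insubF //; apply/negbTE; rewrite -leqNgt.
    rewrite -[t]/(val (Ordinal tn)) [RHS]suppE ffunE /=; case: ltngtP => h //=.
    - by apply: dot_supp; apply: lead_dot.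
    - exact/negbTE/nsupp.
    - by rewrite h.
  rewrite dE // -[X in dot _ X]/(val (Ordinal tn)) dotE ffunE /=.
  by case: ltngtP.
apply: word_ext => t; case: (ltnP t n) => tn;
  try by rewrite /supp /dot !insubF //; apply/negbTE; rewrite -leqNgt.
  rewrite -[t]/(val (Ordinal tn)) [RHS]suppE ffunE /=; case: ltngtP => h //=.
  - by apply: dot_supp; apply: lead_dot.
  - exact/negbTE/nsupp.
  - by apply/negbTE; move: ns; rewrite -h tn.
rewrite dE // -[X in dot _ X]/(val (Ordinal tn)) dotE ffunE /=.
by case: ltngtP.
Qed.

End Homology.

Section Homology2.
Variables (k : comPzRingType) (q qi : k) (n : nat).
Implicit Types (w v : word n) (z D : nat).
Notation chain := {ffun word n -> k^o}.
Implicit Types (x y : chain).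
Notation diff := (@word_diff k qi n).
Notation T := (lin (@eps_part k n)).
Notation O := (lin (@open_part k n)).
Notation gamma := (@gamma k qi).

Lemma dotted_le_letters w : (dotted_letters w <= letters w)%N.
Proof. by rewrite card_undotted leq_addr. Qed.

Lemma linE (F : word n -> k^o) x : lin F x = \sum_w (x w : k) * (F w : k) :> k.
Proof. by []. Qed.

Lemma total_diff D x : graded D.+1 D x -> T (diff x) = gamma D * (O x : k) :> k.
Proof.
move=> gx; rewrite /word_diff lin_comp !linE mulr_sumr; apply: eq_bigr => w _.
case: (x w =P 0) => [->|xw]; first by rewrite !mul0r mulr0.
by have [lw dw] := gx _ xw; rewrite (lin_total_annular qi lw dw) mulrCA.
Qed.

Lemma open_diff D x : graded D.+2 D x -> O (diff x) = 0 :> k.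
Proof.
move=> gx; rewrite /word_diff lin_comp linE big1 // => w _.
case: (x w =P 0) => [->|xw]; first by rewrite !mul0r.
by have [lw dw] := gx _ xw; rewrite (lin_open_annular qi lw dw) mulr0.
Qed.

Lemma upper_undotted w : upper w -> (dotted_letters w < letters w)%N.
Proof.
case/andP=> /andP[an _] sa; rewrite card_undotted -addn1 leq_add2l card_gt0.
apply/set0Pn; exists (Ordinal an); rewrite undottedE -suppE sa.
exact: lead_undotted.
Qed.

(** The only undotted letter sits at the lead position, and another letter follows it. *)
Lemma upper_last w : upper w -> letters w = (dotted_letters w).+1 -> last_undotted w = false.
Proof.
case/andP=> /andP[an /upP[t /andP[at_ tn] st]] sa lw; apply/negbTE/negP.
rewrite /last_undotted; case e: (last_letter w) => [p|//] dp.
have [pn wp hp] := (low_Some _ _ _).1 e.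
have pa : (lead w < p)%N.
  case: (leqP t p) => tp; first exact: leq_trans at_ tp.
  by have /negP[] := hp t (introT andP (conj tp tn)).
have : (1 < #|undotted w|)%N.
  apply/card_gt1P; exists (Ordinal an), (Ordinal pn); split.
  - by rewrite undottedE -suppE sa lead_undotted.
  - by rewrite undottedE -suppE wp.
  - by rewrite -val_eqE /= (ltn_eqF pa).
have := card_undotted w; rewrite lw -addn1 => /addnI <-.
by rewrite ltnn.
Qed.

(** Hence correcting a chain by upper words does not change its value under [open_part]. *)
Lemma open_upper D y : graded D.+1 D y -> (forall w, y w <> 0 -> upper w) -> O y = 0 :> k.
Proof.
move=> gy uy; rewrite linE big1 // => w _; case: (y w =P 0) => [->|yw]; first exact: mul0r.
have [lw dw] := gy _ yw; rewrite /open_part upper_last ?uy ?lw ?dw //.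
by rewrite mulr0 mulr0.
Qed.

(** If all letters are dotted the word is not upper, so once lower words are gone only the critical
    word is left. *)
Lemma bottom_chain D x : graded D D x -> (forall u, lower u -> x u = 0) ->
  x = (x (bottom_word n D) : k) *: delta k (bottom_word n D).
Proof.
move=> gx lx; apply/ffunP=> w; rewrite !ffunE; case: (w =P _) => [->|nw].
  exact/esym/mulr1.
rewrite scaler0; case: (x w =P 0) => // xw; have [lw dw] := gx _ xw.
have nl : ~~ lower w by apply/negP => /lx.
have nu : ~~ upper w by apply/negP => /upper_undotted; rewrite lw dw ltnn.
case: (critical nl nu) => [h|[dn h]]; first by case: nw; rewrite h dw.
by move: lw; rewrite h letters_open // dw => /esym/n_Sn.
Qed.

Lemma graded_delta w z D (c : k) : letters w = z -> dotted_letters w = D ->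
  graded z D (c *: delta k w).
Proof.
move=> lw dw u; rewrite !ffunE; case: (u =P w) => [-> _ //|_ []]; exact: scaler0.
Qed.

Lemma lin_scale_delta (F : word n -> k^o) (c : k) w : lin F (c *: delta k w) = c * (F w : k) :> k.
Proof. by rewrite linZ lin_delta. Qed.

Lemma epsM w : eps k w * eps k w = 1.
Proof. exact: signM. Qed.

Lemma last_open D : (D < n)%N -> last_undotted (open_word n D).
Proof.
move=> Dn; rewrite /last_undotted.
have -> : last_letter (open_word n D) = Some D.
  apply/low_Some; split=> //; first by rewrite -[D]/(val (Ordinal Dn)) suppE ffunE /= ltnn eqxx.
  move=> t /andP[Dt tn]; rewrite -[t]/(val (Ordinal tn)) suppE ffunE /=.
  by case: ltngtP Dt.
by rewrite -[X in dot _ X]/(val (Ordinal Dn)) dotE ffunE /= ltnn eqxx.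
Qed.

(** Correct [open_word] by upper words until its boundary has no lower component. The boundary is
    then a multiple of the bottom word, and [total_diff] determines the multiple without any path
    counting. *)
Lemma connecting_chain D : (D < n)%N -> exists y,
  [/\ graded D.+1 D y, O y = eps k (open_word n D) :> k &
   diff y = (gamma D * eps k (open_word n D) * eps k (bottom_word n D)) *: delta k (bottom_word n D)].
Proof.
move=> Dn; set Q := open_word n D; set P := bottom_word n D.
have gQ : graded D.+1 D (delta k Q).
  by rewrite -[delta k Q]scale1r; apply: graded_delta; rewrite ?letters_open ?dotted_open.
have [y [gy uy hy]] := eliminate qi (graded_diff (qi := qi) gQ).
pose y' := delta k Q - y.
have gy' : graded D.+1 D y' := gradedB gQ gy.
have Oy' : O y' = eps k Q :> k.
  rewrite linB lin_delta (open_upper gy uy) subr0 /open_part last_open //; exact: mulr1.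
exists y'; split=> //.
have dy' : diff y' = (diff y' P : k) *: delta k P.
  apply: bottom_chain; first exact: graded_diff.
  by move=> u lu; rewrite /word_diff linB; apply: hy.
rewrite dy'; congr (_ *: _).
have := total_diff gy'; rewrite {1}dy' lin_scale_delta Oy' => <-.
by rewrite /eps_part -mulrA epsM mulr1.
Qed.

(** Together with [bottom_onto] this identifies the homology at [z = D < n] with [k / gamma D]. For
    the converse, elimination reduces [x] to a multiple of the bottom word, which the connecting
    chain bounds. *)
Theorem boundary_bottom D x : (D < n)%N -> graded D D x ->
  (exists2 y, graded D.+1 D y & x = diff y) <-> (exists u, T x = gamma D * u :> k).
Proof.
move=> Dn gx; split=> [[y gy ->]|[u hu]]; first by exists (O y); exact: total_diff.
have [y0 [gy0 _ hy0]] := eliminate qi gx.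
have [y1 [gy1 _ dy1]] := connecting_chain Dn.
set P := bottom_word n D in dy1; set Q := open_word n D in dy1.
have ex : x - diff y0 = ((x - diff y0) P : k) *: delta k P.
  by apply: bottom_chain hy0; apply: gradedB gx (graded_diff (qi := qi) gy0).
set c := (x - diff y0) P : k in ex.
have hc : c * eps k P = gamma D * (u - (O y0 : k)).
  rewrite -[LHS](lin_scale_delta (@eps_part k n)) -ex linB hu (total_diff gy0).
  by rewrite mulrBr.
exists (y0 + (eps k Q * (u - (O y0 : k))) *: y1).
  apply: gradedD gy0 _ => w h; apply: gy1 => e; apply: h.
  by rewrite ffunE e scaler0.
rewrite /word_diff linD linZ -/(diff y1) dy1 scalerA.
have -> : eps k Q * (u - (O y0 : k)) * (gamma D * eps k Q * eps k P) = c.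
  rewrite -[c]mulr1 -(epsM P) (mulrA c) hc -[RHS]mul1r -(epsM Q); ring.
by rewrite -ex addrC subrK.
Qed.

Lemma diff_bottom D x : graded D D x -> diff x = 0.
Proof.
move=> gx; apply/ffunP=> u; rewrite diffE ffunE big1 // => w _.
case: (x w =P 0) => [->|xw]; first exact: mul0r.
case: (annular_d qi w u =P 0) => [->|dw]; first exact: mulr0.
have [lw dw'] := gx _ xw; have [h1 h2] := annular_d_graded dw.
by have := dotted_le_letters u; rewrite h2 dw' -lw h1 ltnn.
Qed.

Lemma graded_gt z D x : (n < z)%N -> graded z D x -> x = 0.
Proof.
move=> nz gx; apply/ffunP=> w; rewrite ffunE; case: (x w =P 0) => // xw.
by have [lw _] := gx _ xw; have := max_card [set t : 'I_n | w t != None];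
  rewrite card_ord -/(letters w) lw leqNgt nz.
Qed.

Theorem bottom_onto D (c : k) : (D <= n)%N -> exists2 x, graded D D x & T x = c :> k.
Proof.
move=> Dn; exists ((c * eps k (bottom_word n D)) *: delta k (bottom_word n D)).
  by apply: graded_delta; rewrite ?letters_bottom ?dotted_bottom.
by rewrite lin_scale_delta /eps_part -mulrA epsM mulr1.
Qed.

Theorem open_cycle D x : graded D.+1 D x -> diff x = 0 -> gamma D * (O x : k) = 0.
Proof. by move=> gx dx; rewrite -total_diff // dx lin0. Qed.

(** With [open_cycle] and [open_onto] this identifies the homology at [z = D + 1] with the kernel of
    [gamma D]. After elimination, only upper words and the open word remain. *)
Theorem boundary_open D x : graded D.+1 D x -> diff x = 0 ->
  (exists2 y, graded D.+2 D y & x = diff y) <-> O x = 0 :> k.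
Proof.
move=> gx dx; split=> [[y gy ->]|Ox]; first exact: open_diff gy.
have [y [gy _ hy]] := eliminate qi gx; exists y => //.
set x' := x - diff y in hy; have gx' : graded D.+1 D x' := gradedB gx (graded_diff (qi := qi) gy).
apply/eqP; rewrite -subr_eq0 -/x'; apply/eqP.
have dx' : diff x' = 0.
  by rewrite /word_diff linB -/(diff x) -/(diff (diff y)) dx diff_diff subrr.
have Ox' : O x' = 0 :> k by rewrite linB Ox (open_diff gy) subrr.
have crit w : x' w <> 0 -> ~~ upper w -> (D < n)%N /\ w = open_word n D.
  move=> xw nu; have nl : ~~ lower w by apply/negP => /hy.
  have [lw dw] := gx' _ xw; case: (critical nl nu) => [h|[dn h]]; last by rewrite -dw.
  move: lw; rewrite h dw letters_bottom; first by move/n_Sn.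
  rewrite -dw -[X in (_ <= X)%N]card_ord; exact: max_card.
(* Upper words are invisible to [open_part], so its vanishing on [x'] kills the coefficient of the
   open word. *)
have xU w : x' w <> 0 -> upper w.
  move=> xw; apply/negPn/negP => nu; have [Dn eQ] := crit w xw nu.
  case: xw; rewrite eQ; move: Ox'; rewrite linE (bigD1 (open_word n D)) //= big1 => [|v vQ].
    rewrite /open_part last_open // mulr1 addr0 => h.
    by rewrite -[LHS]mulr1 -(epsM (open_word n D)) mulrA h mul0r.
  case: (x' v =P 0) => [->|xv]; first exact: mul0r.
  have [lv dv] := gx' _ xv; have uv : upper v.
    by apply/negPn/negP => nv; have [_ ev] := crit v xv nv; rewrite ev eqxx in vQ.
  by rewrite /open_part upper_last ?lv ?dv // mulr0 mulr0.
by apply: (upper_diff_inj (qi := qi) xU) => u _; rewrite dx' ffunE.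
Qed.

Theorem open_onto D (c : k) : (D < n)%N -> gamma D * c = 0 ->
  exists x, [/\ graded D.+1 D x, diff x = 0 & O x = c :> k].
Proof.
move=> Dn hc; have [y [gy Oy dy]] := connecting_chain Dn.
exists ((c * eps k (open_word n D)) *: y); split.
- by move=> w h; apply: gy => e; apply: h; rewrite ffunE e scaler0.
- rewrite /word_diff linZ -/(diff y) dy scalerA.
  rewrite [X in X *: _](_ : _ = gamma D * c * (eps k (open_word n D) * eps k (open_word n D) * eps k (bottom_word n D))); last by ring.
  by rewrite hc mul0r scale0r.
by rewrite linZ Oy -[RHS]mulr1 -(epsM (open_word n D)); exact/esym/mulrA.
Qed.

(** No critical word has [z] letters, so what elimination leaves of a cycle is an upper cycle, hence
    zero. *)
Theorem acyclic z D x : z <> D -> z <> D.+1 -> graded z D x -> diff x = 0 ->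
  exists2 y, graded z.+1 D y & x = diff y.
Proof.
move=> zD zD1 gx dx.
have [y [gy _ hy]] := eliminate qi gx; exists y => //.
set x' := x - diff y in hy; have gx' : graded z D x' := gradedB gx (graded_diff (qi := qi) gy).
apply/eqP; rewrite -subr_eq0 -/x'; apply/eqP.
have dx' : diff x' = 0.
  by rewrite /word_diff linB -/(diff x) -/(diff (diff y)) dx diff_diff subrr.
apply: (upper_diff_inj (qi := qi)) => [w xw|u _]; last by rewrite dx' ffunE.
apply/negPn/negP => nu; have nl : ~~ lower w by apply/negP => /hy.
have [lw dw] := gx' _ xw; case: (critical nl nu) => [h|[dn h]].
  apply: zD; rewrite -lw h dw letters_bottom //.
  by rewrite -dw -[X in (_ <= X)%N]card_ord; exact: max_card.
by apply: zD1; rewrite -lw h dw letters_open // -dw.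
Qed.

End Homology2.

(** * Linear maps that vanish on the quantum commutators *)

(** Platform points carry no dots; [x] and [y] are the bits of the labels 4 and 5, the bottom and
    top arcs of a non-vertical tangle. *)
Definition bits (x y : bool) : seq bool := [:: false; false; false; false; x; y].

Lemma basis_bits l (T : flat 2 l) (g : gen 2 l) : in_basis T g ->
  exists a b x y rest, g = mkgen T a b (bits x y) rest /\
     basisN (is_vertical T) a b (bits x y).
Proof.
move=> gT; have [a [b [B [rest [sB eg]]]]] := in_basisP gT.
move: gT; rewrite eg in_basis_mkgen => hB.
exists a, b, (nth false B 4), (nth false B 5), rest; suff <- : B = bits (nth false B 4) (nth false B 5) by [].
case/and4P: hB => _ _ _; move: sB; clear eg; do 6?[case: B => [|? B] //=].
case: B => // _; rewrite orbF !negb_or => /and4P[/negPf-> /negPf-> /negPf-> /negPf->] //.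
Qed.

Lemma deg_vertical2 a b B r :
  deg (vertical 2) (mkgen (vertical 2) a b B r) =
  - Posz (clockwise_piecesN true a b) - Posz (2 * dotsN true a b B).
Proof.
rewrite deg_mkgen /=; have rd p : rest_dots (vertical 2) p = 0%N.
  by apply/eqP; rewrite cards_eq0; apply/eqP/setP=> -[].
by rewrite !rd !addn0 sub0r.
Qed.

Lemma cup_eq (a b : cup) : a = b \/ a <> b.
Proof. by case: a b => -[]; do ?[by left|by right]. Qed.

Section Extension.
Variables (k : comPzRingType) (q qi : k) (l : nat) (T : flat 2 l).
Let V := is_vertical T.
Variables (M : lmodType k) (c : gen 2 l -> M).

Local Notation extend := (lin c).

Definition glue_left_sum a b d x0 y0 x y rest : M :=
  \sum_(B1 <- [seq B1 <- left_outcomes V a b d (bits x0 y0) (bits x y) | basisN V a d B1])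
     c (mkgen T a d B1 rest).

Definition glue_right_sum a b d x y x0 y0 rest : M :=
  \sum_(B1 <- [seq B1 <- right_outcomes V a b d (bits x0 y0) (bits x y) | basisN V a d B1])
     c (mkgen T a d B1 rest).

Lemma mu_coef_left_sum a b d x0 y0 x y r0 rest :
  \sum_h (mu_coef (vertical 2) T T (mkgen (vertical 2) a b (bits x0 y0) r0)
      (mkgen T b d (bits x y) rest) h)%:R *: c h = glue_left_sum a b d x0 y0 x y rest.
Proof.
under eq_bigr => h _ do rewrite mu_left // natr_sum scaler_suml.
rewrite exchange_big /= /glue_left_sum big_filter [RHS]big_mkcond.
apply: eq_bigr => B1 _; rewrite (bigD1 (mkgen T a d B1 rest)) //= big1 => [|h /negPf ->].
  by rewrite eqxx andbT in_basis_mkgen addr0 -/V; case: ifP; rewrite (scale1r, scale0r).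
by rewrite andbF scale0r.
Qed.

Lemma mu_coef_right_sum a b d x0 y0 x y r0 rest :
  \sum_h (mu_coef T (vertical 2) T (mkgen T a b (bits x y) rest)
      (mkgen (vertical 2) b d (bits x0 y0) r0) h)%:R *: c h
  = glue_right_sum a b d x y x0 y0 rest.
Proof.
under eq_bigr => h _ do rewrite mu_right // natr_sum scaler_suml.
rewrite exchange_big /= /glue_right_sum big_filter [RHS]big_mkcond.
apply: eq_bigr => B1 _; rewrite (bigD1 (mkgen T a d B1 rest)) //= big1 => [|h /negPf ->].
  by rewrite eqxx andbT in_basis_mkgen addr0 -/V; case: ifP; rewrite (scale1r, scale0r).
by rewrite andbF scale0r.
Qed.

Lemma lin_mu l1 l2 (T1 : flat 2 l1) (T2 : flat 2 l2) (a : mod_amb k 2 l1) (m : mod_amb k 2 l2) :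
  extend (mu T1 T2 T a m) =
  \sum_g \sum_g' ((a g : k) * (m g' : k)) *: \sum_h (mu_coef T1 T2 T g g' h)%:R *: c h.
Proof.
rewrite /lin; under eq_bigr => h _ do rewrite ffunE scaler_suml.
rewrite exchange_big; apply: eq_bigr => g _ /=.
under eq_bigr => h _ do rewrite scaler_suml.
rewrite exchange_big; apply: eq_bigr => g' _ /=; rewrite scaler_sumr.
by apply: eq_bigr => h _; rewrite scalerA; congr (_ *: _); rewrite -mulrA mulrC.
Qed.

Hypothesis off_diagonal : forall a b B rest, a <> b -> c (mkgen T a b B rest) = 0.
Hypothesis balanced : forall a b x0 y0 x y rest,
  basisN true a b (bits x0 y0) -> basisN V b a (bits x y) ->
  glue_left_sum a b a x0 y0 x y rest =
  qpow q qi (- Posz (clockwise_piecesN true a b) - Posz (2 * dotsN true a b (bits x0 y0)))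
  *: glue_right_sum b a b x y x0 y0 rest.

Lemma dia_inj : injective dia.
Proof.
move=> a b /(congr1 val) /= /ffunP h; have := h ord0; have := h ord_max; rewrite !ffunE.
by case: a b {h} => -[].
Qed.

(** By bilinearity it suffices to take basis elements. If only one of the two products can be
    nonzero it is off-diagonal and is killed; if both can, the hypothesis [balanced] applies. *)
Lemma lin_rel v : qHH0_rel q qi T v -> extend v = 0.
Proof.
have e0 : extend 0 = 0 := lin0 c.
elim=> [|c0 v0 w [a [m [d [aA ad mT ->]]]] _ IH] //.
rewrite lin_linear IH addr0 [X in _ *: X](_ : _ = 0) ?scaler0 //.
rewrite addrC -scaleNr lin_linear scaleNr addrC.
apply/eqP; rewrite subr_eq0 2!lin_mu exchange_big /= scaler_sumr.
apply/eqP; apply: eq_bigr => g' _; rewrite scaler_sumr; apply: eq_bigr => g _.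
case: (altP (a g =P 0)) => [->|ag]; first by rewrite mul0r mulr0 !scale0r scaler0.
case: (altP (m g' =P 0)) => [->|mg]; first by rewrite mul0r mulr0 !scale0r scaler0.
rewrite [m g' * _]mulrC scalerA [qpow _ _ _ * _]mulrC -(scalerA (a g * m g')); congr (_ *: _).
have := ad _ ag.
have [a1 [b1 [x0 [y0 [r0 [-> h1]]]]]] := basis_bits (aA _ ag).
have [b2 [a2 [x [y [rest [-> h2]]]]]] := basis_bits (mT _ mg).
rewrite deg_vertical2 => <-.
have mu0 l1 l2 (T1 : flat 2 l1) (T2 : flat 2 l2) (u : gen 2 l1) u' :
    gtop u <> gbot u' -> \sum_h (mu_coef T1 T2 T u u' h)%:R *: c h = 0.
  move=> h; rewrite big1 // => h' _; rewrite /mu_coef; case: eqP => // _ /=; by rewrite scale0r.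
have [eb|nb] := cup_eq b1 b2.
  rewrite -eb in h2 *.
  have [ea|na] := cup_eq a1 a2.
    rewrite -ea in h2 *.
    by rewrite mu_coef_left_sum mu_coef_right_sum; apply: balanced.
  rewrite mu_coef_left_sum mu0; last by move/dia_inj/esym.
  by rewrite scaler0 /glue_left_sum big1 // => B1 _; apply: off_diagonal.
rewrite mu0; last by move/dia_inj.
have [ea|na] := cup_eq a1 a2.
  rewrite -ea mu_coef_right_sum /glue_right_sum big1 ?scaler0 // => B1 _.
  by apply: off_diagonal => /esym.
by rewrite mu0 ?scaler0 //; move/dia_inj/esym.
Qed.

End Extension.

(** The products of an element of [A^2] from [a] to [b], with dot bit [e], and a generator of
    [F_CK(T)] from [b] to [a], with bits [x], [y]: here the one lying over [a], in [right_table] the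
    one over [b]. The empty list is zero. The last branch is meant for idempotents; its other pairs
    are excluded by [basisN]. *)
Definition left_table (V : bool) a b (e x y : bool) : seq (bool * bool) :=
  match a, b with
  | CC, CC => if e && x then [::] else [:: (e || x, if V then e || x else y)]
  | LR, CC => if x || V then [::] else [:: (false, false)]
  | CC, LR => [:: (true, V || y)]
  | _, _ => [:: (false, false)]
  end.

Definition right_table (V : bool) a b (e x y : bool) : seq (bool * bool) :=
  match a, b with
  | CC, CC => if e && y then [::] else [:: (if V then e || x else x, e || y)]
  | LR, CC => [:: (V || x, true)]
  | CC, LR => if y || V then [::] else [:: (false, false)]
  | _, _ => [:: (false, false)]
  end.

Lemma left_outcomes_table V a b x0 y0 x y :
  basisN true a b (bits x0 y0) -> basisN V b a (bits x y) ->
  [seq B1 <- left_outcomes V a b a (bits x0 y0) (bits x y) | basisN V a a B1]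
  = [seq bits d.1 d.2 | d <- left_table V a b x0 x y].
Proof.
suff h : if basisN true a b (bits x0 y0) then if basisN V b a (bits x y) then
    [seq B1 <- left_outcomes V a b a (bits x0 y0) (bits x y) | basisN V a a B1]
    == [seq bits d.1 d.2 | d <- left_table V a b x0 x y] else true else true.
  by move=> h1 h2; rewrite h1 h2 in h; exact/eqP.
by case: V; case: a b x0 y0 x y => -[] [] [] [] []; vm_compute.
Qed.

Lemma right_outcomes_table V a b x0 y0 x y :
  basisN true a b (bits x0 y0) -> basisN V b a (bits x y) ->
  [seq B1 <- right_outcomes V b a b (bits x0 y0) (bits x y) | basisN V b b B1]
  = [seq bits d.1 d.2 | d <- right_table V a b x0 x y].
Proof.
suff h : if basisN true a b (bits x0 y0) then if basisN V b a (bits x y) then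
    [seq B1 <- right_outcomes V b a b (bits x0 y0) (bits x y) | basisN V b b B1]
    == [seq bits d.1 d.2 | d <- right_table V a b x0 x y] else true else true.
  by move=> h1 h2; rewrite h1 h2 in h; exact/eqP.
by case: V; case: a b x0 y0 x y => -[] [] [] [] []; vm_compute.
Qed.

Lemma basisN_true a b x y : basisN true a b (bits x y) =
  match a, b with
  | CC, CC => x == y
  | LL, LL | RR, RR | LR, LR | CC, LR | LR, CC => ~~ x && ~~ y
  | _, _ => false end.
Proof. by case: a b x y => -[] [] []; vm_compute. Qed.

Lemma basisN_false a b x y : basisN false a b (bits x y) =
  match a, b with
  | CC, CC => true | CC, LR => ~~ y | LR, CC => ~~ x | LR, LR => ~~ x && ~~ y
  | _, _ => false end.
Proof. by case: a b x y => -[] [] []; vm_compute. Qed.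

Lemma degree_true a b x y : basisN true a b (bits x y) ->
  - Posz (clockwise_piecesN true a b) - Posz (2 * dotsN true a b (bits x y)) =
  match a, b with
  | CC, CC => if x then -2 else 0 | CC, LR | LR, CC => -1 | _, _ => 0 end.
Proof. by rewrite basisN_true; case: a b x y => -[] [] []. Qed.

Section Functionals.
Variables (k : comPzRingType) (q qi : k) (l : nat) (T : flat 2 l).
Let V := is_vertical T.

Definition bottom_dot (g : gen 2 l) : bool := inl (ord0, ord0) \in gdot g.
Definition top_dot (g : gen 2 l) : bool := inl (ord_max, ord0) \in gdot g.

(** In the annulus the bottom and top arcs form one circle, with dot [o]; it is attributed to the
    last turning slice. *)
Definition word_of (rest : nat -> bool) (o : bool) : word l :=
  [ffun r : 'I_l => if turning T r then Some (if inner T r then rest r else o) else None].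

Definition wordg (g : gen 2 l) : word l :=
  word_of (fun r => inl (inord r.+1, ord0) \in gdot g)
    [|| bottom_dot g, top_dot g | gbot g == dia LR].

(** The scalars forced by the commutators: a dot on the bottom arc moves to the top arc at cost
    [qi ^+ 2], dots on both give zero, and a pair of [LR] diagrams is [qi] times a dotted circle. *)
Definition weightg (g : gen 2 l) : k :=
  if gbot g == gtop g then
    if gbot g == dia CC then
      if bottom_dot g then (if top_dot g then 0 else qi ^+ 2) else 1
    else if gbot g == dia LR then qi else 0
  else 0.

Definition wordv (w : word l) : {ffun word l -> k^o} := [ffun u => (u == w)%:R].

Definition class (g : gen 2 l) : {ffun word l -> k^o} := weightg g *: wordv (wordg g).

Definition classV (g : gen 2 l) : VV k :=
  if (gbot g == gtop g) && (gdot g == set0) then phi_idem qi (gbot g) else 0.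

Lemma dia_eq a b : (dia a == dia b) = match a, b with
  | LL, LL | RR, RR | LR, LR | CC, CC => true | _, _ => false end.
Proof. by apply/eqP/idP => [/dia_inj ->|]; case: a b => -[]. Qed.

Lemma bottom_dot_mkgen a b x y rest :
  bottom_dot (mkgen T a b (bits x y) rest) = x.
Proof.
rewrite /bottom_dot /gdot inE; have := strand_label_bot T (inl ord0) => /= ->.
by rewrite /bot_label /dotted /=; case: is_vertical.
Qed.

Lemma top_dot_mkgen a b x y rest : ~~ V ->
  top_dot (mkgen T a b (bits x y) rest) = y.
Proof.
move=> nV; rewrite /top_dot /gdot inE; have := strand_label_top T (inl ord0) => /= ->.
by rewrite /top_label /dotted /= -/V (negPf nV).
Qed.

Lemma eq_word_of rest rest' o : (forall r, inner T r -> rest r = rest' r) ->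
  word_of rest o = word_of rest' o.
Proof.
move=> h; apply/ffunP=> r; rewrite !ffunE; case: ifP => // _.
by case: ifP => // /h ->.
Qed.

Lemma wordg_mkgen a b x y rest : ~~ V ->
  wordg (mkgen T a b (bits x y) rest) =
  word_of rest [|| x, y | match a with LR => true | _ => false end].
Proof.
move=> nV; rewrite /wordg bottom_dot_mkgen top_dot_mkgen // /gbot /= dia_eq.
apply: eq_word_of => r ir; have /andP[Er _] := ir.
pose r' := Ordinal (turning_lt Er).
have -> : inord r.+1 = lift ord0 r' :> 'I_l.+1.
  by apply: val_inj; rewrite /= inordK // ltnS (turning_lt Er).
by rewrite inE /dotted (@inner_point _ T r') // ltnNge leq_addr /= addKn.
Qed.

Lemma class_mkgen a b x y rest : ~~ V ->
  class (mkgen T a b (bits x y) rest) =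
  (match a, b with
   | CC, CC => if x then (if y then 0 else qi ^+ 2) else 1
   | LR, LR => qi | _, _ => 0 end) *: wordv (word_of rest [|| x, y | match a with LR => true | _ => false end]).
Proof.
move=> nV; rewrite /class wordg_mkgen // /weightg bottom_dot_mkgen top_dot_mkgen // /gbot /gtop /=.
by rewrite !dia_eq; case: a b => -[].
Qed.

Hypothesis hq : q * qi = 1.

(** The tables reduce the balance condition to finitely many cases in [a], [b] and the bits. *)
Lemma class_rel v : ~~ V -> qHH0_rel q qi T v -> lin class v = 0.
Proof.
move=> nV; apply: lin_rel => [a b B rest ab|a b x0 y0 x y rest].
  rewrite /class /weightg /gbot /gtop /= !dia_eq.
  by case: a b ab => -[] //= ; rewrite scale0r.
move=> b0 b1; rewrite degree_true //.
rewrite /glue_left_sum /glue_right_sum left_outcomes_table // right_outcomes_table //.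
move: b0 b1; rewrite -/V (negPf nV) basisN_true basisN_false !big_map.
case: a b => -[] //=; case: x0 => //=; case: y0 => //=; case: x => //=; case: y => //= _ _;
  rewrite ?big_cons ?big_nil ?class_mkgen //= ?addr0 ?scaler0 ?scale0r ?scaler0 //;
  by rewrite ?scale1r ?scalerA ?mulr1 ?expr0 ?mul1r ?scale1r.
Qed.

End Functionals.

Section Functionals2.
Variables (k : comPzRingType) (q qi : k) (l : nat) (T : flat 2 l).
Let V := is_vertical T.
Hypothesis hq : q * qi = 1.

Lemma deco_vertical x y rest : V ->
  (deco 6 (strand_label T) rest (bits x y) == set0) = ~~ x && ~~ y.
Proof.
move=> vV; have lt6 z : (strand_label T z < 6)%N.
  rewrite ltnNge; apply/negP => h.
  have [r er] : exists r, strand_label T z = (6 + r)%N by exists (strand_label T z - 6)%N; lia.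
  have /andP[Er _] := inner_label er; move: vV; rewrite /V /is_vertical.
  by have [t ->] := low_ex (turning_lt Er) Er.
apply/eqP/andP => [e|[/negPf-> /negPf->]]; last first.
  by apply/setP=> z; rewrite !inE /dotted lt6;
    case: (strand_label T z) => [|[|[|[|[|[|n]]]]]] //=; rewrite nth_nil.
have h v : (v < 6)%N -> nth false (bits x y) v = false.
  move=> v6; have [z ez] := strand_label_onto T v6; have /setP/(_ z) := e.
  by rewrite !inE /dotted ez v6.
by have := h 5%N isT; have := h 4%N isT => /= -> ->.
Qed.

Lemma classV_mkgen a b x y rest : V ->
  classV qi (mkgen T a b (bits x y) rest) =
  if [&& dia a == dia b, ~~ x & ~~ y] then phi_idem qi (dia a) else 0.
Proof. by move=> vV; rewrite /classV /gdot /= deco_vertical. Qed.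

Lemma classV_rel v : V -> qHH0_rel q qi T v -> lin (classV qi (l := l)) v = 0.
Proof.
move=> vV; apply: lin_rel => [a b B rest ab|a b x0 y0 x y rest].
  by rewrite /classV /gbot /gtop /=; case: eqP => // /dia_inj.
move=> b0 b1; rewrite degree_true //.
rewrite /glue_left_sum /glue_right_sum left_outcomes_table // right_outcomes_table //.
move: b0 b1; rewrite -/V vV !basisN_true !big_map.
under eq_bigr => d _ do rewrite classV_mkgen //.
under [in RHS]eq_bigr => d _ do rewrite classV_mkgen //.
rewrite !dia_eq; move: (phi_idem qi) => p.
case: a b => -[] //=; case: x0 => //=; case: y0 => //=; case: x => //=; case: y => //= _ _;
  by rewrite ?big_cons ?big_nil /= ?andbF ?addr0 ?scaler0 ?expr0 ?scale1r.
Qed.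

Lemma phi_lin (x : mod_amb k 2 l) : phi qi x = lin (classV qi (l := l)) x.
Proof.
rewrite /phi /lin [RHS](eq_bigr (fun g : gen 2 l => \sum_(a | g == (a, a, set0)) x g *: phi_idem qi a)).
  rewrite (exchange_big_dep predT) //=; apply: eq_bigr => a _.
  by rewrite (big_pred1 (a, a, set0)).
move=> [[a b] S] _; rewrite /classV /gbot /gtop /gdot /=.
case: (altP (a =P b)) => [<-|ab] /=; last first.
  rewrite scaler0 big1 // => a'; rewrite !xpair_eqE => /andP[/andP[/eqP e /eqP e'] _].
  by rewrite e e' eqxx in ab.
case: (altP (S =P set0)) => [->|nS].
  by rewrite (big_pred1 a) // => a'; rewrite !xpair_eqE eqxx andbT andbb eq_sym.
by rewrite scaler0 big1 // => a'; rewrite !xpair_eqE (negPf nS) andbF.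
Qed.

End Functionals2.

(** * The commutators leave nothing beyond the words *)

Section Span.
Variables (k : comPzRingType) (U : lmodType k) (G : U -> Prop).

Lemma span_mem v : G v -> Defs.span G v.
Proof. by move=> Gv; rewrite -[v]scale1r -[_ *: _]addr0; apply: Defs.span_add => //; apply: Defs.span_zero. Qed.

Lemma spanD x y : Defs.span G x -> Defs.span G y -> Defs.span G (x + y).
Proof.
by elim=> [|c v z Gv _ IH] hy; rewrite ?add0r // -addrA; apply: Defs.span_add => //; apply: IH.
Qed.

Lemma spanZ c x : Defs.span G x -> Defs.span G (c *: x).
Proof.
elim=> [|d v z Gv _ IH]; first by rewrite scaler0; apply: Defs.span_zero.
by rewrite scalerDr scalerA; apply: Defs.span_add.
Qed.

Lemma span_sum (X : finType) (P : pred X) (f : X -> U) :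
  (forall i, P i -> Defs.span G (f i)) -> Defs.span G (\sum_(i | P i) f i).
Proof. by move=> h; elim/big_ind: _ => //; [exact: Defs.span_zero|exact: spanD]. Qed.

End Span.

Lemma delta_sum (k : comPzRingType) (X : finType) (f : {ffun X -> k^o}) :
  f = \sum_x (f x : k) *: delta k x.
Proof.
apply/ffunP=> y; rewrite sum_ffunE (bigD1 y) //= big1 ?addr0 => [|x /negPf yx].
  by rewrite !ffunE eqxx [_ *: _]mulr1.
by rewrite !ffunE eq_sym yx [_ *: _]mulr0.
Qed.

Lemma sum_delta2 (k : comPzRingType) (X Y : finType) (U : lmodType k) (F : X -> Y -> U) u v :
  \sum_x \sum_y ((delta k u x : k) * (delta k v y : k)) *: F x y = F u v.
Proof.
rewrite (bigD1 u) //= [X in _ + X]big1 ?addr0 => [|x /negPf xu]; last first.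
  by rewrite big1 // => y _; rewrite ffunE xu mul0r scale0r.
rewrite (bigD1 v) //= [X in _ + X]big1 ?addr0 => [|y /negPf yv]; last first.
  by rewrite [delta k v y]ffunE yv mulr0 scale0r.
by rewrite !ffunE !eqxx mulr1 scale1r.
Qed.

Section Relations.
Variables (k : comPzRingType) (q qi : k) (l : nat) (T : flat 2 l).
Let V := is_vertical T.
Hypothesis hq : q * qi = 1.
Notation rel := (qHH0_rel q qi T).
Notation dl := (fun a b x y rest => delta k (mkgen T a b (bits x y) rest)).

Lemma lin_deltas (x : mod_amb k 2 l) : lin (@delta k (gen 2 l)) x = x.
Proof. by rewrite [RHS]delta_sum. Qed.

Lemma mu_delta l1 l2 (T1 : flat 2 l1) (T2 : flat 2 l2) u v :
  mu T1 T2 T (delta k u) (delta k v) = \sum_h (mu_coef T1 T2 T u v h)%:R *: delta k h.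
Proof.
rewrite -[LHS]lin_deltas lin_mu.
exact: (sum_delta2 (fun g g' => \sum_h (mu_coef T1 T2 T g g' h)%:R *: delta k h)).
Qed.

Lemma homogeneous_delta l1 (T1 : flat 2 l1) u : homogeneous T1 (deg T1 u) (delta k u).
Proof. by move=> g; rewrite ffunE; case: (g =P u) => [->//|_]; rewrite eqxx. Qed.

Lemma in_FCK_delta l1 (T1 : flat 2 l1) u : in_basis T1 u -> in_FCK T1 (delta k u).
Proof. by move=> h g; rewrite ffunE; case: (g =P u) => [->//|_]; rewrite eqxx. Qed.

Lemma commutator_delta u v : in_basis (vertical 2) u -> in_basis T v ->
  rel (mu (vertical 2) T T (delta k u) (delta k v)
   - qpow q qi (deg (vertical 2) u) *: mu T (vertical 2) T (delta k v) (delta k u)).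
Proof.
move=> hu hv; apply: span_mem; exists (delta k u), (delta k v), (deg (vertical 2) u).
by split=> //; [exact: in_FCK_delta|exact: homogeneous_delta|exact: in_FCK_delta].
Qed.

Lemma unit_table a b x y : basisN V a b (bits x y) ->
  [seq B1 <- left_outcomes V a a b (bits false false) (bits x y) | basisN V a b B1]
  = [:: bits x y].
Proof.
suff h W : if basisN W a b (bits x y) then
  [seq B1 <- left_outcomes W a a b (bits false false) (bits x y) | basisN W a b B1]
  == [:: bits x y] else true by move=> hb; have := h V; rewrite hb => /eqP.
by case: W; case: a b x y => -[] [] []; vm_compute.
Qed.

(** Take the commutator with the idempotent of [a], which fixes the generator on one side and kills
    it on the other. *)
Lemma rel_off_diagonal a b x y rest : a <> b -> basisN V a b (bits x y) -> rel (dl a b x y rest).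
Proof.
move=> ab hb.
set u := mkgen (vertical 2) a a (bits false false) xpred0.
have hu : in_basis (vertical 2) u.
  by rewrite in_basis_mkgen vertical_is_vertical basisN_true; case: a {ab hb u}.
have hv : in_basis T (mkgen T a b (bits x y) rest) by rewrite in_basis_mkgen.
have e0 : mu T (vertical 2) T (delta k (mkgen T a b (bits x y) rest)) (delta k u) = 0.
  rewrite mu_delta; apply: big1 => g _; rewrite /mu_coef.
  by case: eqP => [/dia_inj/esym //|_]; rewrite scale0r.
have := commutator_delta hu hv; rewrite e0 scaler0 subr0 mu_delta mu_coef_left_sum.
by rewrite /glue_left_sum unit_table // big_seq1.
Qed.

Lemma rel_diagonal a b x0 y0 x y rest :
  basisN true a b (bits x0 y0) -> basisN V b a (bits x y) ->
  rel (\sum_(d <- left_table V a b x0 x y) dl a a d.1 d.2 rest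
   - qpow q qi (match a, b with
        CC, CC => if x0 then -2 else 0 | CC, LR | LR, CC => -1 | _, _ => 0 end)
     *: \sum_(d <- right_table V a b x0 x y) dl b b d.1 d.2 rest).
Proof.
move=> h0 hb.
have := @commutator_delta (mkgen (vertical 2) a b (bits x0 y0) xpred0)
   (mkgen T b a (bits x y) rest).
rewrite !in_basis_mkgen vertical_is_vertical => /(_ h0 hb).
rewrite !mu_delta mu_coef_left_sum mu_coef_right_sum /glue_left_sum /glue_right_sum.
by rewrite left_outcomes_table // right_outcomes_table // deg_vertical2 degree_true // !big_map.
Qed.

Lemma rel_both_dotted rest : ~~ V -> rel (dl CC CC true true rest).
Proof.
move=> nV; have := @rel_diagonal CC CC true true false true rest.
rewrite (negPf nV) basisN_true basisN_false => /(_ isT isT).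
by rewrite /= big_seq1 big_nil scaler0 subr0.
Qed.

(** Commutator with the dotted element of [A^2], of degree -2: it dots the bottom arc from one side
    and the top arc from the other. *)
Lemma rel_bottom_dotted rest : ~~ V ->
  rel (dl CC CC true false rest - qi ^+ 2 *: dl CC CC false true rest).
Proof.
move=> nV; have := @rel_diagonal CC CC true true false false rest.
rewrite (negPf nV) basisN_true basisN_false => /(_ isT isT).
by rewrite /= !big_seq1.
Qed.

(** Commutator with the degree -1 element from [LR] to [CC]. *)
Lemma rel_LR rest : ~~ V ->
  rel (dl LR LR false false rest - qi *: dl CC CC false true rest).
Proof.
move=> nV; have := @rel_diagonal LR CC false false false false rest.
rewrite (negPf nV) basisN_true basisN_false => /(_ isT isT).
by rewrite /= !big_seq1.
Qed.

Lemma rel_vertical_dotted rest : V -> rel (dl CC CC true true rest).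
Proof.
move=> vV; have := @rel_diagonal CC LR false false false false rest.
rewrite vV !basisN_true => /(_ isT isT).
by rewrite /= !big_seq1 big_nil scaler0 subr0.
Qed.

Definition outer_dot (w : word l) : bool :=
  [exists r : 'I_l, [&& turning T r, ~~ inner T r & w r == Some true]].

(** The normal form: closed by [CC], with the dot of the circle through the seam, if any, on the top
    arc. *)
Definition word_gen (w : word l) : gen 2 l :=
  mkgen T CC CC (bits false (outer_dot w)) (dot w).

Lemma eq_mkgen a b B rest rest' : (forall r, inner T r -> rest r = rest' r) ->
  mkgen T a b B rest = mkgen T a b B rest'.
Proof.
move=> h; congr (_, _, _); apply/setP=> z; rewrite !inE /dotted; case: ltnP => // z6.
by apply: h; apply: (@inner_label _ T z); rewrite subnKC.
Qed.

Lemma last_turning : ~~ V -> exists r : 'I_l, turning T r && ~~ inner T r.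
Proof.
rewrite /V /is_vertical; case e: (low _ _) => [r|//] _; case/low_Some: e => rl Er h.
exists (Ordinal rl); rewrite /inner /= Er /=; apply/negP => /upP[t ht Et].
by have := h t ltac:(lia); rewrite Et.
Qed.

Lemma word_gen_word_of rest o : ~~ V ->
  word_gen (word_of T rest o) = mkgen T CC CC (bits false o) rest.
Proof.
move=> nV; rewrite /word_gen.
have -> : outer_dot (word_of T rest o) = o.
  have [r /andP[Er nr]] := last_turning nV.
  apply/existsP/idP => [[t /and3P[Et nt]]|ho].
    by rewrite ffunE Et (negPf nt); case: o.
  by exists r; rewrite Er nr ffunE Er (negPf nr) ho.
apply: eq_mkgen => r ir; have /andP[Er _] := ir.
rewrite /dot (insubT (fun t => t < l)%N (turning_lt Er)) ffunE /= Er ir.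
by case: (rest r).
Qed.

Lemma rel_normal_form g : ~~ V -> in_basis T g ->
  rel (delta k g - weightg qi g *: delta k (word_gen (wordg T g))).
Proof.
move=> nV gT; have [a [b [x [y [rest [eg hb]]]]]] := basis_bits gT.
rewrite eg wordg_mkgen // word_gen_word_of //.
rewrite /weightg bottom_dot_mkgen top_dot_mkgen // /gbot /gtop /= !dia_eq.
have [eab|nab] := cup_eq a b; last first.
  rewrite (_ : (match a, b with LL, LL | RR, RR | LR, LR | CC, CC => true | _, _ => false end) = false).
    by rewrite scale0r subr0; apply: rel_off_diagonal.
  by case: a b nab {hb eg} => -[].
rewrite -eab in hb *; move: hb; rewrite -/V (negPf nV) basisN_false.
set o := [|| x, y | _]; case ea: a.
- by [].
- case ex: x; case ey: y => // _.
  have -> : o = true by rewrite /o ea ex ey.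
  exact: rel_LR.
- by [].
have -> : o = x || y by rewrite /o ea orbF.
case: (x); case: (y) => _; cbv iota.
- by rewrite scale0r subr0; apply: rel_both_dotted.
- exact: rel_bottom_dotted.
- by rewrite scale1r subrr; apply: Defs.span_zero.
- by rewrite scale1r subrr; apply: Defs.span_zero.
Qed.

(** Modulo commutators, [x] equals the sum of its normal forms, which depends only on its image
    under [class]; with [class_rel] this computes [qHH_0]. *)
Lemma class_kernel x : ~~ V -> in_FCK T x -> lin (class qi T) x = 0 -> rel x.
Proof.
move=> nV xT x0.
have e : \sum_g (x g * weightg qi g) *: delta k (word_gen (wordg T g)) = 0 :> mod_amb k 2 l.
  transitivity (\sum_w (lin (class qi T) x w : k) *: delta k (word_gen w)); last first.
    by rewrite x0 big1 // => w _; rewrite ffunE scale0r.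
  rewrite [RHS](eq_bigr (fun w => \sum_g (if wordg T g == w then x g * weightg qi g else 0)
      *: delta k (word_gen w))); last first.
    move=> w _; rewrite /lin sum_ffunE scaler_suml; apply: eq_bigr => g _.
    rewrite !ffunE eq_sym; congr (_ *: _); rewrite /GRing.scale /=.
    by case: eqP => _; rewrite ?mulr1 ?mulr0.
  rewrite exchange_big /=; apply: eq_bigr => g _.
  rewrite (bigD1 (wordg T g)) //= eqxx big1 ?addr0 // => w /negPf h.
  by rewrite eq_sym h scale0r.
rewrite -[x]subr0 -[X in _ - X]e {1}[x]delta_sum -sumrB; apply: span_sum => g _.
rewrite -scalerA -scalerBr; case: (altP (x g =P 0)) => [->|xg].
  by rewrite scale0r; apply: Defs.span_zero.
by apply: spanZ; apply: rel_normal_form => //; apply: xT.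
Qed.

Lemma sum_dia (U : zmodType) (f : GM 2 -> U) :
  \sum_a f a = f (dia LL) + f (dia LR) + f (dia RR) + f (dia CC).
Proof.
rewrite (perm_big [:: dia LL; dia LR; dia RR; dia CC]) /=.
  by rewrite !big_cons big_nil addr0 !addrA.
apply: uniq_perm; rewrite ?index_enum_uniq //= ?inE ?dia_eq //.
move=> a; rewrite mem_index_enum; have [c ->] := diaP a.
by rewrite !inE !dia_eq; case: c.
Qed.

Lemma phi_dia (x : mod_amb k 2 l) : 
  [/\ phi qi x (false, false) = x (dia LL, dia LL, set0),
      phi qi x (true, true) = x (dia RR, dia RR, set0),
      phi qi x (true, false) = x (dia CC, dia CC, set0)
    & phi qi x (false, true) = x (dia LR, dia LR, set0) + qi * x (dia CC, dia CC, set0)].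
Proof.
rewrite /phi sum_dia /phi_idem /end_at /= !ffunE /= /coev1 /vv.
by split; rewrite ?ffunE /GRing.scale /= ?ffunE /= /GRing.scale /=; ring.
Qed.

(** All generators except the four idempotents are commutators, and [phi_dia] shows that [phi]
    determines the coefficients of the idempotents. *)
Lemma phi_kernel x : V -> in_FCK T x -> phi qi x = 0 -> rel x.
Proof.
move=> vV xT x0; have [h1 h2 h3 h4] := phi_dia x; move: h1 h2 h3 h4.
rewrite x0 !ffunE => h1 h2 h3 h4; rewrite -h3 mulr0 addr0 in h4.
rewrite [x]delta_sum; apply: span_sum => g _.
case: (altP (x g =P 0)) => [->|xg]; first by rewrite scale0r; apply: Defs.span_zero.
have [a [b [x1 [y1 [rest [eg hb]]]]]] := basis_bits (xT _ xg).
have [eab|nab] := cup_eq a b; last first.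
  by apply: spanZ; rewrite eg; apply: rel_off_diagonal.
rewrite -eab in hb eg; have eg0 : ~~ x1 -> ~~ y1 -> g = (dia a, dia a, set0).
  move=> nx ny; rewrite eg; congr (_, _, _); apply/eqP.
  by rewrite deco_vertical // nx.
move: hb; rewrite -/V vV basisN_true.
case: a {eab} eg eg0 => eg eg0 h.
- by case/andP: h => nx ny; case/eqP: xg; rewrite eg0.
- by case/andP: h => nx ny; case/eqP: xg; rewrite eg0.
- by case/andP: h => nx ny; case/eqP: xg; rewrite eg0.
case: x1 y1 eg eg0 h => -[] // eg eg0 _; last by case/eqP: xg; rewrite eg0.
by apply: spanZ; rewrite eg; apply: rel_vertical_dotted.
Qed.

End Relations.

(** * Merging saddles, and curve labels for the closures by [CC] and [LR] *)

Section MergeSaddle.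
Variables (P : finType) (e e' : rel P) (f f' : P -> nat) (p s : P).
Hypotheses (le : labelled e f) (le' : labelled e' f') (ps : f p != f s).
Definition touched x : bool := (f x == f p) || (f x == f s).
Hypothesis merge : forall x y, (f' x == f' y) = (f x == f y) || touched x && touched y.

Definition merge_set (S : {set P}) : {set P} :=
  [set x | if touched x then (p \in S) || (s \in S) else x \in S].

Lemma touched_f x y : f x = f y -> touched x = touched y.
Proof. by rewrite /touched => ->. Qed.

(** Under [merge] the two touched curves become one, so a merge has a single possible outcome and
    fails only on two dots. *)
Lemma merge_saddle S S' : is_decoration e S ->
  saddle e e' p s S S' = ~~ ((p \in S) && (s \in S)) && (S' == merge_set S).
Proof.
move=> /forallP dS; have tp : touched p by rewrite /touched eqxx.
have ts : touched s by rewrite /touched eqxx orbT.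
have dSE x y : f x = f y -> (x \in S) = (y \in S).
  by move=> fxy; have /forallP/(_ y) := dS x; rewrite le fxy eqxx => /eqP.
rewrite /saddle le (negPf ps).
have outE x : ~~ same_curve e p x && ~~ same_curve e s x = ~~ touched x.
  by rewrite !le negb_or ![f x == _]eq_sym.
apply/and3P/andP => [[/forallP dS' /forallP hout /eqP hps]|[nps /eqP ->]].
  have dE' x y : f' x = f' y -> (x \in S') = (y \in S').
    by move=> fxy; have /forallP/(_ y) := dS' x; rewrite le' fxy eqxx => /eqP.
  split; first by case: (p \in S) (s \in S) hps => -[] //; case: (p \in S').
  apply/eqP/setP=> x; rewrite inE; case: ifP => tx; last first.
    by have := hout x; rewrite outE tx => /eqP.
  have -> : (x \in S') = (p \in S') by apply: dE'; apply/eqP; rewrite merge tx tp orbT.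
  by case: (p \in S) (s \in S) (p \in S') hps => -[] [].
split.
- apply/forallP=> x; apply/forallP=> y; apply/implyP; rewrite le' merge !inE.
  case/orP => [/eqP h|/andP[-> ->] //].
  by rewrite (touched_f h) (dSE _ _ h).
- apply/forallP=> x; apply/implyP; rewrite outE => /negPf tx.
  by rewrite inE tx.
- by rewrite inE tp; case: (p \in S) (s \in S) nps => -[].
Qed.

Lemma merge_set_decoration S : is_decoration e S -> is_decoration e' (merge_set S).
Proof.
move=> /forallP dS.
apply/forallP=> x; apply/forallP=> y; apply/implyP; rewrite le' merge !inE.
case/orP => [/eqP h|/andP[-> ->] //].
rewrite (touched_f h); case: touched => //.
by have /forallP/(_ y) := dS x; rewrite le h eqxx.
Qed.

End MergeSaddle.

(** A slot is the last turning slice below a line, [None] being the bottom. Codes start at 2 because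
    0 and 1 are taken by the platform points. *)
Definition slot_code (u : option nat) : nat := if u is Some t then t.+3 else 2.

Lemma slot_code_inj : injective slot_code.
Proof. by move=> [t|] [t'|] //= [->]. Qed.

Section CurveLabels.
Variables (n : nat) (T : flat 2 n).
Hypothesis nV : ~~ is_vertical T.
Let E := turning T.

Lemma line_label_low m m' i i' : (m <= n)%N -> (m' <= n)%N -> (i < 2)%N -> (i' < 2)%N ->
  (line_label T m i == line_label T m' i') = (low E m == low E m').
Proof.
move=> mn mn' i2 i2'; apply/eqP/eqP => [/(line_label_inj mn mn' i2 i2')[]//|e].
have hm : (m < n.+1)%N by []. have hm' : (m' < n.+1)%N by [].
suff : same_curve (strand T) (inl (Ordinal hm, Ordinal i2)) (inl (Ordinal hm', Ordinal i2')).
  by rewrite strand_labelled => /eqP.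
apply: (same_curve_trans (y := inl (Ordinal hm, Ordinal i2'))); first exact: strand_turn.
exact: strand_low.
Qed.

Lemma line_label_ge m i : (3 < line_label T m i)%N.
Proof. by rewrite /line_label; case: (low _ _) => [?|]; case: ifP. Qed.

Lemma line_label_lt m i : (line_label T m i < 4)%N = false.
Proof. by apply/negbTE; rewrite -leqNgt; exact: line_label_ge. Qed.

Definition circle_label (x : pt 2 n) : nat :=
  match x with inl (m, _) => slot_code (low E m) | inr (_, m) => m end.

(** In the closure by [LR] the bottom arc, the top arc and the innermost platform points form one
    curve, labelled 0. *)
Definition open_label (x : pt 2 n) : nat :=
  match x with
  | inl (m, _) => if (low E m == None) || (low E m == low E n) then 0 else slot_code (low E m)
  | inr (_, m) => m end.

Lemma lab_CC v : lab (edges false CC CC) v = if (v < 4)%N then odd v : nat else v.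
Proof.
case: (ltnP v 6) => h; first by do 6?[case: v h => [|v] h //].
by rewrite (@lab_big 6) // ltnNge (leq_trans _ h).
Qed.

Lemma lab_LR v : lab (edges false LR LR) v =
  if (v == 1)%N || (v == 3)%N then 1%N else if (v < 6)%N then 5%N else v.
Proof.
case: (ltnP v 6) => h; first by do 6?[case: v h => [|v] h //].
rewrite (@lab_big 6) //; case: (altP (v =P 1%N)) h => [->|] //; case: (altP (v =P 3%N)) => [->|] //.
Qed.

Lemma odd_platform (s : bool) (m : 'I_2) : odd (2 * s + m) = m :> nat.
Proof. by rewrite oddD oddM /=; case: (I2P m) => ->. Qed.

Lemma platform_lt (s : bool) (m : 'I_2) : (2 * s + m < 4)%N.
Proof. by case: s; case: (I2P m) => ->. Qed.

Lemma slot_code_platform u (m : 'I_2) : (slot_code u == m) = false.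
Proof. by case: u => [t|]; case: (I2P m) => ->. Qed.

Lemma line_label_platform m i (m' : 'I_2) : (line_label T m i == m') = false.
Proof. by have := line_label_ge m i; case: (I2P m') => ->; case: line_label => [|[|]]. Qed.

Lemma circle_labelled : labelled (closed_diagram T (dia CC) (dia CC)) circle_label.
Proof.
move=> x y; rewrite closed_labelled /diagram_label (negbTE nV) !lab_CC.
case: x => [[m i]|[s m]]; case: y => [[m' i']|[s' m']] /=.
- by rewrite !line_label_lt line_label_low ?leq_ord // (inj_eq slot_code_inj).
- by rewrite line_label_lt platform_lt odd_platform line_label_platform slot_code_platform.
- by rewrite line_label_lt platform_lt odd_platform eq_sym line_label_platform eq_sym slot_code_platform.
- by rewrite !platform_lt !odd_platform.
Qed.

Lemma platform_lt6 (s : bool) (m : 'I_2) : (2 * s + m < 6)%N.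
Proof. by case: s; case: (I2P m) => ->. Qed.

Lemma low_top m : (m <= n)%N -> ~~ up E m n -> low E m = low E n.
Proof.
move=> mn /upP nu; case e: (low E m) => [t|].
  have [tm Et h] := (low_Some _ _ _).1 e; apply/esym/low_Some; split=> //.
    exact: leq_trans tm mn.
  move=> u /andP[tu un]; case: (ltnP u m) => um; first by apply: h; rewrite tu.
  by apply/negP => Eu; apply: nu; exists u; rewrite ?um.
apply/esym/low_None => u un; case: (ltnP u m) => um; first by move/low_None: e; apply.
by apply/negP => Eu; apply: nu; exists u; rewrite ?um.
Qed.

Lemma low_last m i : (m <= n)%N -> (i < 2)%N ->
  (line_label T m i < 6)%N = (low E m == None) || (low E m == low E n).
Proof.
move=> mn i2; have i0 : (0 < 2)%N by [].
rewrite -[None]/(low E 0) -!(line_label_low mn _ i2 i0) //.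
have -> : line_label T 0 0 = 4%N.
  by have := strand_label_bot T (inl ord0); rewrite /= /bot_label (negbTE nV).
have -> : line_label T n 0 = 5%N.
  by have := strand_label_top T (inl ord0); rewrite /= /top_label (negbTE nV).
rewrite /line_label -/E; case e: (low E m) => [t|]; case: ifP => // /negbT nu.
move: nV; rewrite /is_vertical -/E -(low_top mn nu) e.
by [].
Qed.

Lemma open_labelled : labelled (closed_diagram T (dia LR) (dia LR)) open_label.
Proof.
have lb m i : ((line_label T m i == 1) || (line_label T m i == 3))%N = false.
  by have := line_label_ge m i; case: line_label => [|[|[|[|]]]].
have lp (s : bool) (m : 'I_2) : ((2 * s + m == 1) || (2 * s + m == 3))%N = (m == ord_max).
  by case: s; case: (I2P m) => ->.
have l5 (m : 'I_n.+1) (i : 'I_2) : (low E m == None) || (low E m == low E n) = false ->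
    (line_label T m i == 5)%N = false /\ (line_label T m i == 1)%N = false.
  rewrite -(low_last (leq_ord m) (ltn_ord i)) => /negbT; rewrite -leqNgt => h.
  by rewrite !gtn_eqF //; apply: leq_trans h.
have s0 u : (slot_code u == 0)%N = false by case: u.
move=> x y; rewrite closed_labelled /diagram_label (negbTE nV) !lab_LR.
case: x => [[m i]|[s m]]; case: y => [[m' i']|[s' m']]; rewrite /= ?lb ?lp ?low_last ?leq_ord //.
- case: ifP => h; case: ifP => h' //=.
  + by rewrite eq_sym (l5 _ _ h').1 eq_sym s0.
  + by rewrite (l5 _ _ h).1 s0.
  + by rewrite line_label_low ?leq_ord // (inj_eq slot_code_inj).
- case: ifP => h; rewrite platform_lt6; first by case: (I2P m') => ->.
  by rewrite slot_code_platform; case: ifP => _; rewrite ?(l5 _ i h).1 ?(l5 _ i h).2.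
- case h: ((low E m' == None) || (low E m' == low E n)); rewrite platform_lt6; first by case: (I2P m) => ->.
  by rewrite eq_sym [RHS]eq_sym slot_code_platform; case: ifP => _; rewrite ?(l5 _ i' h).1 ?(l5 _ i' h).2.
- by rewrite !platform_lt6; case: (I2P m) (I2P m') => -> [] ->.
Qed.

End CurveLabels.

(** Here [eqv] glues the bottom slot [o] to the top slot [L]. Merging slot [R] into [P] commutes
    with this gluing, although the top slot may itself be [R]. *)
Lemma open_merge (X : eqType) (o u v L P R : X) :
  P != R -> R != o -> (P == o -> L != R) -> P != L ->
  let mg x := if x == R then P else x in
  let eqv L x y := [|| x == y | ((x == o) || (x == L)) && ((y == o) || (y == L))] in
  eqv (mg L) (mg u) (mg v) = eqv L u v || (eqv L u P || eqv L u R) && (eqv L v P || eqv L v R).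
Proof.
move=> /eqP PR /eqP Ro oL /eqP PL /=.
have {}oL : P = o -> L <> R by move=> h; apply/eqP/oL/eqP.
case: (L =P R) => LR; case: (u =P R) => uR; case: (v =P R) => vR; subst=> //=;
  rewrite ?eqxx ?orbT //=;
  repeat (case: eqP => ?; subst => //=); try congruence; try tauto.
Qed.

(** * The effect of a saddle on generators *)

Section Cells.
Variables (k : comPzRingType) (q qi : k) (n : nat) (T : flat 2 n).
Hypothesis hq : q * qi = 1.
Hypothesis nV : ~~ is_vertical T.

Definition letters_of (g : gen 2 n) : word n :=
  [ffun t : 'I_n => if turning T t then Some (inl (lift ord0 t, ord0) \in gdot g) else None].

(** A curve meeting a platform tolerates no dot, just as a dotted circle tolerates no second one.
    Hence an [LR] closure is treated as a cell with dotted bottom circle, and [scale_of] corrects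
    its weight through [q * qi ^+ 2 = qi]. *)
Definition cell_of (g : gen 2 n) : cell n :=
  (bottom_dot g || (gbot g == dia LR), letters_of g).

Definition scale_of (g : gen 2 n) : k := if gbot g == dia LR then q else 1.

Lemma supp_letters_of g : supp (letters_of g) =1 turning T.
Proof.
move=> t; case: (ltnP t n) => tn; last first.
  rewrite /supp insubF; last by apply/negbTE; rewrite -leqNgt.
  by apply/esym/negbTE; apply: contraL tn => /turning_lt; rewrite -ltnNge.
by rewrite -[t]/(val (Ordinal tn)) suppE ffunE; case: ifP.
Qed.

Lemma low_letters_of g m : low (supp (letters_of g)) m = low (turning T) m.
Proof. by apply: eq_low => t _; apply: supp_letters_of. Qed.

Lemma dot_letters_of g (t : 'I_n) : dot (letters_of g) t =
  turning T t && (inl (lift ord0 t, ord0) \in gdot g).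
Proof. by rewrite dotE ffunE; case: turning => //; case: (_ \in _). Qed.

Lemma letters_of_mkgen a b x y rest :
  letters_of (mkgen T a b (bits x y) rest) = word_of T rest y.
Proof.
apply/ffunP=> t; rewrite !ffunE; case: ifP => // Et; congr Some.
rewrite inE /dotted; case: (boolP (inner T t)) => it.
  by rewrite inner_point // ltnNge leq_addr /= addKn.
rewrite /= /line_label /= Et; move: it; rewrite /inner Et /= => /negPf ->.
by [].
Qed.

Lemma class_cell g : in_basis T g -> gbot g = gtop g ->
  class qi T g = scale_of g *: close qi (cell_of g).
Proof.
move=> gT hd; have [a [b [x [y [rest [eg hb]]]]]] := basis_bits gT.
have eab : a = b by apply: dia_inj; move: hd; rewrite eg.
move: hb; rewrite -eab (negPf nV) basisN_false.
have [L eL] : exists L, low (turning T) n = Some L.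
  by move: nV; rewrite /is_vertical; case: low => // L; exists L.
have [Ln EL nL] := (low_Some _ _ _).1 eL.
have lastL (w' : word n) : supp w' =1 turning T -> last_letter w' = Some L.
  by move=> h; rewrite -eL /last_letter; apply: eq_low => t _; apply: h.
have nextL o : add_dot (word_of T rest o) L = word_of T rest true.
  apply/ffunP=> t; rewrite !ffunE; case: eqP => [e|tL].
    rewrite e EL; case: ifP => // /andP[_ /upP[u /andP[Lu un] Eu]].
    by have /negP[] := nL u (introT andP (conj Lu un)).
  case: ifP => // Et; case: ifP => // /negP []; rewrite /inner Et /=.
  apply/upP; exists L => //; rewrite Ln andbT ltnNge leq_eqVlt negb_or; apply/andP; split.
    by apply/eqP => e; apply: tL.
  by apply/negP => Lt; have /negP[] := nL t (introT andP (conj Lt (ltn_ord t))).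
have dotL o : dot (word_of T rest o) L = o.
  rewrite -[L]/(val (Ordinal Ln)) dotE ffunE /= EL; case: ifP; last by case: o.
  case/andP=> _ /upP[u /andP[Lu un] Eu].
  by have /negP[] := nL u (introT andP (conj Lu un)).
have sl := supp_letters_of g.
rewrite eg class_mkgen // /scale_of /cell_of bottom_dot_mkgen /gbot /= dia_eq -eg.
rewrite /close /= (lastL _ sl) eg letters_of_mkgen dotL nextL -eab.
case: a {eg eab sl} => //=.
  case/andP=> /negPf-> /negPf-> /=; rewrite scalerA expr2 mulrA hq mul1r.
  by [].
move=> _; case: x => /=; last by rewrite orbF.
by case: y; rewrite ?scale0r ?scaler0 ?scale1r.
Qed.

End Cells.

Lemma platform_slot_code u (m : 'I_2) : (nat_of_ord m == slot_code u) = false.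
Proof. by rewrite eq_sym slot_code_platform. Qed.

Section OpenSlots.
Variables (n : nat) (T : flat 2 n).

(* The right platform counts as being below all slices. *)
Definition open_slot (x : pt 2 n) : option (option nat) :=
  match x with inl (m, _) => Some (low (turning T) m) | inr (_, m) => if m == ord0 then Some None else None end.

Lemma open_label_slot x y : (open_label T x == open_label T y) =
  match open_slot x, open_slot y with
  | Some u, Some v => (u == v) || ((u == None) || (u == low (turning T) n)) && ((v == None) || (v == low (turning T) n))
  | None, None => true
  | _, _ => false
  end.
Proof.
have s0 u : (slot_code u == 0)%N = false by case: u.
have s0' u : (0 == slot_code u)%N = false by case: u.
have s1 u : (slot_code u == 1)%N = false by case: u.
have s1' u : (1 == slot_code u)%N = false by case: u.
case: x => [[m i]|[s m]]; case: y => [[m' i']|[s' m']] /=.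
- case: ifP => h; case: ifP => h' /=; rewrite ?orbT ?orbF ?s0 ?s0' ?(inj_eq slot_code_inj) //.
  + by apply/esym/eqP => e; rewrite e h' in h.
  + by apply/esym/eqP => e; rewrite e h' in h.
- case: (I2P m') => -> /=; rewrite ?andbT; last by case: ifP.
  by case: ifP => h /=; [rewrite orbT|rewrite s0 orbF; case: (low (turning T) m) h].
- case: (I2P m) => -> /=; last by case: ifP.
  by case: ifP => h /=; [rewrite orbT|rewrite s0' orbF; case: (low (turning T) m') h].
- by case: (I2P m) => ->; case: (I2P m') => ->.
Qed.

End OpenSlots.

Section SmoothingChange.
Variables (n : nat) (T T' : flat 2 n) (r : 'I_n).
Hypothesis nV : ~~ is_vertical T.
Hypothesis Er : turning T r.
Hypothesis E' : forall t, turning T' t = (t != r) && turning T t.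
Let E := turning T.
Let P := low E r.
Let R := Some (r : nat).

Definition below : pt 2 n := inl (widen_ord (leqnSn n) r, ord0).
Definition above : pt 2 n := inl (lift ord0 r, ord_max).

Lemma low_changed m : low (turning T') m = if low E m == R then P else low E m.
Proof. exact: low_rem. Qed.

Lemma low_above : low E r.+1 = R.
Proof. by rewrite /= /E Er. Qed.

Lemma low_neq_above : P != R.
Proof. by apply/eqP => /low_Some[]; rewrite ltnn. Qed.

Lemma circle_below : circle_label T below = slot_code P.
Proof. by []. Qed.

Lemma circle_above : circle_label T above = slot_code R.
Proof. by rewrite -low_above. Qed.

Lemma slot_merge (X : eqType) (u v L A : X) : L != A ->
  ((if u == A then L else u) == (if v == A then L else v)) =
  (u == v) || ((u == L) || (u == A)) && ((v == L) || (v == A)).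
Proof.
move=> /eqP LA; case: (u =P A) => [->|uA]; case: (v =P A) => [->|vA];
  repeat (case: eqP => ?; subst => //=); congruence.
Qed.

Lemma circle_merge x y :
  (circle_label T' x == circle_label T' y) = (circle_label T x == circle_label T y) ||
  touched (circle_label T) below above x && touched (circle_label T) below above y.
Proof.
rewrite /touched circle_below circle_above; case: x => [[m i]|[s m]]; case: y => [[m' i']|[s' m']];
  rewrite /= ?low_changed -?[r.+3]/(slot_code R).
- rewrite !(inj_eq slot_code_inj); apply: slot_merge; exact: low_neq_above.
- by rewrite !slot_code_platform !platform_slot_code andbF.
- by rewrite !platform_slot_code.
- by rewrite !platform_slot_code /= orbF.
Qed.

Hypothesis nV' : ~~ is_vertical T'.

Let L := low E n.

Lemma low_below_last : P != L.
Proof.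
apply/eqP => e; have [u Lu] := low_ex (ltn_ord r) Er.
have [_ _ h] := (low_Some _ _ _).1 Lu.
have [ur _ _] : [/\ (u < r)%N, E u & forall t, (u < t < r)%N -> ~~ E t].
  by apply/low_Some; rewrite -/P e.
by have /negP[] := h r (introT andP (conj ur (ltn_ord r))).
Qed.

(** Otherwise [r] would be the only turning slice and [T'] would be vertical. *)
Lemma low_bottom_last : P == None -> L != R.
Proof.
move=> /eqP p0; apply/eqP => lr; move: nV'; rewrite /is_vertical low_changed -/L lr eqxx p0.
by [].
Qed.

Lemma open_slot_changed x : open_slot T' x =
  if open_slot T x is Some u then Some (if u == R then P else u) else None.
Proof. by case: x => [[m i]|[s m]] /=; [rewrite low_changed|case: ifP]. Qed.

Lemma open_slot_below : open_slot T below = Some P.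
Proof. by []. Qed.

Lemma open_slot_above : open_slot T above = Some R.
Proof. by rewrite -low_above. Qed.

Lemma open_label_merge x y :
  (open_label T' x == open_label T' y) = (open_label T x == open_label T y) ||
  touched (open_label T) below above x && touched (open_label T) below above y.
Proof.
rewrite /touched !open_label_slot !open_slot_changed open_slot_below open_slot_above low_changed.
case: (open_slot T x) => [u|]; case: (open_slot T y) => [v|] //; last by rewrite /= andbF.
have := @open_merge _ None u v L P R low_neq_above isT low_bottom_last low_below_last.
by [].
Qed.

End SmoothingChange.

Lemma decoration_label (X : finType) (e : rel X) f (S : {set X}) x y :
  labelled e f -> is_decoration e S -> f x = f y -> (x \in S) = (y \in S).
Proof. by move=> le /forallP dS fxy; have /forallP/(_ y) := dS x; rewrite le fxy eqxx => /eqP. Qed.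

Definition slot_dots n T (g : gen 2 n) (u : option nat) : bool :=
  slot_dot (bottom_dot g, letters_of T g) u.

Lemma line_dot n (T : flat 2 n) (g : gen 2 n) (f : pt 2 n -> nat) (m : 'I_n.+1) (i : 'I_2) :
  labelled (gcurves T g) f ->
  (forall (m m' : 'I_n.+1) (i i' : 'I_2), low (turning T) m = low (turning T) m' -> f (inl (m, i)) = f (inl (m', i'))) ->
  is_decoration (gcurves T g) (gdot g) ->
  (inl (m, i) \in gdot g) = slot_dots T g (low (turning T) m).
Proof.
move=> lf flow dg; case e: (low (turning T) m) => [t|] /=.
  have [tm Et _] := (low_Some _ _ _).1 e; have tn := turning_lt Et.
  rewrite /slot_dots /= -[t]/(val (Ordinal tn)) dot_letters_of Et /=.
  apply: (decoration_label lf dg); apply: flow.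
  by rewrite e /= /bump /= Et.
apply: (decoration_label lf dg); apply: flow.
by rewrite e.
Qed.

Definition smoothing n (T T' : flat 2 n) (r : 'I_n) (g h : gen 2 n) : bool :=
  [&& gbot h == gbot g, gtop h == gtop g, in_basis T' h
    & saddle (gcurves T g) (gcurves T' g) (below r) (above r) (gdot g) (gdot h)].

Section SmoothingSum.
Variables (k : comPzRingType) (q qi : k) (n : nat) (T T' : flat 2 n) (r : 'I_n).
Hypothesis hq : q * qi = 1.
Hypothesis nV : ~~ is_vertical T.
Hypothesis nV' : ~~ is_vertical T'.
Hypothesis Er : turning T r.
Hypothesis E' : forall t, turning T' t = (t != r) && turning T t.
Let E := turning T.
Let P := low E r.
Let R := Some (r : nat).
Variable g : gen 2 n.
Hypothesis gT : in_basis T g.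
Let S := gdot g.
Let w := letters_of T g.
Let b := bottom_dot g.

Definition merged (f : pt 2 n -> nat) : gen 2 n := (gbot g, gtop g, merge_set f (below r) (above r) (gdot g)).

Lemma smoothing_sum (f f' : pt 2 n -> nat) (U : lmodType k) (F : gen 2 n -> U) :
  labelled (gcurves T g) f -> labelled (gcurves T' g) f' -> f (below r) != f (above r) ->
  (forall x y, (f' x == f' y) = (f x == f y) || touched f (below r) (above r) x && touched f (below r) (above r) y) ->
  \sum_h (smoothing T T' r g h)%:R *: F h =
  (~~ ((below r \in S) && (above r \in S)) && in_basis T' (merged f))%:R *: F (merged f).
Proof.
move=> lf lf' ba hm; have /and4P[_ _ dg _] := gT.
rewrite (bigD1 (merged f)) //= [X in _ + X]big1 ?addr0 => [|h hh].
  rewrite /smoothing /merged /gbot /gtop /= !eqxx /= (merge_saddle lf lf' ba hm _ dg) /gdot /= eqxx andbT.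
  by rewrite andbC.
rewrite /smoothing (merge_saddle lf lf' ba hm _ dg).
case: eqP => e1; case: eqP => e2; rewrite ?andbF ?scale0r //=.
case: (gdot h =P _) => e3; rewrite ?andbF ?scale0r //=.
by case/eqP: hh; rewrite /merged -e1 -e2 -e3; case: h {e1 e2 e3} => [[]].
Qed.

(** After a merge, the only way to leave the basis is a dot on a curve that meets a platform. *)
Lemma merged_basis (f f' : pt 2 n -> nat) : weight (gbot g) = weight (gtop g) ->
  labelled (gcurves T g) f -> labelled (gcurves T' g) f' ->
  (forall x y, (f' x == f' y) = (f x == f y) || touched f (below r) (above r) x && touched f (below r) (above r) y) ->
  (forall s (m m' : 'I_2), m != m' -> f' (inr (s, m)) != f' (inr (s, m'))) ->
  in_basis T' (merged f) = [forall p, inr p \notin gdot (merged f)].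
Proof.
move=> wg lf lf' hm fp; have /and4P[_ _ dg _] := gT.
rewrite /in_basis /merged /gbot /gtop /= -/(gbot g) -/(gtop g) wg eqxx /=.
rewrite (_ : gcurves T' _ = gcurves T' g) //.
rewrite [is_decoration _ _](merge_set_decoration lf lf' hm dg) /= andbC.
case: (boolP (meets_platform_twice _)) => //; last by rewrite andbT.
case/existsP=> s /existsP[m /existsP[m' /andP[mm]]].
by rewrite lf' (negPf (fp s m m' mm)).
Qed.

Lemma previous_letters : previous w r = P.
Proof. exact: low_letters_of. Qed.

Lemma merged_letters (f : pt 2 n -> nat) :
  (forall t : 'I_n, E t -> t != r :> nat ->
     (inl (lift ord0 t, ord0) \in merge_set f (below r) (above r) S) =
     dot w t || (Some (t : nat) == P) && dot w r) ->
  letters_of T' (merged f) = remove_letter w r.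
Proof.
move=> h; apply/ffunP=> t; rewrite !ffunE E' previous_letters -/E -val_eqE /=.
case: eqP => //= /eqP tr; case: ifP => Et; last first.
  by case: eqP => // /esym /low_Some[_]; rewrite Et.
rewrite /merged /gdot /= h //; case: eqP => _ //=.
by rewrite orbF dot_letters_of -/E Et.
Qed.

Lemma smoothing_circle : gbot g = dia CC -> gtop g = dia CC ->
  \sum_h (smoothing T T' r g h)%:R *: class qi T' h =
  scale_of q g *: ((removable (cell_of T g) r)%:R *: close qi (remove (cell_of T g) r)).
Proof.
move=> e1 e2; have /and4P[_ _ dg /forallP pg] := gT.
have lf : labelled (gcurves T g) (circle_label T) by rewrite /gcurves e1 e2; exact: circle_labelled.
have lf' : labelled (gcurves T' g) (circle_label T') by rewrite /gcurves e1 e2; exact: circle_labelled.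
have hm := circle_merge Er E'.
have ld (m : 'I_n.+1) (i : 'I_2) : (inl (m, i) \in S) = slot_dots T g (low E m).
  by apply: (line_dot _ _ lf) => // m1 m2 _ _ /= ->.
have dP : (below r \in S) = slot_dots T g P by rewrite ld.
have dR : (above r \in S) = dot w r by rewrite ld (low_above Er).
rewrite (smoothing_sum _ lf lf' _ hm); last first.
  by rewrite (circle_above Er) (inj_eq slot_code_inj); exact: low_neq_above.
have ce : cell_of T g = (b, w) by rewrite /cell_of e1 dia_eq orbF.
have ntp p : touched (circle_label T) (below r) (above r) (inr p) = false.
  by case: p => s m; rewrite /touched (circle_above Er) !platform_slot_code.
have mb : in_basis T' (merged (circle_label T)).
  rewrite (merged_basis _ lf lf' hm) ?e1 ?e2 //; apply/forallP=> p.
  by rewrite /merged /gdot /= inE ntp; exact: pg.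
have gm : gbot (merged (circle_label T)) = dia CC by [].
have gtm : gtop (merged (circle_label T)) = dia CC by [].
rewrite mb andbT dP dR {1}/removable ce /= previous_letters -/(slot_dots T g P) andbC.
rewrite {1}/scale_of e1 dia_eq scale1r; congr (_ *: _).
rewrite (class_cell hq nV' mb) ?gm ?gtm // /scale_of gm dia_eq scale1r; congr close.
rewrite /cell_of gm dia_eq orbF /remove /= previous_letters; congr (_, _).
  rewrite /bottom_dot /merged /gdot /= inE /touched circle_below (circle_above Er).
  have -> : circle_label T (inl (ord0, ord0)) = slot_code None by [].
  rewrite !(inj_eq slot_code_inj) orbF eq_sym.
  rewrite -/E -/P dP dR; case: eqP => [e|_] /=; [by rewrite e|by rewrite orbF].
apply: merged_letters => t Et tr; rewrite inE /touched circle_below (circle_above Er) dP dR ld.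
have -> : circle_label T (inl (lift ord0 t, ord0)) = slot_code (Some (t : nat)).
  by rewrite /= /bump /= -/E Et.
have -> : low E (lift ord0 t) = Some (t : nat) by rewrite /= /bump /= Et.
rewrite !(inj_eq slot_code_inj) (_ : Some (t : nat) == R = false) ?orbF; last by apply/eqP=> -[] /eqP; rewrite (negPf tr).
case: eqP => [e|_] /=; last by rewrite orbF.
by have -> : P = Some (t : nat) by exact: esym e.
Qed.

(** Merging a dotted circle into the platform curve gives zero, as does merging it with a dotted
    bottom circle in the cell model. *)
Lemma smoothing_open : gbot g = dia LR -> gtop g = dia LR ->
  \sum_h (smoothing T T' r g h)%:R *: class qi T' h =
  scale_of q g *: ((removable (cell_of T g) r)%:R *: close qi (remove (cell_of T g) r)).
Proof.
move=> e1 e2; have /and4P[_ _ dg /forallP pg] := gT.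
have lf : labelled (gcurves T g) (open_label T) by rewrite /gcurves e1 e2; exact: open_labelled.
have lf' : labelled (gcurves T' g) (open_label T') by rewrite /gcurves e1 e2; exact: open_labelled.
have hm := open_label_merge Er E' nV'.
pose L := low E n.
have PL : P != L := low_below_last Er.
have PN : P == None -> L != R := low_bottom_last Er E' nV'.
have ld (m : 'I_n.+1) (i : 'I_2) : (inl (m, i) \in S) = slot_dots T g (low E m).
  by apply: (line_dot _ _ lf) => // m1 m2 _ _ /= ->.
have dP : (below r \in S) = slot_dots T g P by rewrite ld.
have dR : (above r \in S) = dot w r by rewrite ld (low_above Er).
(* The bottom and top arcs lie on the platform curve, so these slots are undotted. *)
have zero_dot u : (u == None) || (u == L) -> (exists2 m : 'I_n.+1, u = low E m & true) -> slot_dots T g u = false.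
  move=> hu [m em _]; rewrite em -(ld m ord0); rewrite em in hu.
  rewrite (decoration_label (y := inr (false, ord0)) lf dg); first exact/negbTE/pg.
  by rewrite /= hu.
have dN : slot_dots T g None = false by apply: zero_dot => //; exists ord0.
have dL : slot_dots T g L = false by apply: zero_dot; [rewrite eqxx orbT|exists ord_max].
have tP p : touched (open_label T) (below r) (above r) (inr p) = (p.2 == ord0) && ((P == None) || (L == R)).
  case: p => s m; rewrite /touched !open_label_slot open_slot_below (open_slot_above Er) /=.
  case: (m =P ord0) => // _; rewrite -/L -/E (negPf PL) orbF andTb /= ![None == _]eq_sym orbb.
  by rewrite [R == L]eq_sym.
have ce : cell_of T g = (true, w) by rewrite /cell_of e1 dia_eq orbT.
have mb : in_basis T' (merged (open_label T)) =
    ~~ (((P == None) || (L == R)) && (slot_dots T g P || dot w r)).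
  rewrite (merged_basis _ lf lf' hm) ?e1 ?e2 //.
  apply/forallP/idP => [/(_ (false, ord0))|h p].
    by rewrite /merged /gdot /= inE tP /= -/S dP dR; case: ifP => // _ /negPf->.
  rewrite /merged /gdot /= inE tP -/S dP dR; case: ifP => [/andP[_ h']|_]; last exact: pg.
  by rewrite h' in h.
rewrite (smoothing_sum _ lf lf' _ hm); last first.
  by rewrite open_label_slot open_slot_below (open_slot_above Er) -/L -/E (negPf (low_neq_above T r)) (negPf PL) /=
    orbF; apply/negP => /andP[/PN/negPf]; rewrite eq_sym => ->.
have gm : gbot (merged (open_label T)) = dia LR by [].
have gtm : gtop (merged (open_label T)) = dia LR by [].
have cm : in_basis T' (merged (open_label T)) ->
    class qi T' (merged (open_label T)) = q *: close qi (remove (true, w) r).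
  move=> mb1; rewrite (class_cell hq nV' mb1) ?gm ?gtm // /scale_of gm dia_eq.
  rewrite /cell_of gm dia_eq orbT /remove /=; congr (_ *: close _ (_, _)).
  rewrite mb in mb1.
  apply: merged_letters => t Et tr; rewrite inE dP dR ld.
  have et : low E (lift ord0 t) = Some (t : nat) by rewrite /= /bump /= Et.
  have tR : (Some (t : nat) == R) = false by apply/eqP=> -[] /eqP; rewrite (negPf tr).
  rewrite et /touched !open_label_slot open_slot_below (open_slot_above Er).
  rewrite /open_slot -/E et tR -/L (negPf PL) orbF /=.
  case: (Some (t : nat) =P P) => [e|_] /=; first by have -> : P = Some (t : nat) by exact: esym e.
  rewrite orbF; case: (Some (t : nat) =P L) => //= e.
  rewrite [R == L]eq_sym -e; case: ifP => // h.
  move: mb1; rewrite -e h /= => /negPf->.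
  by have := dL; rewrite -e => <-.
rewrite mb dP dR {1}/removable ce /= previous_letters {1}/scale_of e1 dia_eq.
case: (boolP (P == None)) => [/eqP pn|pn] /=.
  rewrite pn dN /= andbT; case: (boolP (dot w r)) => dr; first by rewrite !scale0r scaler0.
  by rewrite cm ?mb ?pn ?dN ?(negPf dr) ?andbF // !scale1r.
have -> : slot_dot (true, w) P = slot_dots T g P by case: (P) pn.
(* If [r] is the last turning slice, the top arc merges with the circle below. A dot there makes the
   left side zero by the platform rule and the right side zero because [close] meets a dotted last
   letter. *)
case: (boolP (L == R)) => [/eqP lr|lr] /=.
  have dr : dot w r = false by have := dL; rewrite lr.
  rewrite dr orbF andbF /=; case: (boolP (slot_dots T g P)) => dp; last first.
    by rewrite cm ?mb ?dr ?(negPf dp) ?andbF // !scale1r.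
  rewrite scale0r scale1r /close /= last_remove; last by rewrite -suppE supp_letters_of.
  have -> : last_letter w = Some (r : nat) by rewrite /last_letter low_letters_of.
  rewrite eqxx previous_letters; case ep: P pn => [t|//] _.
  rewrite dot_remove previous_letters ep eqxx dr andbF orbF.
  have [tr _ _] := (low_Some _ _ _).1 ep.
  rewrite (ltn_eqF tr) /= (_ : dot w t) ?scaler0 //.
  by have := dp; rewrite ep.
rewrite andbT andbC; case: (boolP (dot w r && _)) => h; first by rewrite !scale0r scaler0.
by rewrite cm ?mb ?(negPf pn) ?(negPf lr) // !scale1r.
Qed.

End SmoothingSum.

Lemma diagonal_basis n (T : flat 2 n) g : ~~ is_vertical T -> in_basis T g -> gbot g = gtop g ->
  (gbot g = dia CC /\ gtop g = dia CC) \/ (gbot g = dia LR /\ gtop g = dia LR).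
Proof.
move=> nV gT; have [a [b [x [y [rest [-> hb]]]]]] := basis_bits gT.
rewrite /gbot /gtop /= => /dia_inj eab; move: hb; rewrite -eab (negPf nV) basisN_false.
by case: a {eab} => //; [right|left].
Qed.

Definition empty_word n : word n := [ffun => None].

Section LastSmoothing.
Variables (k : comPzRingType) (q qi : k) (n : nat) (T T' : flat 2 n) (r : 'I_n).
Hypothesis nV : ~~ is_vertical T.
Hypothesis vV' : is_vertical T'.
Hypothesis Er : turning T r.
Hypothesis E' : forall t, turning T' t = (t != r) && turning T t.
Variable g : gen 2 n.
Hypothesis gT : in_basis T g.

Lemma only_turning t : turning T t -> t = r.
Proof.
move=> Et; move: vV'; rewrite /is_vertical => /eqP/low_None/(_ t (turning_lt Et)).
by rewrite E' Et andbT negbK => /eqP.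
Qed.

Lemma nothing_below : low (turning T) r = None.
Proof. by apply/low_None => t tr; apply/negP => /only_turning e; rewrite e ltnn in tr. Qed.

Lemma last_remaining : low (turning T) n = Some (r : nat).
Proof.
apply/low_Some; split => // t /andP[rt _]; apply/negP => /only_turning e.
by rewrite e ltnn in rt.
Qed.

Lemma remove_last_letter : remove_letter (letters_of T g) r = empty_word n.
Proof.
apply/ffunP=> t; rewrite !ffunE; case: eqP => // tr.
rewrite /previous low_letters_of nothing_below /=; case: ifP => // /only_turning e.
by case: tr; apply: val_inj.
Qed.

(** Under [classV] only undotted diagrams survive. A [CC] closure without dots merges into the
    idempotent of [CC], that is [coev1]. An [LR] closure splits, which creates a dot on a platform
    curve and gives zero. *)
Lemma smoothing_vertical : gbot g = gtop g ->
  \sum_h (smoothing T T' r g h)%:R *: classV qi h =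
  (scale_of q g * ((removable (cell_of T g) r)%:R
     * close qi (remove (cell_of T g) r) (empty_word n))) *: coev1 qi.
Proof.
move=> hd; have /and4P[_ _ dg /forallP pg] := gT.
pose h0 : gen 2 n := (gbot g, gtop g, set0).
have -> : \sum_h (smoothing T T' r g h)%:R *: classV qi h
     = (smoothing T T' r g h0)%:R *: phi_idem qi (gbot g).
  rewrite (bigD1 h0) //= [X in _ + X]big1 ?addr0 => [|h hh].
    by rewrite /classV /gdot /gbot /gtop /= -/(gbot g) -/(gtop g) hd !eqxx.
  rewrite /smoothing; case: eqP => e1; rewrite ?scale0r //; case: eqP => e2; rewrite ?scale0r //.
  rewrite /classV; case: (gdot h =P set0) => e3; rewrite ?andbF ?scaler0 //.
  by case/eqP: hh; rewrite /h0 -e1 -e2 -e3; case: h {e1 e2 e3} => [[]].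
have close0 b0 : close qi (b0, empty_word n) (empty_word n) = (~~ b0)%:R.
  case: b0; rewrite /close /=; last by rewrite ffunE eqxx.
  rewrite (_ : last_letter _ = None) ?ffunE //; apply/low_None => t tn.
  by rewrite -[t]/(val (Ordinal tn)) suppE ffunE.
have rm : remove (cell_of T g) r = ((cell_of T g).1 || dot (letters_of T g) r, empty_word n).
  by rewrite /remove remove_last_letter /cell_of /= /previous low_letters_of nothing_below.
rewrite rm close0.
case: (diagonal_basis nV gT hd) => -[e1 e2]; last first.
  have lf : labelled (gcurves T g) (open_label T) by rewrite /gcurves e1 e2; exact: open_labelled.
  rewrite /cell_of e1 dia_eq orbT /= !mulr0 scale0r.
  suff -> : smoothing T T' r g h0 = false by rewrite scale0r.
  apply/negbTE/negP => /and4P[_ _ _ /and3P[_ _]].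
  rewrite lf open_label_slot open_slot_below (open_slot_above Er) nothing_below last_remaining.
  by rewrite !eqxx /= ?orbT /gdot /= !inE addn1.
have lf : labelled (gcurves T g) (circle_label T) by rewrite /gcurves e1 e2; exact: circle_labelled.
have ld (m : 'I_n.+1) (i : 'I_2) : (inl (m, i) \in gdot g) = slot_dots T g (low (turning T) m).
  by apply: (line_dot _ _ lf) => // m1 m2 _ _ /= ->.
have dP : (below r \in gdot g) = bottom_dot g by rewrite ld nothing_below.
have dR : (above r \in gdot g) = dot (letters_of T g) r by rewrite ld (low_above Er).
have -> : phi_idem qi (gbot g) = coev1 qi by rewrite e1 /phi_idem /end_at !ffunE.
rewrite /cell_of e1 dia_eq orbF /scale_of e1 dia_eq mul1r.
rewrite /removable /= /previous low_letters_of nothing_below /=.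
have bh0 : in_basis T' h0.
  rewrite /h0 e1 e2; have := in_basis_mkgen T' CC CC (bits false false) xpred0.
  rewrite vV' basisN_true /mkgen (_ : deco _ _ _ _ = set0) => [->//|].
  by apply/eqP; rewrite deco_vertical.
rewrite /smoothing {1 2}/gbot {1 2}/gtop /= -/(gbot g) -/(gtop g) !eqxx bh0 /=.
suff -> : saddle (gcurves T g) (gcurves T' g) (below r) (above r) (gdot g) (gdot h0)
    = ~~ (bottom_dot g || dot (letters_of T g) r).
  by case: (bottom_dot g); case: (dot _ _); rewrite /= ?mulr0 ?mulr1.
rewrite /saddle lf circle_below (circle_above Er) nothing_below (inj_eq slot_code_inj) /=.
rewrite dP dR /gdot /= inE.
have -> : is_decoration (gcurves T' g) set0.
  by apply/forallP=> x; apply/forallP=> y; rewrite !inE eqxx implybT.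
have -> : [forall x, ~~ same_curve (gcurves T g) (below r) x && ~~ same_curve (gcurves T g) (above r) x
     ==> ((x \in set0) == (x \in g.2))].
  apply/forallP=> x; apply/implyP; rewrite !lf circle_below (circle_above Er) nothing_below inE.
  case: x => [[m i]|p] /=; last by rewrite (negPf (pg p)).
  case em: (low (turning T) m) => [t|]; last by rewrite eqxx.
  by case/low_Some: em => _ /only_turning -> _; rewrite eqxx andbF.
by case: (bottom_dot g); case: (dot _ _).
Qed.

End LastSmoothing.

(** * Comparison of the cube of resolutions with the word complex *)

Section ChainMap.
Variables (k : comPzRingType) (q qi : k) (n : nat).
Hypothesis hq : q * qi = 1.
Implicit Types (xi : vertex n) (r t : 'I_n).
Notation B := (sigma_neg n).
Notation res := (resolution (sigma_neg n)).

Lemma turning_resolution xi r : turning (res xi) r = ~~ xi r.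
Proof. by rewrite /turning -tnth_nth !tnth_mktuple; case: (xi r). Qed.

Lemma vertical_resolution xi : is_vertical (res xi) = [forall r, xi r].
Proof.
apply/eqP/forallP => [/low_None h r|h]; first by have := h r (ltn_ord r); rewrite turning_resolution negbK.
by apply/low_None => t tn; rewrite -[t]/(val (Ordinal tn)) turning_resolution negbK.
Qed.

Lemma nonvertical xi r : ~~ xi r -> ~~ is_vertical (res xi).
Proof. by move=> xr; rewrite vertical_resolution; apply/negP => /forallP/(_ r); rewrite (negPf xr). Qed.

Lemma turning_clear xi r (t : nat) : xi r ->
  turning (res xi) t = (t != r) && turning (res (clear xi r)) t.
Proof.
move=> xr; case: (ltnP t n) => tn; last first.
  by apply/idP/andP => [/turning_lt|[_ /turning_lt]]; rewrite ltnNge tn.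
rewrite -[t]/(val (Ordinal tn)) !turning_resolution ffunE negb_and negbK -val_eqE /=.
by case: eqP => //= e; rewrite (_ : Ordinal tn = r) ?xr //; apply: val_inj.
Qed.

Lemma saddle_coef_smoothing xi xi' r g h :
  saddle_coef B xi xi' r g h = smoothing (res xi) (res xi') r g h.
Proof.
rewrite /saddle_coef /smoothing; congr [&& _, _, _ & _].
have cb p : corner B r false p = (p == below r).
  case: p => [[m i]|p] //; rewrite /corner tnth_mktuple /= !addn0 /below.
  apply/andP/eqP => [[/eqP e1 /eqP e2]|[-> ->]] //.
  by congr (inl (_, _)); apply: val_inj.
have ca p : corner B r true p = (p == above r).
  case: p => [[m i]|p] //; rewrite /corner tnth_mktuple /= /above.
  apply/andP/eqP => [[/eqP e1 /eqP e2]|[-> ->]]; last by rewrite /= /bump /= add1n addn1.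
  by congr (inl (_, _)); apply: val_inj => //=; rewrite e1 /bump addn1.
apply/existsP/idP => [[p /existsP[s /and3P[]]]|hs].
  by rewrite cb ca => /eqP -> /eqP ->.
by exists (below r); apply/existsP; exists (above r); rewrite cb ca !eqxx.
Qed.

Definition removal xi (g : gen 2 n) r : {ffun word n -> k^o} :=
  (if gbot g == gtop g then scale_of q g else 0) *:
  ((removable (cell_of (res xi) g) r)%:R *: close qi (remove (cell_of (res xi) g) r)).

Definition crossed xi r : nat := #|[set t : 'I_n | (t < r)%N && xi t]|.

Lemma letters_None xi g r : (letters_of (res xi) g r == None) = xi r.
Proof. by rewrite ffunE turning_resolution; case: (xi r). Qed.

(** As [class] is a multiple of [close] applied to a cell, the annular differential can be computed
    before closing, one term for each letter. *)
Lemma annular_class xi g : ~~ is_vertical (res xi) -> in_basis (res xi) g ->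
  lin (annular_d qi (n := n)) (class qi (res xi) g) =
  \sum_(r | ~~ xi r) (-1) ^+ crossed xi r *: removal xi g r.
Proof.
move=> nV gT; case: (altP (gbot g =P gtop g)) => hd; last first.
  rewrite /class /weightg (negPf hd) scale0r lin0 big1 // => r _.
  by rewrite /removal (negPf hd) scale0r scaler0.
rewrite (class_cell hq nV gT hd) linZ -close_linear_d /linear_d lin_sum scaler_sumr.
apply: eq_big => r; first by rewrite letters_None.
move=> _; rewrite /linear_term linZ lin_delta /removal hd eqxx.
rewrite -(scalerA ((-1) ^+ _)) scaler_swap; congr (_ *: _); congr (_ ^+ _).
by apply: eq_card => t; rewrite !inE letters_None.
Qed.

Lemma off_diagonal_smoothing (T T' : flat 2 n) r g h : gbot g != gtop g -> smoothing T T' r g h -> gbot h != gtop h.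
Proof. by move=> hd /and4P[/eqP-> /eqP-> _ _]. Qed.

Lemma smoothing_class xi r g : xi r -> ~~ is_vertical (res xi) -> in_basis (res (clear xi r)) g ->
  \sum_h (saddle_coef B (clear xi r) xi r g h)%:R *: class qi (res xi) h = removal (clear xi r) g r.
Proof.
move=> xr nV gT; have cr : ~~ clear xi r r by rewrite ffunE eqxx.
under eq_bigr => h _ do rewrite saddle_coef_smoothing.
case: (altP (gbot g =P gtop g)) => hd; last first.
  rewrite /removal (negPf hd) scale0r; apply: big1 => h _.
  case sm: smoothing; rewrite ?scale0r // /class /weightg.
  by rewrite (negPf (off_diagonal_smoothing hd sm)) scale0r scaler0.
have nV0 := nonvertical cr.
have Er : turning (res (clear xi r)) r by rewrite turning_resolution.
have E' (t : nat) : turning (res xi) t = (t != r) && turning (res (clear xi r)) t by exact: turning_clear.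
rewrite /removal hd eqxx; case: (diagonal_basis nV0 gT hd) => -[e1 e2].
  exact: (smoothing_circle hq nV0 nV Er E' gT e1 e2).
exact: (smoothing_open hq nV0 nV Er E' gT e1 e2).
Qed.

Lemma smoothing_phi xi r g : xi r -> is_vertical (res xi) -> in_basis (res (clear xi r)) g ->
  \sum_h (saddle_coef B (clear xi r) xi r g h)%:R *: classV qi h =
  (removal (clear xi r) g r (empty_word n) : k) *: coev1 qi.
Proof.
move=> xr vV gT; have cr : ~~ clear xi r r by rewrite ffunE eqxx.
under eq_bigr => h _ do rewrite saddle_coef_smoothing.
case: (altP (gbot g =P gtop g)) => hd; last first.
  rewrite /removal (negPf hd) scale0r ffunE scale0r; apply: big1 => h _.
  case sm: smoothing; rewrite ?scale0r // /classV.
  by rewrite (negPf (off_diagonal_smoothing hd sm)) scaler0.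
have nV0 := nonvertical cr.
have Er : turning (res (clear xi r)) r by rewrite turning_resolution.
have E' (t : nat) : turning (res xi) t = (t != r) && turning (res (clear xi r)) t by exact: turning_clear.
by rewrite (smoothing_vertical q qi nV0 vV Er E' gT hd) /removal hd eqxx !ffunE.
Qed.

Lemma cube_exchange (U : nmodType) (G : vertex n -> 'I_n -> U) :
  \sum_(xi : vertex n) \sum_(r | ~~ xi r) G xi r = \sum_(xi : vertex n) \sum_(r | xi r) G (clear xi r) r.
Proof.
rewrite (exchange_big_dep predT) //= [RHS](exchange_big_dep predT) //=; apply: eq_bigr => r _.
pose fill (xi : vertex n) : vertex n := [ffun t => (t == r) || xi t].
rewrite (reindex_onto (fun xi : vertex n => clear xi r) fill) /=; last first.
  move=> xi xr; apply/ffunP=> t; rewrite !ffunE; case: eqP => // ->; exact/esym/negbTE.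
apply: eq_bigl => xi; rewrite ffunE eqxx /=; apply/eqP/idP => [<-|xr]; first by rewrite ffunE eqxx.
by apply/ffunP=> t; rewrite !ffunE; case: eqP => // ->.
Qed.

(** The all-vertical vertex is left out: its [qHH_0] is not spanned by words and is read by
    [phi]. *)
Definition word_part (x : cube k 2 n) : {ffun word n -> k^o} :=
  \sum_(xi | ~~ is_vertical (res xi)) lin (class qi (res xi)) (x xi).

Definition valid (x : cube k 2 n) : Prop := forall xi, in_FCK (res xi) (x xi).

Lemma lin_d_CK (U : lmodType k) (F : gen 2 n -> U) x xi :
  lin F (d_CK B x xi) = \sum_(r | xi r) \sum_g ((-1) ^+ crossed xi r * (x (clear xi r) g : k)) *:
     \sum_h (saddle_coef B (clear xi r) xi r g h)%:R *: F h.
Proof.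
rewrite /lin; under eq_bigr => h _ do rewrite !ffunE scaler_suml.
rewrite exchange_big; apply: eq_bigr => r _ /=.
under eq_bigr => h _ do rewrite mulr_sumr scaler_suml.
rewrite exchange_big; apply: eq_bigr => g _ /=; rewrite scaler_sumr.
apply: eq_bigr => h _; rewrite scalerA; congr (_ *: _).
by rewrite -mulrA; congr (_ * _); exact: mulrC.
Qed.

Lemma crossed_clear xi r : crossed (clear xi r) r = crossed xi r.
Proof.
apply: eq_card => t; rewrite !inE ffunE; case: (ltnP t r) => // tr.
by rewrite (_ : t != r) //; apply: contraTneq tr => ->; rewrite ltnn.
Qed.

Lemma word_diff_part x : valid x -> word_diff qi (word_part x) =
  \sum_(xi : vertex n) \sum_(r | xi r) \sum_g ((-1) ^+ crossed xi r * (x (clear xi r) g : k)) *: removal (clear xi r) g r.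
Proof.
move=> vx; rewrite /word_diff /word_part lin_sum.
under eq_bigr => xi nV do rewrite lin_comp.
pose G (xi : vertex n) r := \sum_g ((-1) ^+ crossed xi r * (x xi g : k)) *: removal xi g r.
transitivity (\sum_(xi : vertex n) \sum_(r | ~~ xi r) G xi r); last first.
  rewrite cube_exchange; apply: eq_bigr => xi _; apply: eq_bigr => r _.
  by rewrite /G crossed_clear.
rewrite [LHS]big_mkcond; apply: eq_bigr => xi _; case: ifP => [nV|]; last first.
  by rewrite vertical_resolution => /negbFE /forallP h; rewrite big1 // => r; rewrite h.
rewrite exchange_big; apply: eq_bigr => g _ /=.
case: (altP (x xi g =P 0)) => [->|xg].
  by rewrite scale0r big1 // => r _; rewrite mulr0 scale0r.
rewrite annular_class //; last exact: vx xg.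
rewrite scaler_sumr; apply: eq_bigr => r _.
by rewrite scalerA mulrC.
Qed.

Definition ones : vertex n := [ffun => true].

Lemma vertical_ones xi : is_vertical (res xi) = (xi == ones).
Proof.
rewrite vertical_resolution; apply/forallP/eqP => [h|-> r]; last by rewrite ffunE.
by apply/ffunP=> r; rewrite ffunE h.
Qed.

(** The saddles into the all-vertical vertex; their values are multiples of the empty word, which
    [phi_d] turns into multiples of [coev1]. *)
Definition last_term (x : cube k 2 n) : {ffun word n -> k^o} :=
  \sum_r \sum_g ((-1) ^+ crossed ones r * (x (clear ones r) g : k)) *: removal (clear ones r) g r.

Lemma word_part_d x : valid x ->
  word_diff qi (word_part x) = word_part (d_CK B x) + last_term x.
Proof.
move=> vx; rewrite word_diff_part // (bigD1 ones) //= addrC; congr (_ + _).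
  rewrite /word_part; apply: eq_big => xi; first by rewrite vertical_ones.
  move=> xo; rewrite lin_d_CK; apply: eq_bigr => r xr; apply: eq_bigr => g _.
  case: (altP (x (clear xi r) g =P 0)) => [->|xg]; first by rewrite mulr0 !scale0r.
  rewrite smoothing_class //; first by rewrite vertical_ones.
  exact: vx xg.
by apply: eq_bigl => r; rewrite ffunE.
Qed.

Lemma phi_d x : valid x -> phi qi (d_CK B x ones) = (last_term x (empty_word n) : k) *: coev1 qi.
Proof.
move=> vx; rewrite phi_lin lin_d_CK /last_term sum_ffunE scaler_suml.
apply: eq_big => r; rewrite ?ffunE // => _; rewrite sum_ffunE scaler_suml; apply: eq_bigr => g _.
case: (altP (x (clear ones r) g =P 0)) => [->|xg]; first by rewrite mulr0 !scale0r ffunE scale0r.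
rewrite smoothing_phi ?vertical_ones //; first by rewrite scalerA [in RHS]ffunE.
  by rewrite ffunE.
exact: vx xg.
Qed.

Lemma class_supp xi g w : class qi (res xi) g w != 0 -> forall r, (w r == None) = xi r.
Proof.
rewrite ffunE ffunE; case: (w =P _) => [-> _ r|_]; last by rewrite scaler0 eqxx.
by rewrite ffunE turning_resolution; case: (xi r).
Qed.

Definition gap_vertex (w : word n) : vertex n := [ffun r => w r == None].

Lemma class_other xi v w : xi != gap_vertex w -> lin (class qi (res xi)) v w = 0.
Proof.
move=> xw; rewrite /lin sum_ffunE big1 // => g _; rewrite ffunE.
case: (altP (class qi (res xi) g w =P 0)) => [->|h]; first exact: scaler0.
by case/eqP: xw; apply/ffunP=> r; rewrite ffunE (class_supp h).
Qed.

Lemma word_part_at x w : w != empty_word n ->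
  word_part x w = lin (class qi (res (gap_vertex w))) (x (gap_vertex w)) w.
Proof.
move=> we; rewrite /word_part sum_ffunE (bigD1 (gap_vertex w)) /=.
  by rewrite big1 ?addr0 // => xi /andP[_ h]; apply: class_other.
rewrite vertical_resolution; apply/negP => /forallP h; case/eqP: we.
by apply/ffunP=> r; have := h r; rewrite !ffunE => /eqP.
Qed.

Lemma word_part_empty x : word_part x (empty_word n) = 0.
Proof.
rewrite /word_part sum_ffunE big1 // => xi; rewrite vertical_ones => h; apply: class_other.
by apply: contra h => /eqP ->; apply/eqP/ffunP=> r; rewrite !ffunE eqxx.
Qed.

Lemma last_term_at x w : valid x -> w != empty_word n -> last_term x w = 0.
Proof.
move=> vx we; rewrite /last_term sum_ffunE big1 // => r _; rewrite sum_ffunE big1 // => g _.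
rewrite ffunE; case: (altP (x (clear ones r) g =P 0)) => [->|xg]; first by rewrite mulr0 scale0r.
suff -> : removal (clear ones r) g r w = 0 by exact: mulr0.
have vV : is_vertical (res ones) by rewrite vertical_ones.
have E' (t : nat) : turning (res ones) t = (t != r) && turning (res (clear ones r)) t by apply: turning_clear; rewrite ffunE.
rewrite /removal /remove !ffunE (remove_last_letter vV E').
case: (_ || _) => /=; last by rewrite /close /= ffunE (negPf we) !scaler0.
rewrite /close /= (_ : last_letter _ = None) ?ffunE ?scaler0 //; apply/low_None => t tn.
by rewrite -[t]/(val (Ordinal tn)) suppE ffunE.
Qed.

Lemma word_part_diff x w : valid x -> w != empty_word n ->
  word_part (d_CK B x) w = word_diff qi (word_part x) w.
Proof. by move=> vx we; rewrite word_part_d // ffunE last_term_at // addr0. Qed.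

Lemma phi_diff x : valid x ->
  phi qi (d_CK B x ones) = (word_diff qi (word_part x) (empty_word n) : k) *: coev1 qi.
Proof. by move=> vx; rewrite phi_d // word_part_d // ffunE word_part_empty add0r. Qed.

End ChainMap.

(** * Degrees of words and their normal forms *)

Section WordDegree.
Variables (l : nat) (T : flat 2 l).
Hypothesis nV : ~~ is_vertical T.

Lemma last_slice : exists2 L : 'I_l, turning T L & forall r : nat, inner T r = turning T r && (r != L).
Proof.
move: nV; rewrite /is_vertical; case e: (low _ _) => [L|//] _.
have [Ln EL h] := (low_Some _ _ _).1 e; exists (Ordinal Ln) => // r.
rewrite /inner; case Er: (turning T r) => //=; apply/upP/idP => [[t /andP[rt tl] Et]|rL].
  by apply/eqP => er; have /negP[] := h t ltac:(by rewrite -er rt).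
exists L => //; rewrite Ln andbT ltn_neqAle rL leqNgt; apply/negP => Lr.
by have /negP[] := h r (introT andP (conj Lr (turning_lt Er))).
Qed.

Lemma letters_word_of rest o : letters (word_of T rest o) = (rest_dots T predT).+1.
Proof.
have [L EL hi] := last_slice.
rewrite /letters (cardsD1 L) inE ffunE EL /= add1n; congr _.+1; apply: eq_card => r.
by rewrite !inE ffunE andbT hi andbC -val_eqE /=; case: turning.
Qed.

Lemma dotted_word_of rest o : dotted_letters (word_of T rest o) = (o + rest_dots T rest)%N.
Proof.
have [L EL hi] := last_slice.
rewrite /dotted_letters (cardsD1 L) inE ffunE EL hi EL eqxx /=; congr (_ + _)%N; first by case: o.
apply: eq_card => r; rewrite !inE ffunE hi -val_eqE /=; case: turning; rewrite ?andbF //=.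
by case: eqP => //= _; case: (rest r).
Qed.

(** A trivial circle counts 1, or -1 if dotted. For [LR] the two clockwise pieces lower the degree
    by 2, exactly as the dot of its word does. *)
Lemma word_degree g : in_basis T g -> gbot g = gtop g -> ~~ (bottom_dot g && top_dot g) ->
  deg T g = (letters (wordg T g))%:Z - (2 * dotted_letters (wordg T g))%:Z.
Proof.
move=> gT hd hb; have [a [b [x [y [rest [eg]]]]]] := basis_bits gT.
have eab : a = b by apply: dia_inj; move: hd; rewrite eg.
move: hb; rewrite eg bottom_dot_mkgen top_dot_mkgen // wordg_mkgen // letters_word_of dotted_word_of.
rewrite deg_mkgen nV (negPf nV) addn1 -eab basisN_false.
case: a {eab eg} => // hb h.
  case/andP: h => /negPf-> /negPf->.
  rewrite (_ : clockwise_piecesN _ _ _ = 2%N) // (_ : dotsN _ _ _ _ = 0%N) //=.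
  by rewrite add0n mulnDr PoszD opprD addrA.
rewrite (_ : clockwise_piecesN _ _ _ = 0%N) // subr0 orbF; congr (_ - Posz (2 * (_ + _))).
by case: x y hb h => [] [].
Qed.

Lemma word_of_letters w : supp w =1 turning T -> word_of T (dot w) (outer_dot T w) = w.
Proof.
move=> sw; have [L EL hi] := last_slice.
have hL : w L != None by rewrite -suppE sw.
apply/ffunP=> r; rewrite ffunE -sw suppE; case wr: (w r) => [o|] //=; congr Some.
have Er : turning T r by rewrite -sw suppE wr.
rewrite hi Er /=; case: eqP => [e|_] /=; last by rewrite dotE wr; case: (o).
have {}e : r = L by apply: val_inj.
apply/existsP/idP => [[t /and3P[Et]]|ho].
  by rewrite hi Et /= negbK => /eqP /val_inj ->; rewrite -e wr; case: (o).
by exists L; rewrite EL hi EL eqxx /= -e wr ho.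
Qed.

Lemma word_gen_basis w : in_basis T (word_gen T w).
Proof. by rewrite /word_gen in_basis_mkgen (negPf nV) basisN_false. Qed.

Lemma wordg_word_gen w : supp w =1 turning T -> wordg T (word_gen T w) = w.
Proof. by move=> sw; rewrite /word_gen wordg_mkgen //= orbF word_of_letters. Qed.

Lemma word_gen_degree w : supp w =1 turning T ->
  deg T (word_gen T w) = (letters w)%:Z - (2 * dotted_letters w)%:Z.
Proof.
move=> sw; rewrite word_degree ?wordg_word_gen //; first exact: word_gen_basis.
by rewrite /word_gen bottom_dot_mkgen.
Qed.

Lemma class_word_gen (k : comPzRingType) (qi : k) w : supp w =1 turning T ->
  class qi T (word_gen T w) = delta k w.
Proof.
by move=> sw; rewrite /word_gen class_mkgen //= orbF scale1r word_of_letters.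
Qed.

End WordDegree.

(** * Cycles and relations of the cube in terms of words *)

Section Relations2.
Variables (k : comPzRingType) (q qi : k) (n : nat).
Hypothesis hq : q * qi = 1.
Notation B := (sigma_neg n).
Notation res := (resolution (sigma_neg n)).
Implicit Types (x y : cube k 2 n).

Lemma phi0 l : phi qi (0 : mod_amb k 2 l) = 0.
Proof. by rewrite phi_lin lin0. Qed.

Lemma phiZD l c (x y : mod_amb k 2 l) : phi qi (c *: x + y) = c *: phi qi x + phi qi y.
Proof. by rewrite !phi_lin lin_linear. Qed.

Lemma phiB l (x y : mod_amb k 2 l) : phi qi (x - y) = phi qi x - phi qi y.
Proof. by rewrite !phi_lin linB. Qed.

Lemma word_partZD c x y : word_part qi (c *: x + y) = c *: word_part qi x + word_part qi y.
Proof.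
rewrite /word_part scaler_sumr -big_split; apply: eq_bigr => xi _.
by rewrite !ffunE lin_linear.
Qed.

Lemma word_partB x y : word_part qi (x - y) = word_part qi x - word_part qi y.
Proof. by rewrite addrC -scaleN1r word_partZD scaleN1r addrC. Qed.

Lemma cubeB x y xi : (x - y) xi = x xi - y xi.
Proof. by rewrite !ffunE. Qed.

Lemma in_relP x : valid x ->
  in_rel q qi B x <-> word_part qi x = 0 /\ phi qi (x (ones n)) = 0.
Proof.
move=> vx; split=> [rx|[w0 p0] xi].
  split; first by rewrite /word_part big1 // => xi nV; exact: (class_rel nV (rx xi)).
  by rewrite phi_lin; apply: (@classV_rel _ q _ _ (res (ones n))); rewrite ?vertical_ones //; apply: rx.
case: (boolP (is_vertical (res xi))) => hV.
  apply: phi_kernel => //; move: hV; rewrite vertical_ones => /eqP ->.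
  exact: p0.
apply: class_kernel => //; apply/ffunP=> w; rewrite ffunE.
case: (altP (xi =P gap_vertex w)) => [e|ne]; last exact: class_other.
case: (altP (w =P empty_word n)) => [we|we].
  move: hV; rewrite vertical_ones e we => /eqP[]; apply/ffunP=> r; by rewrite !ffunE.
by rewrite e -word_part_at // w0 ffunE.
Qed.

Lemma valid_d x : valid (d_CK B x).
Proof.
move=> xi h; rewrite !ffunE; apply: contraR => nb.
apply/eqP; rewrite big1 // => r _; rewrite [X in _ * X]big1 ?mulr0 // => g _.
by rewrite /saddle_coef (negPf nb) /= !andbF mul0r.
Qed.

Lemma validB x y : valid x -> valid y -> valid (x - y).
Proof.
move=> vx vy xi g; rewrite !ffunE; case: (altP (x xi g =P 0)) => [x0|/vx //].
by rewrite x0 sub0r oppr_eq0 => /vy.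
Qed.

Lemma in_rel_subP x y : valid x -> valid y -> in_rel q qi B (x - y) <->
  word_part qi x = word_part qi y /\ phi qi (x (ones n)) = phi qi (y (ones n)).
Proof.
move=> vx vy; have h := in_relP (validB vx vy).
rewrite word_partB cubeB phiB in h; split=> [/h[/eqP + /eqP]|[e1 e2]].
  by rewrite !subr_eq0 => /eqP ? /eqP.
by apply/h; rewrite e1 e2 !subrr.
Qed.

Lemma coev1_inj (c : k) : c *: coev1 qi = 0 -> c = 0.
Proof.
move=> /ffunP/(_ (true, false)); rewrite !ffunE /= /GRing.scale /= mulr0 addr0.
by rewrite mulr1.
Qed.

(** At the all-vertical vertex [phi] sees a multiple of [coev1], and [coev1_inj] recovers its
    coefficient, which is that of the empty word. *)
Lemma cycleP x : valid x -> in_rel q qi B (d_CK B x) <-> word_diff qi (word_part qi x) = 0.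
Proof.
move=> vx; have in_d := in_relP (@valid_d x); split=> [/in_d[w0 p0]|w0].
  apply/ffunP=> w; rewrite [RHS]ffunE; case: (altP (w =P empty_word n)) => [->|we].
    by apply: coev1_inj; rewrite -(phi_diff hq).
  by rewrite -(word_part_diff hq) // w0 ffunE.
apply/in_d; rewrite (phi_diff hq) // w0 ffunE scale0r; split=> //.
apply/ffunP=> w; case: (altP (w =P empty_word n)) => [->|we]; first by rewrite word_part_empty ffunE.
by rewrite (word_part_diff hq) // w0.
Qed.

Lemma in_C_valid i j x : in_C B i j x -> valid x.
Proof. by move=> cx xi g /cx[]. Qed.

Lemma n_minus_sigma : n_minus B = n.
Proof. by rewrite /n_minus (@eq_in_count _ _ predT) ?count_predT ?size_tuple // => c /mapP[r _ ->]. Qed.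

Lemma n_plus_sigma : n_plus B = 0%N.
Proof. by rewrite /n_plus (@eq_in_count _ _ pred0) ?count_pred0 // => c /mapP[r _ ->]. Qed.

Lemma height_letters (w : word n) : (height (gap_vertex w) + letters w)%N = n.
Proof.
rewrite -[RHS]card_ord -(cardC [pred r | w r == None]); congr (_ + _)%N; apply: eq_card => r.
  by rewrite !inE ffunE.
by rewrite !inE.
Qed.

Lemma turning_gap (w : word n) : supp w =1 turning (res (gap_vertex w)).
Proof.
move=> t; case: (ltnP t n) => tn; last by apply/idP/idP => [/supp_lt|/turning_lt]; rewrite ltnNge tn.
by rewrite -[t]/(val (Ordinal tn)) turning_resolution ffunE suppE.
Qed.

Lemma gap_nonvertical (w : word n) : w != empty_word n -> ~~ is_vertical (res (gap_vertex w)).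
Proof.
move=> we; rewrite vertical_resolution; apply: contra we => /forallP h.
by apply/eqP/ffunP=> r; have := h r; rewrite !ffunE => /eqP.
Qed.

Lemma word_part_graded i j x w : in_C B i j x -> word_part qi x w != 0 ->
  i = - (letters w)%:Z /\ j = - n%:Z - (2 * dotted_letters w)%:Z.
Proof.
move=> cx; case: (altP (w =P empty_word n)) => [->|we]; first by rewrite word_part_empty eqxx.
rewrite word_part_at //; have nV := gap_nonvertical we.
set xi := gap_vertex w => hs.
have [g hg] : exists g, (x xi g : k) *: class qi (res xi) g w != 0.
  case: (boolP [exists g, (x xi g : k) *: class qi (res xi) g w != 0]) => [/existsP//|].
  rewrite negb_exists => /forallP h; case/eqP: hs; rewrite /lin sum_ffunE big1 // => g _.
  by rewrite ffunE; apply/eqP; have := h g; rewrite negbK.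
have xg : x xi g != 0 by apply: contraNneq hg => ->; rewrite scale0r.
have cg : class qi (res xi) g w != 0 by apply: contraNneq hg => ->; rewrite scaler0.
have [gT hi hj] := cx _ _ xg.
have ww : w = wordg (res xi) g.
  by move: cg; rewrite !ffunE; case: (w =P _) => // _; rewrite scaler0 eqxx.
have wg : weightg qi g != 0.
  by move: cg; rewrite ffunE; apply: contraNneq => ->; rewrite scale0r.
have hd : gbot g = gtop g by move: wg; rewrite /weightg; case: (gbot g =P _) => //; rewrite eqxx.
have hb : ~~ (bottom_dot g && top_dot g).
  case: (diagonal_basis nV gT hd) => -[e1 e2].
    by move: wg; rewrite /weightg hd e2 !eqxx; case: bottom_dot; case: top_dot; rewrite ?eqxx.
  have /and4P[_ _ dg /forallP pg] := gT.
  rewrite negb_and; apply/orP; left; rewrite /bottom_dot.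
  have lf : labelled (gcurves (res xi) g) (open_label (res xi)) by rewrite /gcurves e1 e2; exact: open_labelled.
  by rewrite (decoration_label (y := inr (false, ord0)) lf dg).
have := word_degree nV gT hd hb; rewrite -ww => dg.
move: hi hj; rewrite dg n_minus_sigma n_plus_sigma.
have := height_letters w; rewrite -/xi.
set h := height xi; set lw := letters w; set dw := dotted_letters w.
clear => e hi hj; move: hi hj; rewrite -e PoszD => hi <-; split; first by lia.
by move: hi; lia.
Qed.

Lemma ones_height : height (ones n) = n.
Proof. by rewrite -[RHS]card_ord; apply: eq_card => r; rewrite !inE ffunE. Qed.

Lemma height_full xi : height xi = n -> xi = ones n.
Proof.
move=> h; apply/ffunP=> r; rewrite ffunE.
have /setP/(_ r) : [set r | xi r] = setT by apply/eqP; rewrite eqEcard subsetT cardsT card_ord -/(height xi) h leqnn.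
by rewrite !inE.
Qed.

(** A section of [word_part] on chains without empty word. *)
Definition cube_of (y : {ffun word n -> k^o}) : cube k 2 n :=
  [ffun xi => \sum_(w | gap_vertex w == xi) (y w : k) *: delta k (word_gen (res xi) w)].

Lemma gap_vertex_empty : gap_vertex (empty_word n) = ones n.
Proof. by apply/ffunP=> r; rewrite !ffunE. Qed.

Lemma gap_vertex_ones w : gap_vertex w = ones n -> w = empty_word n.
Proof. by move=> /ffunP h; apply/ffunP=> r; have := h r; rewrite !ffunE => /eqP. Qed.

Lemma word_part_cube_of (y : {ffun word n -> k^o}) : y (empty_word n) = 0 ->
  word_part qi (cube_of y) = y.
Proof.
move=> y0; apply/ffunP=> w; case: (altP (w =P empty_word n)) => [->|we].
  by rewrite word_part_empty y0.
rewrite word_part_at // /cube_of ffunE lin_sum sum_ffunE (bigD1 w) //= big1 ?addr0 => [|v /andP[/eqP ev vw]].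
  rewrite linZ lin_delta (class_word_gen (gap_nonvertical we)); last exact: turning_gap.
  by rewrite !ffunE eqxx; exact: mulr1.
have ve : v != empty_word n.
  by apply: contraNneq we => e; apply/eqP/gap_vertex_ones; rewrite -ev e gap_vertex_empty.
rewrite -ev linZ lin_delta (class_word_gen (gap_nonvertical ve)); last exact: turning_gap.
by rewrite !ffunE eq_sym (negPf vw); exact: mulr0.
Qed.

Lemma cube_of_in_C z D (y : {ffun word n -> k^o}) : graded z D y -> (0 < z)%N ->
  in_C B (- z%:Z) (- n%:Z - (2 * D)%:Z) (cube_of y).
Proof.
move=> gy z0 xi g; rewrite ffunE sum_ffunE => hs.
have [w /andP[/eqP ew]] : exists w, (gap_vertex w == xi) && (((y w : k) *: delta k (word_gen (res xi) w)) g != 0).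
  case: (boolP [exists w, (gap_vertex w == xi) && (((y w : k) *: delta k (word_gen (res xi) w)) g != 0)]) => [/existsP//|].
  rewrite negb_exists => /forallP h; case/eqP: hs; apply: big1 => w ew; apply/eqP.
  by have := h w; rewrite ew /= negbK.
rewrite !ffunE => hw; have yw : y w <> 0 by move=> e; case/eqP: hw; rewrite e scale0r.
have eg : g = word_gen (res xi) w.
  by move: hw; case: (g =P _) => // _; rewrite scaler0 eqxx.
have [lw dw] := gy _ yw.
have we : w != empty_word n.
  apply/eqP => e; move: z0; rewrite -lw e /letters (_ : [set _ | _] = set0) ?cards0 //.
  by apply/setP=> r; rewrite !inE ffunE.
rewrite eg -ew n_minus_sigma n_plus_sigma; have nV := gap_nonvertical we; split.
- exact: word_gen_basis.
- have -> : n%:Z = (height (gap_vertex w))%:Z + z%:Z by rewrite -PoszD -lw height_letters.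
  by rewrite addrC addrK.
- rewrite word_gen_degree //; last exact: turning_gap.
  by rewrite lw dw; clear; lia.
Qed.

End Relations2.

Lemma undotted_vertical l (T : flat 2 l) g : is_vertical T -> gbot g = gtop g -> gdot g = set0 ->
  in_basis T g /\ deg T g = 0.
Proof.
move=> vT hd h0; have [a ea] := diaP (gbot g).
have -> : g = mkgen T a a (bits false false) xpred0.
  rewrite [LHS](_ : g = (gbot g, gtop g, gdot g)); last by case: g {hd h0 ea} => [[]].
  rewrite -hd ea h0; congr (_, _, _); apply/esym/eqP; by rewrite deco_vertical.
rewrite in_basis_mkgen deg_mkgen vT basisN_true; split; first by case: a {ea}.
have r0 p : rest_dots T p = 0%N.
  apply/eqP; rewrite cards_eq0; apply/eqP/setP=> r; rewrite !inE /inner.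
  move: vT; rewrite /is_vertical => /eqP/low_None/(_ r (ltn_ord r)) => /negPf->.
  by [].
by rewrite !r0; case: a {ea}.
Qed.

(** * From the homology of words to isomorphisms of representations *)

Section Isomorphisms.
Variables (k : comPzRingType) (q qi : k) (n : nat).
Hypothesis hq : q * qi = 1.
Notation B := (sigma_neg n).
Notation res := (resolution (sigma_neg n)).
Implicit Types x : cube k 2 n.

Lemma phi_psi (v : VV k) : phi qi (psi qi n v) = v.
Proof.
have [h1 h2 h3 h4] := phi_dia qi (psi qi n v); apply/ffunP=> -[[] []].
- by rewrite h2 ffunE /gbot /gtop /gdot /= !eqxx /end_at /= !ffunE.
- by rewrite h3 ffunE /gbot /gtop /gdot /= !eqxx /end_at /= !ffunE.
- rewrite h4 !ffunE /gbot /gtop /gdot /= !eqxx /end_at /= !ffunE /=.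
  exact: subrK.
- by rewrite h1 ffunE /gbot /gtop /gdot /= !eqxx /end_at /= !ffunE.
Qed.

Lemma psi0 : psi qi n (0 : VV k) = 0.
Proof.
apply/ffunP=> g; rewrite !ffunE; case: ifP => // _.
by case: (end_at (gbot g) ord0) => [[]|]; case: (end_at (gbot g) ord_max) => [[]|]; rewrite /= ?ffunE ?mulr0 ?subr0.
Qed.

Lemma all_vertical xi : all (fun c => c == None) (res xi) = (xi == ones n).
Proof.
rewrite -vertical_ones vertical_resolution; apply/all_tnthP/forallP => h r; have := h r;
  by rewrite tnth_mktuple; rewrite ?tnth_mktuple; case: (xi r).
Qed.

Lemma actE X X0 x xi : act qi X X0 B x xi =
  if xi == ones n then psi qi n (X (phi qi (x xi))) else X0 n (x xi).
Proof. by rewrite ffunE all_vertical. Qed.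

Lemma word_part_act X X0 x : (forall l (v : mod_amb k 2 l), X0 l v = v) ->
  word_part qi (act qi X X0 B x) = word_part qi x.
Proof.
by move=> h; apply: eq_bigr => xi; rewrite vertical_ones => /negPf xo; rewrite actE xo h.
Qed.

Lemma word_part_ones x : (forall xi, xi != ones n -> x xi = 0) -> word_part qi x = 0.
Proof. by move=> h; rewrite /word_part big1 // => xi; rewrite vertical_ones => /h ->; exact: lin0. Qed.

Lemma in_C_height i j x xi : in_C B i j x -> x xi != 0 -> (height xi)%:Z = i + n%:Z.
Proof.
move=> cx xx; have [g xg] : exists g, x xi g != 0.
  case: (boolP [exists g, x xi g != 0]) => [/existsP//|].
  rewrite negb_exists => /forallP h; case/eqP: xx; apply/ffunP=> g; rewrite ffunE.
  by apply/eqP; have := h g; rewrite negbK.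
by have [_ -> _] := cx _ _ xg; rewrite n_minus_sigma.
Qed.

Section TrivialTarget.
Variables (i j : int) (F : word n -> k^o) (N0 D0 : k^o -> Prop).
Hypothesis D00 : D0 0.
Hypothesis phi_zero : forall x, in_C B i j x -> phi qi (x (ones n)) = 0.
Let f x := lin F (word_part qi x).
Hypothesis f_num : forall x, cycle_CK q qi B i j x -> N0 (f x).
Hypothesis f_den : forall x, cycle_CK q qi B i j x -> D0 (f x) <-> boundary_CK q qi B i j x.
Hypothesis f_onto : forall c, N0 c -> exists2 x, cycle_CK q qi B i j x & f x = c.

Lemma act_cycle X X0 x : X 0 = 0 -> cycle_CK q qi B i j x ->
  (forall l (v : mod_amb k 2 l), X0 l v = v) \/ (forall l (v : mod_amb k 2 l), X0 l v = 0) ->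
  cycle_CK q qi B i j (act qi X X0 B x).
Proof.
move=> X00 [cx dx] hX; have ca : in_C B i j (act qi X X0 B x).
  move=> xi g; rewrite actE; case: ifP => [/eqP ->|_].
    by rewrite phi_zero // X00 psi0 ffunE eqxx.
  by case: hX => ->; [exact: cx|rewrite ffunE eqxx].
split=> //; apply/(cycleP hq); first exact: in_C_valid ca.
case: hX => h; first by rewrite word_part_act //; apply/(cycleP hq) => //; exact: in_C_valid cx.
rewrite word_part_ones ?/word_diff ?lin0 // => xi xo.
by rewrite actE (negPf xo) h.
Qed.

(** Where [phi] vanishes on chains, the action is zero at the all-vertical vertex; elsewhere [E],
    [F] act by zero and [K] and its inverse by the identity. Any functional on words that computes
    the homology is therefore equivariant. *)
Lemma trivial_iso : Uq_iso (qAKh q qi B i j) (trivial_obj N0 D0).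
Proof.
exists f; split; [split|split] => /=.
- exact: f_num.
- by move=> c x y _ _; rewrite /f word_partZD lin_linear subrr.
- exact: f_den.
- by move=> c /f_onto[x cx <-]; exists x => //; rewrite subrr.
- move=> x cx; have X00 : VV_E q qi 0 = 0 :> VV k.
    by apply/ffunP=> u; rewrite !(tensE, ffunE) !mulr0 !addr0.
  split; first by apply: act_cycle => //; right.
  by rewrite /f word_part_ones ?lin0 ?subrr // => xi /negPf xo; rewrite actE xo.
- move=> x cx; have X00 : VV_F q qi 0 = 0 :> VV k.
    by apply/ffunP=> u; rewrite !(tensE, ffunE) !mulr0 !addr0.
  split; first by apply: act_cycle => //; right.
  by rewrite /f word_part_ones ?lin0 ?subrr // => xi /negPf xo; rewrite actE xo.
- move=> x cx; have X00 : VV_K q qi 0 = 0 :> VV k.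
    by apply/ffunP=> u; rewrite tensE !ffunE !mulr0 !addr0.
  split; first by apply: act_cycle => //; left.
  by rewrite /f word_part_act // subrr.
- move=> x cx; have X00 : VV_Ki q qi 0 = 0 :> VV k.
    by apply/ffunP=> u; rewrite tensE !ffunE !mulr0 !addr0.
  split; first by apply: act_cycle => //; left.
  by rewrite /f word_part_act // subrr.
Qed.

End TrivialTarget.

Lemma valid0 : valid (0 : cube k 2 n).
Proof. by move=> xi g; rewrite !ffunE eqxx. Qed.

Lemma zero_boundary i j x : in_C B i j x -> word_part qi x = 0 -> phi qi (x (ones n)) = 0 ->
  boundary_CK q qi B i j x.
Proof.
move=> cx w0 p0; exists 0; first by move=> xi g; rewrite !ffunE eqxx.
have d0 : d_CK B (0 : cube k 2 n) = 0.
  apply/ffunP=> xi; apply/ffunP=> h; rewrite !ffunE big1 // => r _.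
  by rewrite [X in _ * X]big1 ?mulr0 // => g _; rewrite !ffunE mulr0.
by rewrite d0 subr0; apply/(in_relP q qi) => //; exact: in_C_valid cx.
Qed.

Lemma zero_iso i j : (forall x, in_C B i j x -> phi qi (x (ones n)) = 0) ->
  (forall x, in_C B i j x -> word_part qi x = 0) -> Uq_iso (qAKh q qi B i j) (zero_obj k).
Proof.
move=> p0 w0; apply: (@trivial_iso _ _ (fun _ => 0)) => //.
- by move=> x [cx _]; rewrite w0 // lin0.
- by move=> x [cx _]; rewrite w0 // lin0; split=> // _; apply: zero_boundary; rewrite ?w0 ?p0.
- move=> c ->; exists 0; last by rewrite word_part_ones ?lin0 // => xi _; rewrite ffunE.
  split; first by move=> xi g; rewrite !ffunE eqxx.
  by apply/(cycleP hq); [exact: valid0|rewrite word_part_ones /word_diff ?lin0 // => xi _; rewrite ffunE].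
Qed.

Lemma phi_zero_height i j x : i <> 0 -> in_C B i j x -> x (ones n) = 0.
Proof.
move=> i0 cx; apply/eqP; apply: contra_notT i0 => /(in_C_height cx); rewrite ones_height.
by move=> e; apply: (@addIr _ n%:Z); rewrite add0r.
Qed.

Section Bidegree.
Variables (z D : nat).
Hypothesis z0 : (0 < z)%N.
Let i : int := - z%:Z.
Let j : int := - n%:Z - (2 * D)%:Z.

Lemma word_part_bidegree m x : in_C B (- m%:Z) j x -> graded m D (word_part qi x).
Proof.
move=> cx w /eqP /(word_part_graded cx)[/oppr_inj[<-]].
move=> /addrI/oppr_inj/eqP; rewrite /= eqz_nat eqn_pmul2l // => /eqP <-.
by [].
Qed.

Lemma graded_empty m (y : {ffun word n -> k^o}) : (0 < m)%N -> graded m D y -> y (empty_word n) = 0.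
Proof.
move=> m0 gy; case: (y (empty_word n) =P 0) => // /gy[lw _]; move: m0.
rewrite -lw /letters (_ : [set _ | _] = set0) ?cards0 //.
by apply/setP=> r; rewrite !inE ffunE.
Qed.

Lemma i_neq0 : i <> 0.
Proof. by move/eqP; rewrite oppr_eq0 eqz_nat; case: (z) z0. Qed.

Lemma phi_bidegree x : in_C B i j x -> phi qi (x (ones n)) = 0.
Proof. by move=> cx; rewrite (phi_zero_height i_neq0 cx) phi0. Qed.

Lemma below_i : i - 1 = - z.+1%:Z.
Proof. by rewrite /i -opprD -PoszD addn1. Qed.

(** Chains are read by [word_part] and lifted by [cube_of]. As [z > 0], the empty word occurs
    neither in [y] nor in its differential, so the all-vertical vertex does not interfere. *)
Lemma boundary_model x : in_C B i j x -> boundary_CK q qi B i j x <->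
  exists2 y, graded z.+1 D y & word_part qi x = word_diff qi y.
Proof.
move=> cx; have vx := in_C_valid cx; split=> [[y cy rel]|[y gy e]].
  rewrite below_i in cy; have gy := word_part_bidegree cy; exists (word_part qi y) => //.
  have vy := in_C_valid cy.
  have [-> _] := (in_rel_subP q qi vx (@valid_d _ _ y)).1 rel; apply/ffunP=> w.
  case: (altP (w =P empty_word n)) => [->|we]; last by rewrite (word_part_diff hq).
  by rewrite word_part_empty (graded_empty z0) //; apply: graded_diff.
have y0 : y (empty_word n) = 0 by apply: graded_empty gy.
have cy : in_C B (i - 1) j (cube_of y) by rewrite below_i; exact: cube_of_in_C.
exists (cube_of y) => //; have vy := in_C_valid cy.
apply/(in_rel_subP q qi vx (@valid_d _ _ _)).
have gd : graded z D (word_diff qi y) by apply: graded_diff.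
split; last first.
  by rewrite (phi_bidegree cx) (phi_diff hq) // word_part_cube_of // (graded_empty z0 gd) scale0r.
rewrite e; apply/ffunP=> w.
case: (altP (w =P empty_word n)) => [->|we]; first by rewrite word_part_empty (graded_empty z0 gd).
by rewrite (word_part_diff hq) // word_part_cube_of.
Qed.

Lemma model_iso (F : word n -> k^o) (N0 D0 : k^o -> Prop) : D0 0 ->
  (forall y : {ffun word n -> k^o}, graded z D y -> word_diff qi y = 0 -> N0 (lin F y)) ->
  (forall y : {ffun word n -> k^o}, graded z D y -> word_diff qi y = 0 ->
     (exists2 v, graded z.+1 D v & y = word_diff qi v) <-> D0 (lin F y)) ->
  (forall c, N0 c -> exists y, [/\ graded z D y, word_diff qi y = 0 & lin F y = c]) ->
  Uq_iso (qAKh q qi B i j) (trivial_obj N0 D0).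
Proof.
move=> D00 h1 h3 h4; have cyc x : cycle_CK q qi B i j x ->
    graded z D (word_part qi x) /\ word_diff qi (word_part qi x) = 0.
  by move=> [cx dx]; split; [exact: word_part_bidegree|apply/(cycleP hq) => //; exact: in_C_valid cx].
apply: (trivial_iso D00 (F := F)).
- exact: phi_bidegree.
- by move=> x /cyc[gx dx]; apply: h1.
- move=> x cx; have [gx dx] := cyc x cx; have [cx' _] := cx.
  by split=> [/h3 h|/boundary_model h]; [apply/boundary_model => //; apply: h|apply/h3 => //; apply: h].
- move=> c /h4[y [gy dy fy]]; have y0 := graded_empty z0 gy.
  exists (cube_of y); last by rewrite word_part_cube_of.
  have cy : in_C B i j (cube_of y) by exact: cube_of_in_C.
  by split=> //; apply/(cycleP hq); [exact: in_C_valid cy|rewrite word_part_cube_of].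
Qed.

Lemma model_zero : (forall y : {ffun word n -> k^o}, graded z D y -> word_diff qi y = 0 ->
     exists2 v, graded z.+1 D v & y = word_diff qi v) ->
  Uq_iso (qAKh q qi B i j) (zero_obj k).
Proof.
move=> h; apply: (model_iso (F := fun _ => 0)) => //.
- by move=> y _ _; rewrite /lin big1 // => w _; exact: mulr0.
- move=> y gy dy; split=> [_|_]; last exact: h.
  by rewrite /lin big1 // => w _; exact: mulr0.
- move=> c ->; exists 0; split; last by rewrite lin0.
    by move=> w; rewrite ffunE.
  by rewrite /word_diff lin0.
Qed.

End Bidegree.

End Isomorphisms.

(** * The individual bidegrees *)

Section Assembly.
Variables (k : comPzRingType) (q qi : k) (n : nat).
Hypothesis hq : q * qi = 1.
Hypothesis n0 : (0 < n)%N.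
Notation B := (sigma_neg n).
Notation res := (resolution (sigma_neg n)).
Implicit Types x : cube k 2 n.

Lemma in_C_ones j x xi : in_C B 0 j x -> x xi != 0 -> xi = ones n.
Proof. by move=> cx /(in_C_height cx); rewrite add0r => -[] /height_full. Qed.

(** [phi] only sees idempotents, and these have degree 0 in [F_CK]. *)
Lemma phi_zero_degree j x : j != - n%:Z -> in_C B 0 j x -> phi qi (x (ones n)) = 0.
Proof.
move=> jn cx; rewrite phi_lin /lin big1 // => g _.
case: (altP (x (ones n) g =P 0)) => [->|xg]; first by rewrite scale0r.
rewrite /classV; case: (gbot g =P gtop g) => hd; last by rewrite scaler0.
case: (gdot g =P set0) => h0; last by rewrite scaler0.
have [_ _ hj] := cx _ _ xg; case/eqP: jn; rewrite -hj n_minus_sigma n_plus_sigma.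
have vo : is_vertical (res (ones n)) by rewrite vertical_ones.
by have [_ ->] := undotted_vertical vo hd h0; rewrite !add0r.
Qed.

Lemma word_part_height0 j x : in_C B 0 j x -> word_part qi x = 0.
Proof.
move=> cx; apply: word_part_ones => xi xo; apply/eqP; apply: contraNT xo => h.
by apply/eqP; exact: in_C_ones cx h.
Qed.

Definition vertical_cube (v : VV k) : cube k 2 n :=
  [ffun xi => if xi == ones n then psi qi n v else 0].

Lemma vertical_cube_in_C v : in_C B 0 (- n%:Z) (vertical_cube v).
Proof.
move=> xi g; rewrite ffunE; case: (xi =P ones n) => [->|_]; last by rewrite ffunE eqxx.
rewrite ffunE; case: andP => [[/eqP hd /eqP h0] _|_]; last by rewrite eqxx.
have vo : is_vertical (res (ones n)) by rewrite vertical_ones.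
have [gT ->] := undotted_vertical vo hd h0.
by rewrite n_minus_sigma n_plus_sigma ones_height !add0r.
Qed.

Lemma height0_cycle j x : in_C B 0 j x -> cycle_CK q qi B 0 j x.
Proof.
move=> cx; split=> //; apply/(cycleP hq); first exact: in_C_valid cx.
by rewrite (word_part_height0 cx) /word_diff lin0.
Qed.

Lemma act_vertical X X0 x : (forall l, X0 l 0 = 0) -> in_C B 0 (- n%:Z) x ->
  act qi X X0 B x = vertical_cube (X (phi qi (x (ones n)))).
Proof.
move=> h cx; apply/ffunP=> xi; rewrite actE ffunE; case: eqP => [->//|/eqP xo].
rewrite (_ : x xi = 0) ?h //; apply/eqP; apply: contraNT xo => hx.
by apply/eqP; exact: in_C_ones cx hx.
Qed.

(** Since [gamma 0] is 1, every chain with [z = D = 0] is a boundary. *)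
Lemma coev1_boundary (c : k) : exists2 y : {ffun word n -> k^o},
  graded 1 0 y & word_diff qi y = c *: delta k (empty_word n).
Proof.
have g0 : graded 0 0 (c *: delta k (empty_word n)).
  apply: graded_delta; apply/eqP; rewrite cards_eq0; apply/eqP/setP=> r; by rewrite !inE ffunE.
have [_ /(_ (ex_intro _ _ (esym (mul1r _))))[y gy ->]] := boundary_bottom qi n0 g0.
by exists y.
Qed.

(** In degree 0 every chain is a cycle, and its class is its image in [V_1 \otimes V_1^*].
    Boundaries map to multiples of [coev1], and by [coev1_boundary] all multiples occur. *)
Lemma V2_iso : Uq_iso (qAKh q qi B 0 (- n%:Z)) (V2 q qi).
Proof.
have spanc v : Defs.span (fun v => v = coev1 qi) v <-> exists c : k, v = c *: coev1 qi.
  split=> [|[c ->]]; last by apply/spanZ/span_mem.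
  elim=> [|c u w -> _ [d ->]]; first by exists 0; rewrite scale0r.
  by exists (c + d); rewrite scalerDl.
have inter X X0 : (forall l, X0 l 0 = 0) ->
    @intertwines k (qAKh q qi B 0 (- n%:Z)) (V2 q qi) (fun x => phi qi (x (ones n))) (act qi X X0 B) X.
  move=> h x /= [cx _]; rewrite act_vertical //; split.
    exact/height0_cycle/vertical_cube_in_C.
  by rewrite /vertical_cube ffunE eqxx phi_psi subrr; apply: Defs.span_zero.
exists (fun x => phi qi (x (ones n))); split; split; try exact: inter.
- by [].
- by move=> c x y _ _ /=; rewrite !ffunE phiZD subrr; apply: Defs.span_zero.
- move=> x [cx _] /=; have vx := in_C_valid cx; split.
    case/spanc => c e; have [y gy dy] := coev1_boundary c.
    have y0 : y (empty_word n) = 0 by apply: graded_empty gy.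
    have cy : in_C B (0 - 1) (- n%:Z) (cube_of y).
      by have := cube_of_in_C gy isT; rewrite muln0 subr0 sub0r.
    exists (cube_of y) => //; have vy := in_C_valid cy.
    apply/(in_rel_subP q qi vx (@valid_d _ _ _)).
    rewrite (phi_diff hq) // word_part_cube_of // e dy !ffunE eqxx [_ *: (1%R : k^o)]mulr1; split=> //.
    rewrite (word_part_height0 cx); apply/ffunP=> w; rewrite [LHS]ffunE.
    case: (altP (w =P empty_word n)) => [->|we]; first by rewrite word_part_empty.
    by rewrite (word_part_diff hq) // word_part_cube_of // dy !ffunE (negPf we); apply/esym; exact: mulr0.
  case=> y cy rel; have vy := in_C_valid cy; apply/spanc.
  have [_ ->] := (in_rel_subP q qi vx (@valid_d _ _ y)).1 rel.
  by rewrite (phi_diff hq) //; eexists.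
- move=> v _; exists (vertical_cube v); first exact/height0_cycle/vertical_cube_in_C.
  by rewrite /vertical_cube /= ffunE eqxx phi_psi subrr; apply: Defs.span_zero.
Qed.

(** With [formula_gamma]: the two elements differ by a unit, so they have the same kernel and
    generate the same ideal. *)
Lemma gamma_formula D : (0 < D)%N -> gamma qi D = qi ^+ 2 * (-1) ^+ D * (q ^+ 2 + (-1) ^+ D).
Proof.
move=> D0; have -> : gamma qi D = qi ^+ 2 + (-1) ^+ D by case: D D0.
have ss : (-1) ^+ D * (-1) ^+ D = 1 :> k by rewrite -exprMn mulrNN mulr1 expr1n.
move: ss; set s := (-1) ^+ D => ss.
ring: hq ss.
Qed.

Lemma formula_gamma D : (0 < D)%N -> q ^+ 2 + (-1) ^+ D = q ^+ 2 * (-1) ^+ D * gamma qi D.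
Proof.
move=> D0; rewrite gamma_formula //.
have ss : (-1) ^+ D * (-1) ^+ D = 1 :> k by rewrite -exprMn mulrNN mulr1 expr1n.
move: ss; set s := (-1) ^+ D => ss.
ring: hq ss.
Qed.

Lemma V0_mod_iso z : (0 < z < n)%N ->
  Uq_iso (qAKh q qi B (- z%:Z) (- n%:Z - (2 * z)%:Z)) (V0_mod (q ^+ 2 + (-1) ^+ z)).
Proof.
case/andP=> z0 zn; apply: (model_iso hq z0 (F := @eps_part k n)) => //.
- by exists 0; rewrite mulr0.
- move=> y gy _; rewrite (boundary_bottom qi zn gy); split=> -[u ->].
    by exists (qi ^+ 2 * (-1) ^+ z * u); rewrite gamma_formula //; ring.
  by exists (q ^+ 2 * (-1) ^+ z * u); rewrite formula_gamma //; ring.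
- move=> c _; have [x gx <-] := bottom_onto c (ltnW zn).
  by exists x; split=> //; exact: (diff_bottom qi gx).
Qed.

(** With all [n] positions occupied no word is lower, so [bottom_chain] applies. *)
Lemma full_chain (y : {ffun word n -> k^o}) : graded n n y ->
  y = (y (bottom_word n n) : k) *: delta k (bottom_word n n).
Proof.
move=> gy; apply: bottom_chain => // u /andP[/andP[an _] /negP sa].
case: (y u =P 0) => // /gy[lu _]; case: sa; rewrite -[lead u]/(val (Ordinal an)) suppE.
have /setP/(_ (Ordinal an)) : [set t | u t != None] = setT.
  by apply/eqP; rewrite eqEcard subsetT cardsT card_ord -/(letters u) lu leqnn.
by rewrite !inE.
Qed.

Lemma V0_iso : Uq_iso (qAKh q qi B (- n%:Z) (- n%:Z - (2 * n)%:Z)) (V0 k).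
Proof.
apply: (model_iso hq n0 (F := @eps_part k n)) => //.
- move=> y gy _; split=> [[v /(graded_gt (ltnSn n)) -> ->]|].
    by rewrite /word_diff !lin0.
  rewrite [y in lin _ y](full_chain gy) lin_scale_delta => e.
  exists 0; first by move=> w; rewrite ffunE.
  rewrite /word_diff lin0 (full_chain gy).
  suff -> : y (bottom_word n n) = 0 by rewrite scale0r.
  move: e; rewrite /eps_part => /(congr1 (fun c : k => c * eps k (bottom_word n n))).
  by rewrite -mulrA epsM mulr1 mul0r.
- move=> c _; have [x gx <-] := bottom_onto c (leqnn n).
  by exists x; split=> //; exact: (diff_bottom qi gx).
Qed.

Lemma V0_ker_iso D : (0 < D < n)%N ->
  Uq_iso (qAKh q qi B (- D.+1%:Z) (- n%:Z - (2 * D)%:Z)) (V0_ker (q ^+ 2 + (-1) ^+ D)).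
Proof.
case/andP=> D0 Dn; apply: (model_iso hq _ (F := @open_part k n)) => //.
- move=> y gy dy; rewrite formula_gamma // -mulrA (open_cycle gy dy); exact: mulr0.
- move=> y gy dy; exact: boundary_open.
- move=> c hc; apply: open_onto => //; rewrite gamma_formula // -mulrA hc; exact: mulr0.
Qed.

Lemma vanishing z D : (0 < z)%N -> ~~ (0 < z < n)%N || (D != z) -> ~~ ((z == n) && (D == n)) ->
  ~~ [&& (0 < D)%N, (D < n)%N & z == D.+1] ->
  Uq_iso (qAKh q qi B (- z%:Z) (- n%:Z - (2 * D)%:Z)) (zero_obj k).
Proof.
move=> z0 h1 h2 h3; apply: model_zero => // y gy dy.
case: (ltnP n z) => nz.
  by exists 0; [move=> w; rewrite ffunE|rewrite (graded_gt nz gy) /word_diff lin0].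
have [e|/eqP zD] := altP (z =P D).
  by move: h1 h2; rewrite -e z0 eqxx orbF /= andbb -leqNgt => nz'; rewrite eqn_leq nz nz'.
have [e|/eqP zD1] := altP (z =P D.+1); last exact: acyclic zD zD1 gy dy.
(* What remains is [z = 1], [D = 0], where the kernel of [gamma 0 = 1] is zero. *)
rewrite e in gy nz *; have D0 : D = 0%N.
  by move: h3; rewrite e eqxx andbT nz andbT; case: (D).
apply/(boundary_open gy dy); have := open_cycle gy dy.
by rewrite D0 mul1r.
Qed.

End Assembly.

Theorem proposition6p9 (k : comPzRingType) (q qi : k) (hq : q * qi = 1)
    (n : nat) (hn : (0 < n)%N) (i j : int) :
  Uq_iso (qAKh q qi (sigma_neg n) i j) (qAKh_T2n_formula q qi n i j).
Proof.
rewrite /qAKh_T2n_formula.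
have [->|/eqP i0] := altP (i =P 0).
  case: (altP (j =P - n%:Z)) => [->|jn] /=; first exact: V2_iso.
  rewrite andbF; have -> : (0 == - n%:Z) = false by rewrite eq_sym oppr_eq0 eqz_nat eqn0Ngt hn.
  rewrite andbF /=; apply: (zero_iso hq) => x cx; first exact: phi_zero_degree jn cx.
  exact: word_part_height0 cx.
(* The only candidates for the numbers of dots and letters. If they do not give back [(i, j)], no
   word lives in this bidegree. *)
rewrite /=; pose D := (absz (j + n%:Z))./2; pose z := absz i.
have [e|ne] := altP ((i, j) =P (- z%:Z, - n%:Z - (2 * D)%:Z)); last first.
  have form z' D' : (i, j) != (- z'%:Z, - n%:Z - (2 * D')%:Z).
    apply: contraNneq ne => -[ei ej]; rewrite xpair_eqE /z /D ei ej.
    have -> : - n%:Z - (2 * D')%:Z + n%:Z = - (2 * D')%:Z by rewrite addrAC addNr sub0r.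
    by rewrite !abszN !absz_nat !mul2n doubleK !eqxx.
  rewrite ifF; last by have := form z z; rewrite xpair_eqE /z; lia.
  rewrite ifF; last by have := form z z.-1; rewrite xpair_eqE /z; lia.
  rewrite ifF; last by have := form z z; rewrite xpair_eqE /z; lia.
  apply: (zero_iso hq) => x cx; first by rewrite (phi_zero_height i0 cx) phi0.
  apply/ffunP=> w; rewrite ffunE; apply/eqP; case: eqP => // /eqP /(word_part_graded cx)[ei ej].
  by have := form (letters w) (dotted_letters w); rewrite -ei -ej eqxx.
case: e => ei ej; have z0 : (0 < z)%N by rewrite lt0n absz_eq0; apply/eqP.
move: ei ej; move: z D z0 => z D z0 -> ->; clear i0.
have -> : (- n%:Z + 1 <= - z%:Z <= -1) && (- n%:Z - (2 * D)%:Z == 2 * - z%:Z - n%:Z) = (0 < z < n)%N && (D == z).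
  by lia.
case: ifP => [/andP[zn /eqP ->]|h1]; first by rewrite /sgnz abszN absz_nat; exact: V0_mod_iso.
have -> : (- n%:Z <= - z%:Z <= -2) && (- n%:Z - (2 * D)%:Z == 2 * - z%:Z - n%:Z + 2) =
   [&& (0 < D)%N, (D < n)%N & z == D.+1].
  by lia.
case: ifP => [/and3P[D0 Dn /eqP ->]|h2].
  (* Here [i = -(D + 1)], so minus the sign of [i] is [(-1) ^+ D]. *)
  rewrite /sgnz abszN absz_nat [(-1) ^+ _]exprS mulN1r opprK; apply: V0_ker_iso => //.
  by rewrite D0.
have -> : (- z%:Z == - n%:Z) && (- n%:Z - (2 * D)%:Z == - 3 * n%:Z) = (z == n) && (D == n).
  by lia.
case: ifP => [/andP[/eqP -> /eqP ->]|h3]; first exact: V0_iso.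
apply: vanishing => //; [by rewrite -negb_and h1|by rewrite h3|by rewrite h2].
Qed.
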